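(* Let $G$ be a locally compact group such that the Rajchman algebra $B_0(G)$ is regular. Then the group $(B_0(G)\oplus\mathbb{C}1)^{-1}/\exp(B_0(G)\oplus\mathbb{C}1)$ is isomorphic to $(A(G)\oplus\mathbb{C}1)^{-1}/\exp(A(G)\oplus\mathbb{C}1)$, and hence $$(B_0(G)\oplus\mathbb{C}1)^{-1}=\exp(B_0(G)\oplus\mathbb{C}1)\,(A(G)\oplus\mathbb{C}1)^{-1}.$$
   Context: $B(G)$ is the Fourier-Stieltjes algebra of $G$ (linear span of the continuous positive definite functions, with norm as the dual of $C^*(G)$ and pointwise multiplication). $A(G)$ is the Fourier algebra, the closed ideal of $B(G)$ generated by the compactly supported elements of $B(G)$. $B_0(G)=B(G)\cap C_0(G)$ is the Rajchman algebra; $A(G)\subseteq B_0(G)$. A commutative Banach algebra $A$ with Gelfand spectrum $\Delta(A)$ is regular if for every closed $E\subset\Delta(A)$ and $\gamma\in\Delta(A)\setminus E$ there is $a\in A$ with $\widehat{a}=0$ on $E$ and $\widehat{a}(\gamma)\ne0$. For a unital commutative Banach algebra $A$, $A^{-1}$ is its group of invertible elements and $\exp(A)=\{e^a:a\in A\}$. $A(G)\oplus\mathbb{C}1$ and $B_0(G)\oplus\mathbb{C}1$ denote the subalgebras $A(G)+\mathbb{C}1$ and $B_0(G)+\mathbb{C}1$ of $B(G)$, where $1$ is the constant function. *)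

(* Defs.v *)
From HB Require Import structures.
From mathcomp Require Import all_boot all_order all_algebra.
From mathcomp Require Import complex.
From mathcomp Require Import all_classical all_reals all_analysis.

Set Implicit Arguments.
Unset Strict Implicit.
Unset Printing Implicit Defensive.

Import Order.TTheory GRing.Theory Num.Theory.
Import numFieldNormedType.Exports.

Local Open Scope classical_set_scope.
Local Open Scope ring_scope.

(* The complex numbers, under a head symbol from which the norm topology of a
   [numClosedFieldType] is inferred ([R[i]] itself carries no canonical
   topology).  On this type [0 <= z] means that z is a nonnegative real. *)
Definition Cplx (R : realType) : numClosedFieldType := R[i].

(* The norm [`|z|] of the library is itself a complex number. *)
Definition modulus (R : realType) (z : Cplx R) : R := complex.Re `|z|.

HB.mixin Record isTopologicalGroup G of Group G & Topological G := {
  mulg_continuous : continuous (fun x : G * G => (x.1 * x.2)%g) ;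
  invg_continuous : continuous (fun x : G => (x^-1)%g)
}.

#[short(type="topologicalGroupType")]
HB.structure Definition TopologicalGroup :=
  {G of isTopologicalGroup G & Group G & Topological G}.

Section function_algebras.
Variables (R : realType) (X : Type).
Local Notation C := (Cplx R).
Implicit Types (S : set (X -> C)) (u v w : X -> C).

(* A subalgebra S of the algebra of all functions on X is a [set (X -> C)];
   as a type, S is the type of its elements and [val] the inclusion. *)

(* Delta(S), with the Gelfand topology: the topology of pointwise convergence
   on the functions S -> C. *)
Definition spectrum S : set {ptws S -> C} := [set chi |
  [/\ exists a : S, chi a != 0,
      forall (c : C) (a b d : S), val d = c *: val a + val b ->
        chi d = c * chi a + chi b
    & forall a b d : S, val d = val a * val b -> chi d = chi a * chi b]].

(* The closed subsets of Delta(S) are the traces of the closed subsets of the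
   ambient space. *)
Definition regular_algebra S : Prop :=
  forall (F : set {ptws S -> C}) (gamma : {ptws S -> C}),
    closed F -> spectrum gamma -> ~ F gamma ->
    exists a : S, (forall chi, (F `&` @spectrum S) chi -> chi a = 0) /\
                  gamma a != 0.

Definition unitization S : set (X -> C) :=
  [set u | exists2 v, S v & exists c : C, u = v + cst c].

Definition invertibles S : set (X -> C) :=
  [set u | S u /\ exists2 v, S v & u * v = 1].

Definition setprod (A B : set (X -> C)) : set (X -> C) :=
  [set u | exists2 a, A a & exists2 b, B b & u = a * b].

(* The elements of a quotient group U / N, as cosets; their product in U / N is
   [setprod]. *)
Definition cosets (U N : set (X -> C)) : set (set (X -> C)) :=
  [set setprod [set u] N | u in U].

Definition quotients_isomorphic (U N U' N' : set (X -> C)) : Prop :=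
  exists Phi : set (X -> C) -> set (X -> C),
    set_bij (cosets U N) (cosets U' N') Phi /\
    (forall P Q, cosets U N P -> cosets U N Q ->
       Phi (setprod P Q) = setprod (Phi P) (Phi Q)).

End function_algebras.

Section fourier_stieltjes.
Variables (R : realType) (G : topologicalGroupType).
Local Notation C := (Cplx R).
Implicit Types (u v w f phi : G -> C).

Definition compactly_supported f : Prop := compact (closure [set x | f x != 0]).

Definition Cc : set (G -> C) :=
  [set f | continuous f /\ compactly_supported f].

Definition C0 : set (G -> C) := [set f | continuous f /\
  forall e : R, 0 < e ->
    exists2 K, compact K & forall x, ~ K x -> modulus (f x) < e].

(* Integration against a left Haar measure, viewed as a Radon measure, that is,
   as a positive linear functional on Cc(G).  Values outside Cc(G) are
   irrelevant. *)
Record left_haar_integral (I : (G -> C) -> C) : Prop := LeftHaarIntegral {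
  haar_linear : forall (c : C) f g, Cc f -> Cc g ->
    I (c *: f + g) = c * I f + I g ;
  haar_pos : forall f, Cc f -> (forall x, 0 <= f x) -> 0 <= I f ;
  haar_invariant : forall f (y : G), Cc f -> I (fun x => f (y * x)%g) = I f ;
  haar_neq0 : exists2 f, Cc f & I f != 0 }.

Definition positive_definite phi : Prop :=
  forall n (x : 'I_n -> G) (c : 'I_n -> C),
    0 <= \sum_(i < n) \sum_(j < n)
           Num.conj (c i) * c j * phi ((x i)^-1 * x j)%g.

(* B(G) as a set of functions; its norm is [fs_norm] below. *)
Definition FS : set (G -> C) := [set u | exists n (c : 'I_n -> C)
  (phi : 'I_n -> G -> C),
  (forall i, continuous (phi i) /\ positive_definite (phi i)) /\
  u = \sum_(i < n) c i *: phi i].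

(* A complete normed space whose norm comes from an inner product (linear in
   its first argument) is a Hilbert space. *)
Definition hilbert_product (H : completeNormedModType C)
    (ip : {dot H for @Num.conj C}) : Prop :=
  forall xi : H, `|xi| ^+ 2 = ip xi xi.

Record unitary_rep (H : completeNormedModType C)
    (ip : {dot H for @Num.conj C}) (pi : G -> {linear H -> H}) : Prop :=
  UnitaryRep {
  rep1 : forall xi, pi 1%g xi = xi ;
  repM : forall x y xi, pi (x * y)%g xi = pi x (pi y xi) ;
  rep_unitary : forall x xi eta, ip (pi x xi) (pi x eta) = ip xi eta ;
  rep_continuous : forall xi, continuous (fun x => pi x xi) }.

Section norms.
Variable I : (G -> C) -> C.

(* The operator norm of pi(f), the operator determined by
   <pi(f) xi, eta> = \int f(x) <pi(x) xi, eta> dx. *)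
Definition rep_norm (H : completeNormedModType C)
    (ip : {dot H for @Num.conj C}) (pi : G -> {linear H -> H}) f : \bar R :=
  ereal_sup [set t | exists xi eta : H, [/\ `|xi| <= 1, `|eta| <= 1 &
    t = (modulus (I (fun x => f x * ip (pi x xi) eta)))%:E]].

(* The norm of C*(G) on its dense subspace Cc(G). *)
Definition cstar_norm f : \bar R :=
  ereal_sup [set t | exists (H : completeNormedModType C)
    (ip : {dot H for @Num.conj C}) (pi : G -> {linear H -> H}),
    [/\ hilbert_product ip, unitary_rep ip pi & t = rep_norm ip pi f]].

(* The norm of u as the functional f |-> \int f u on C*(G). *)
Definition fs_norm u : \bar R :=
  ereal_sup [set (modulus (I (f * u)))%:E |
    f in [set f | Cc f /\ (cstar_norm f <= 1)%E]].

Definition fs_closed (J : set (G -> C)) : Prop :=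
  forall u, FS u ->
    (forall e : R, 0 < e -> exists2 v, J v & (fs_norm (u - v)%R < e%:E)%E) -> J u.

Definition closed_ideal (J : set (G -> C)) : Prop :=
  [/\ J `<=` FS, J 0,
      forall (c : C) u v, J u -> J v -> J (c *: u + v),
      forall u v, FS u -> J v -> J (u * v)
    & fs_closed J].

Definition fourier_algebra : set (G -> C) :=
  smallest closed_ideal (FS `&` compactly_supported).

(* exp(S) for a subalgebra S of B(G): w = e^a means that the exponential series
   of a converges to w in the norm of B(G). *)
Definition exp_set (S : set (G -> C)) : set (G -> C) :=
  [set w | FS w /\ exists2 a, S a &
    fs_norm (w - \sum_(k < n) (k`!%:R : C)^-1 *: a ^+ k) @[n --> \oo] --> 0%E].

End norms.

Definition rajchman_algebra : set (G -> C) := FS `&` C0.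

End fourier_stieltjes.

Arguments Cc R G : clear implicits.
Arguments C0 R G : clear implicits.
Arguments FS R G : clear implicits.
Arguments rajchman_algebra R G : clear implicits.

(* Main.v *)
Require Import Defs.
From HB Require Import structures.
From mathcomp Require Import all_boot all_order all_algebra.
From mathcomp Require Import complex spectral sesquilinear ring lra.
From mathcomp Require Import all_classical all_reals all_analysis.

Set Implicit Arguments.
Unset Strict Implicit.
Unset Printing Implicit Defensive.

Import Order.TTheory GRing.Theory Num.Theory.
Import numFieldNormedType.Exports.

Local Open Scope classical_set_scope.
Local Open Scope ring_scope.

(** Let E = exp(B0(G) + C1), and let U and V be the groups of invertible
    elements of B0(G) + C1 and of A(G) + C1.  If U = E V and if E meets V in
    exp(A(G) + C1), then the inclusion of V in U induces the isomorphism of the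
    quotients ([quotients_isomorphic_of_product]).  When G is compact
    A(G) = B0(G) = B(G), so let G be noncompact.

    Regularity says that the spectrum of B0(G) is G: a character outside the
    closure of the evaluations would be separated from all of them by a function
    that vanishes on G, hence is 0, and a nonzero limit of evaluations is the
    evaluation at a cluster point of points in a compact set
    ([spectrum_evaluation]).  By Gelfand theory an element b + c with c <> 0 that
    vanishes nowhere on G is invertible ([nonvanishing_invertible]).  Both facts about U, E and V follow by
    dividing by well-chosen nonvanishing functions, with the help of functions
    v >= 0 of A(G) that are positive on a given compact set: autocorrelations of
    elements of Cc(G) ([exists_cpd_positive]).

    For U = E V ([invertible_factorization]), write u = c (1 + b') and
    b1 = b' / (1 + v) with v so large that |b1| < 1.  All 1 + t b1 with t in [0, 1]
    are invertible, so 1 + b1 is an exponential ([log_of_invertible_segment]),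
    and u / (1 + b1) is in A(G) + C1 since v is in the ideal A(G).  For the
    intersection ([exp_meets_fourier], [exp_fourier_log]), if e^b - 1 = b h is in
    A(G), then so is b (|h|^2 + v), and |h|^2 + v is invertible when v is
    positive on the compact set where h may vanish.

    All of this needs a Banach algebra norm on B(G).  The infimum of
    \sum_i |c_i| phi_i(1) over the representations of u as a combination of
    continuous positive definite functions is one by elementary means
    ([FS_banach_algebra]), and it also makes B0(G) + C1 complete.  It is linked to
    the norm of the dual of C*(G), in which A(G) and the exponentials are
    defined, by
      sup |u| <= fs_norm u <= pd_norm u.
    The first inequality tests u against approximate units ([sup_le_fs_norm]),
    the second is the GNS construction ([fs_norm_le_pd_norm]).  Hence the
    elements of A(G) vanish at infinity and both meanings of e^a agree
    ([exp_setE]).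

    The Gelfand-Mazur theorem is proved without complex integration: the mean of
    the resolvent over the vertices of a square of radius r agrees with its value
    at the centre up to order r^4 ([resolvent_mean]), which is enough for a
    maximum principle. *)

(** * Complex numbers *)

Section complex_numbers.
Variable R : realType.
Local Notation C := (Cplx R).
Implicit Types (z w : C) (x y : R).

Definition rc x : C := x%:C%C.

Fact rc_zmod_morphism : zmod_morphism rc.
Proof. exact: (raddfB (real_complex R)). Qed.

Fact rc_monoid_morphism : monoid_morphism rc.
Proof. by split=> [//|x y]; exact: (rmorphM (real_complex R)). Qed.

HB.instance Definition _ := GRing.isZmodMorphism.Build R C rc rc_zmod_morphism.
HB.instance Definition _ :=
  GRing.isMonoidMorphism.Build R C rc rc_monoid_morphism.

Lemma rcD x y : rc (x + y) = rc x + rc y. Proof. exact: (rmorphD rc). Qed.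
Lemma rcB x y : rc (x - y) = rc x - rc y. Proof. exact: (rmorphB rc). Qed.
Lemma rcM x y : rc (x * y) = rc x * rc y. Proof. exact: (rmorphM rc). Qed.
Lemma rcV x : rc x^-1 = (rc x)^-1. Proof. exact: (fmorphV rc). Qed.
Lemma rcX x n : rc (x ^+ n) = rc x ^+ n. Proof. exact: (rmorphXn rc). Qed.
Lemma rcMn x n : rc (x *+ n) = rc x *+ n. Proof. exact: (rmorphMn rc). Qed.
Lemma rc_nat n : rc n%:R = n%:R. Proof. exact: (rmorph_nat rc). Qed.
Lemma rc_sum (T : Type) (s : seq T) (P : pred T) (F : T -> R) :
  rc (\sum_(i <- s | P i) F i) = \sum_(i <- s | P i) rc (F i).
Proof. exact: (raddf_sum rc). Qed.

Local Notation Re := (@complex.Re R).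
Local Notation Im := (@complex.Im R).

Definition ii : C := 'i%C.

Lemma ReD z w : Re (z + w) = Re z + Re w.
Proof. by case: z; case: w. Qed.

Lemma ImD z w : Im (z + w) = Im z + Im w.
Proof. by case: z; case: w. Qed.

Lemma ReN z : Re (- z) = - Re z. Proof. by case: z. Qed.
Lemma ImN z : Im (- z) = - Im z. Proof. by case: z. Qed.
Lemma Re_rc x : Re (rc x) = x. Proof. by []. Qed.
Lemma Im_rc x : Im (rc x) = 0. Proof. by []. Qed.

Lemma rcI : injective rc. Proof. by move=> x y []. Qed.

Lemma cplxE z : z = rc (Re z) + ii * rc (Im z).
Proof. exact: complexE. Qed.

Lemma cplx_eqP z w : Re z = Re w -> Im z = Im w -> z = w.
Proof. by case: z; case: w => ? ? ? ? /= -> ->. Qed.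

Lemma rc_ge0 x : (0 <= rc x) = (0 <= x).
Proof. by rewrite -[0 in LHS]/(rc 0) [LHS]lecE /= eqxx. Qed.

Lemma ge0_rc z : 0 <= z -> z = rc (Re z) /\ 0 <= Re z.
Proof.
rewrite [_ <= _]lecE /= => /andP[/eqP h0 h1]; split=> //.
by apply: cplx_eqP.
Qed.

Lemma ge0_rcP z : 0 <= z -> exists2 x, 0 <= x & z = rc x.
Proof. by move=> /ge0_rc[h1 h2]; exists (Re z). Qed.

Lemma normC_modulus z : `|z| = rc (modulus z).
Proof. by have /ge0_rc[] := normr_ge0 z. Qed.

Lemma modulus_ge0 z : 0 <= modulus z.
Proof. by have /ge0_rc[] := normr_ge0 z. Qed.

Lemma modulus_le z t : (modulus z <= t) = (`|z| <= rc t).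
Proof. by rewrite normC_modulus -subr_ge0 -[RHS]subr_ge0 -rcB rc_ge0. Qed.

Lemma modulus_rc x : modulus (rc x) = `|x|.
Proof.
by rewrite /modulus [`|rc x|]normc_def /= expr0n addr0 sqrtr_sqr.
Qed.

Lemma modulus_ge0_rc x : 0 <= x -> modulus (rc x) = x.
Proof. by move=> h; rewrite modulus_rc ger0_norm. Qed.

Lemma modulus0 : modulus (0 : C) = 0.
Proof. by rewrite -[0 in LHS]/(rc 0) modulus_rc normr0. Qed.

Lemma modulus1 : modulus (1 : C) = 1.
Proof. by rewrite -[1 in LHS]/(rc 1) modulus_rc normr1. Qed.

Lemma modulus_eq0 z : (modulus z == 0) = (z == 0).
Proof. by rewrite -[RHS]normr_eq0 normC_modulus -[0 in RHS]/(rc 0) (inj_eq rcI). Qed.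

Lemma modulus_gt0 z : (0 < modulus z) = (z != 0).
Proof. by rewrite lt_def modulus_ge0 andbT modulus_eq0. Qed.

Lemma modulusD z w : modulus (z + w) <= modulus z + modulus w.
Proof. by rewrite modulus_le rcD -!normC_modulus ler_normD. Qed.

Lemma modulusN z : modulus (- z) = modulus z.
Proof. by rewrite /modulus normrN. Qed.

Lemma modulusB z w : modulus (z - w) <= modulus z + modulus w.
Proof. by rewrite (le_trans (modulusD _ _))// modulusN. Qed.

Lemma modulus_sub z w : modulus (z - w) = modulus (w - z).
Proof. by rewrite -modulusN opprB. Qed.

Lemma modulusM z w : modulus (z * w) = modulus z * modulus w.
Proof. by apply: rcI; rewrite rcM -!normC_modulus normrM. Qed.

Lemma modulusX z n : modulus (z ^+ n) = modulus z ^+ n.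
Proof. by elim: n => [|n ih]; rewrite ?expr0 ?modulus1// !exprS modulusM ih. Qed.

Lemma modulusV z : modulus z^-1 = (modulus z)^-1.
Proof. by apply: rcI; rewrite rcV -!normC_modulus normfV. Qed.

Lemma modulus_conj z : modulus (Num.conj z) = modulus z.
Proof. by rewrite /modulus norm_conjC. Qed.

Lemma modulus_sum (T : Type) (s : seq T) (P : pred T) (F : T -> C) :
  modulus (\sum_(i <- s | P i) F i) <= \sum_(i <- s | P i) modulus (F i).
Proof.
elim/big_ind2 : _ => //; first by rewrite modulus0.
by move=> a b c d h1 h2; rewrite (le_trans (modulusD _ _))// lerD.
Qed.

Lemma modulus_ii : modulus ii = 1.
Proof. by rewrite /modulus [`|ii|]normc_def /= expr0n expr1n add0r sqrtr1. Qed.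

Lemma ii2 : ii * ii = -1.
Proof. by have := sqr_i R; rewrite expr2. Qed.

Lemma conj_ii : Num.conj ii = - ii.
Proof. by apply: cplx_eqP; rewrite //= oppr0. Qed.

Lemma conj_rc x : Num.conj (rc x) = rc x.
Proof. by apply: cplx_eqP; rewrite //= oppr0. Qed.

Lemma Re_conj z : Re (Num.conj z) = Re z. Proof. by case: z. Qed.
Lemma Im_conj z : Im (Num.conj z) = - Im z. Proof. by case: z. Qed.

Lemma addC_conj z : z + Num.conj z = rc (2 * Re z).
Proof.
by apply: cplx_eqP; rewrite ?ReD ?ImD ?Re_conj ?Im_conj /= ?subrr //; ring.
Qed.

Lemma mulC_conj z : z * Num.conj z = rc (modulus z ^+ 2).
Proof. by rewrite rcX -normC_modulus normCK. Qed.

Lemma Re_le_modulus z : `|Re z| <= modulus z.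
Proof.
by rewrite -subr_ge0 -rc_ge0 rcB -normC_modulus subr_ge0; exact: normc_ge_Re.
Qed.

Lemma Im_le_modulus z : `|Im z| <= modulus z.
Proof.
have := Re_le_modulus (- ii * z).
rewrite modulusM modulusN modulus_ii mul1r; congr (`|_| <= _).
by case: z => a b /=; ring.
Qed.

Lemma modulus_dist z w : `|modulus z - modulus w| <= modulus (z - w).
Proof.
rewrite ler_norml; apply/andP; split.
  by rewrite lerBrDr addrC lerBlDr -[w in leLHS](subrK z)
    (le_trans (modulusD _ _))// modulus_sub addrC.
by rewrite lerBlDr -{1}[z](subrK w) modulusD.
Qed.

(** The core of every Cauchy-Schwarz inequality below: the hypothesis says that
    |xi + t eta|^2 is nonnegative, where a, b, c stand for |xi|^2, |eta|^2 and
    the scalar product of xi and eta. *)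
Lemma quadratic_discriminant (a b : R) (c : C) : 0 <= a -> 0 <= b ->
  (forall t : C, 0 <= Re (rc a + Num.conj t * c + t * Num.conj c +
                        t * Num.conj t * rc b)) ->
  modulus c ^+ 2 <= a * b.
Proof.
move=> a0 b0 H.
have key s : 0 <= a + s * (modulus c ^+ 2) *+ 2 + s ^+ 2 * modulus c ^+ 2 * b.
  have := H (rc s * c).
  rewrite rmorphM /= conj_rc.
  have -> : rc a + rc s * Num.conj c * c + rc s * c * Num.conj c +
    rc s * c * (rc s * Num.conj c) * rc b = rc a + rc s * (c * Num.conj c) *+ 2
    + rc s ^+ 2 * (c * Num.conj c) * rc b by ring.
  by rewrite mulC_conj -!(rcM, rcX, rcMn, rcD).
have m0 := modulus_ge0 c; set m := modulus c ^+ 2 in key *.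
have m1 : 0 <= m by rewrite exprn_ge0.
(* The real quadratic in s attains its minimum at s = - 1 / b; when b = 0 it
   is affine, and negative at s = - (a + 1) / m unless m = 0. *)
have [b_0|bN0] := eqVneq b 0.
  rewrite b_0 mulr0 in key *.
  rewrite leNgt; apply/negP => mp.
  have := key (- (a + 1) / m); rewrite -mulr_natr.
  have -> : a + - (a + 1) / m * m * 2%:R + (- (a + 1) / m) ^+ 2 * m * 0 = - a - 2.
    by field; rewrite gt_eqF.
  lra.
have bp : 0 < b by rewrite lt_def bN0.
have := key (- b^-1); rewrite -mulr_natr.
have -> : a + - b^-1 * m * 2%:R + (- b^-1) ^+ 2 * m * b = (a * b - m) / b.
  by field.
by rewrite pmulr_lge0 ?invr_gt0// subr_ge0.
Qed.

End complex_numbers.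
Arguments rc {R}.
Arguments ii {R}.

(** * Complex functions and series *)

Section complex_topology.
Variable R : realType.
Local Notation C := (Cplx R).

Lemma cvgC_modulusP (T : Type) (F : set_system T) (FF : Filter F)
    (f : T -> C) (l : C) :
  f @ F --> l <-> forall e : R, 0 < e -> \forall x \near F, modulus (f x - l) < e.
Proof.
have key (e : R) (z : C) : (`|z| < rc e) = (modulus z < e).
  rewrite !lt_neqAle normC_modulus (inj_eq (@rcI R)); congr (_ && _).
  by rewrite modulus_le normC_modulus.
split=> [/cvgrPdist_lt h e e0|h].
  have /h : 0 < rc e by rewrite lt_def rc_ge0 ltW// andbT (inj_eq (@rcI R)) gt_eqF.
  by apply: filterS => x; rewrite key modulus_sub.
apply/cvgrPdist_lt => e; rewrite lt_def => /andP[e1 /ge0_rcP[x x0 ex]].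
move: e1; rewrite {}ex -[0]/(rc 0) (inj_eq (@rcI R)) => xN0.
have /h : 0 < x by rewrite lt_def xN0.
by apply: filterS => y; rewrite key modulus_sub.
Qed.

Lemma continuousC_P (T : topologicalType) (f : T -> C) :
  continuous f <->
  forall x (e : R), 0 < e -> \forall y \near x, modulus (f y - f x) < e.
Proof.
by split=> h x; [have /cvgC_modulusP := h x|apply/cvgC_modulusP; exact: h].
Qed.

Lemma continuous_modulus (T : topologicalType) (f : T -> C) :
  continuous f -> continuous (fun x => modulus (f x) : R).
Proof.
move=> /continuousC_P h x; apply/cvgrPdist_lt => e e0.
near=> y; rewrite distrC (le_lt_trans (modulus_dist _ _))//.
by near: y; exact: h.
Unshelve. all: by end_near. Qed.

Lemma continuousC_of_le (T : topologicalType) (f : T -> C) (g : T -> C) :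
  continuous g -> (forall x y, modulus (f x - f y) <= modulus (g x - g y)) ->
  continuous f.
Proof.
move=> /continuousC_P h le; apply/continuousC_P => x e /(h x).
by apply: filterS => y; apply: le_lt_trans.
Qed.

Lemma continuousC_conj (T : topologicalType) (f : T -> C) :
  continuous f -> continuous (fun x => Num.conj (f x)).
Proof.
move=> h; apply: continuousC_of_le h _ => x y.
by rewrite -rmorphB/= modulus_conj.
Qed.

Lemma continuousC_rc (T : topologicalType) (f : T -> R) :
  continuous f -> continuous (fun x => rc (f x)).
Proof.
move=> h; apply/continuousC_P => x e e0.
have /cvgrPdist_lt/(_ _ e0) := h x.
by apply: filterS => y; rewrite -rcB modulus_rc distrC.
Qed.

Lemma continuousC_Re (T : topologicalType) (f : T -> C) :
  continuous f -> continuous (fun x => complex.Re (f x) : R).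
Proof.
move=> /continuousC_P h x; apply/cvgrPdist_lt => e e0.
near=> y; rewrite distrC -ReN -ReD (le_lt_trans (Re_le_modulus _))//.
by near: y; exact: h.
Unshelve. all: by end_near. Qed.

Lemma continuousC_D (T : topologicalType) (f g : T -> C) :
  continuous f -> continuous g -> continuous (f + g).
Proof. by move=> h1 h2 x; apply: cvgD; [exact: h1|exact: h2]. Qed.

Lemma continuousC_M (T : topologicalType) (f g : T -> C) :
  continuous f -> continuous g -> continuous (f * g).
Proof. by move=> h1 h2 x; apply: cvgM; [exact: h1|exact: h2]. Qed.

Lemma continuousC_Z (T : topologicalType) (c : C) (f : T -> C) :
  continuous f -> continuous (c *: f).
Proof. by move=> h x; apply: (@cvgM _ _ _ _ (cst c)) => //; [exact: cvg_cst|exact: h]. Qed.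

Lemma hausdorffC : hausdorff_space C.
Proof. exact: norm_hausdorff. Qed.

End complex_topology.

Section series_tails.
Variable R : realType.
Local Notation C := (Cplx R).
Implicit Types (a b : R^nat).

(** Remainders measure all the rates of convergence below: a limit l of partial
    sums is pinned down by |l - sum| <= tail a n. *)
Definition tail a (n : nat) : R := limn (series a) - series a n.

Lemma tail_cvg0 a : cvgn (series a) -> tail a n @[n --> \oo] --> (0 : R).
Proof.
move=> ca; rewrite -(subrr (limn (series a))); apply: cvgB => //.
exact: cvg_cst.
Qed.

Lemma tail_ge a n m : (forall k, 0 <= a k) -> cvgn (series a) -> (n <= m)%N ->
  \sum_(n <= k < m) a k <= tail a n.
Proof.
move=> a0 ca nm; rewrite /tail lerBrDr addrC.
have -> : series a n + \sum_(n <= k < m) a k = series a m.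
  by rewrite /series /= -big_cat_nat.
apply: nondecreasing_cvgn_le => //; apply/nondecreasing_seqP => k.
by rewrite /series /= big_nat_recr //= lerDl.
Qed.

Lemma tail_ge0 a n : (forall k, 0 <= a k) -> cvgn (series a) -> 0 <= tail a n.
Proof. by move=> a0 ca; have := tail_ge a0 ca (leqnn n); rewrite big_geq. Qed.

Lemma complex_series_cvg (z : nat -> C) a :
  (forall k, modulus (z k) <= a k) -> cvgn (series a) ->
  exists l : C, forall n, modulus (l - \sum_(k < n) z k) <= tail a n.
Proof.
move=> za ca.
have a0 k : 0 <= a k by exact: le_trans (modulus_ge0 _) (za k).
have cpart (p : C -> R) : (forall w, `|p w| <= modulus w) ->
    cvgn (series (fun k => p (z k))).
  move=> hp; apply: normed_cvg.
  apply: (@series_le_cvg _ _ a) => // k; first exact: normr_ge0.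
  exact: le_trans (hp _) (za k).
set zr := fun k => complex.Re (z k).
set zi := fun k => complex.Im (z k).
have cr : cvgn (series zr) by apply: cpart => w; exact: Re_le_modulus.
have ci : cvgn (series zi) by apply: cpart => w; exact: Im_le_modulus.
exists (rc (limn (series zr)) + ii * rc (limn (series zi))) => n.
set l := rc _ + ii * rc _.
have sE m : \sum_(k < m) z k = rc (series zr m) + ii * rc (series zi m).
  rewrite /series /= !big_mkord !rc_sum mulr_sumr -big_split /=.
  by apply: eq_bigr => i _; rewrite [LHS]cplxE.
apply/ler_addgt0Pr => e e0.
have e2 : 0 < e / 2 by rewrite divr_gt0.
have /cvgrPdist_lt/(_ _ e2)[N1 _ h1] := cr.
have /cvgrPdist_lt/(_ _ e2)[N2 _ h2] := ci.
pose m := maxn n (maxn N1 N2).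
have -> : l - \sum_(k < n) z k =
  (\sum_(k < m) z k - \sum_(k < n) z k) + (l - \sum_(k < m) z k) by ring.
rewrite (le_trans (modulusD _ _))//.
apply: lerD.
  have nm : (n <= m)%N by rewrite leq_maxl.
  have mk p : \sum_(k < p) z k = \sum_(0 <= k < p) z k by rewrite big_mkord.
  rewrite !mk (@big_cat_nat _ _ _ n) //= addrAC subrr add0r.
  rewrite (le_trans (modulus_sum _ _ _))// (le_trans _ (tail_ge a0 ca nm))//.
  by apply: ler_sum.
rewrite sE /l.
have -> : forall x y x' y' : R, rc x + ii * rc y - (rc x' + ii * rc y') =
    rc (x - x') + ii * rc (y - y') :> C by move=> *; rewrite !rcB; ring.
rewrite (le_trans (modulusD _ _))// modulusM modulus_ii mul1r !modulus_rc.
rewrite [leRHS]splitr; apply: lerD; apply: ltW.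
  by apply: h1; rewrite /= /m !leq_max leqnn orbT.
by apply: h2; rewrite /= /m !leq_max leqnn !orbT.
Qed.

(** Limits of complex sequences are handled through explicit null sequences of
    error bounds. *)
Lemma modulus_limit_unique (z : nat -> C) (t t' : R^nat) (l l' : C) :
  t n @[n --> \oo] --> (0 : R) -> t' n @[n --> \oo] --> (0 : R) ->
  (forall n, modulus (l - z n) <= t n) -> (forall n, modulus (l' - z n) <= t' n) ->
  l = l'.
Proof.
move=> c c' h h'; apply/eqP; rewrite -subr_eq0 -modulus_eq0 eq_le modulus_ge0 andbT.
have cc : t n + t' n @[n --> \oo] --> (0 : R).
  by rewrite -[0 in X in _ --> X]addr0; exact: cvgD.
apply: (ler_cvg_to (cvg_cst (modulus (l - l'))) cc); near=> n.
have -> : l - l' = (l - z n) - (l' - z n) by ring.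
by rewrite (le_trans (modulusB _ _))// lerD.
Unshelve. all: by end_near. Qed.

End series_tails.

(** * Banach algebras of functions *)

Section approximation_from_above.
Variable R : realType.
Implicit Types (a b t : R) (E : set R).

Lemma ge_inf_of_ge0 E t : (forall s, E s -> 0 <= s) -> E t -> inf E <= t.
Proof. by move=> E0 Et; apply: ge_inf => //; exists 0 => s /E0. Qed.

Lemma inf_ge0 E : (forall s, E s -> 0 <= s) -> 0 <= inf E.
Proof.
move=> E0; have [->|E_neq0] := eqVneq E set0; first by rewrite inf0.
by apply: lb_le_inf => //; exact/set0P.
Qed.

(** Submultiplicativity passes to norms that are defined as infima. *)
Lemma le_mul_approx a b t : 0 <= a -> 0 <= b ->
  (forall a' b', a < a' -> b < b' -> t <= a' * b') -> t <= a * b.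
Proof.
move=> a0 b0 h; rewrite leNgt; apply/negP => lt.
pose d := t - a * b; have d0 : 0 < d by rewrite subr_gt0.
pose e := Num.min 1 (d / (2 * (a + b + 1))).
have c0 : 0 < 2 * (a + b + 1) by lra.
have e0 : 0 < e by rewrite lt_min ltr01 divr_gt0.
have e1 : e <= 1 by rewrite ge_min lexx.
have e2 : e * (2 * (a + b + 1)) <= d by rewrite -ler_pdivlMr// ge_min lexx orbT.
have := h (a + e) (b + e); rewrite !ltrDl => /(_ e0 e0).
have : e * e <= e by rewrite -[leRHS]mul1r ler_pM2r.
rewrite /d in e2 d0; nra.
Qed.

End approximation_from_above.

Section banach_function_algebras.
Variables (R : realType) (X : Type).
Local Notation C := (Cplx R).
Local Notation T := (X -> C).
Implicit Types (S : set T) (N : T -> R) (u v w : T).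

(** A unital commutative Banach algebra of functions.  The norm dominates the
    values of the functions, so that limits in norm are pointwise limits and
    identities between elements can be verified pointwise; completeness is
    stated for absolutely convergent series. *)
Record banach_algebra S N : Prop := BanachAlgebra {
  ba1 : S 1 ;
  ba_lin : forall (c : C) u v, S u -> S v -> S (c *: u + v) ;
  ba_mul : forall u v, S u -> S v -> S (u * v) ;
  ba_ge0 : forall u, 0 <= N u ;
  ba_sup : forall u x, S u -> modulus (u x) <= N u ;
  ba_normD : forall u v, S u -> S v -> N (u + v) <= N u + N v ;
  ba_normZ : forall (c : C) u, S u -> N (c *: u) <= modulus c * N u ;
  ba_normM : forall u v, S u -> S v -> N (u * v) <= N u * N v ;
  ba_complete : forall (u : nat -> T) (a : R^nat), (forall k, S (u k)) ->
    (forall k, N (u k) <= a k) -> cvgn (series a) ->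
    exists2 s, S s & N (s - \sum_(k < n) u k) @[n --> \oo] --> (0 : R) }.

Section theory.
Variables (S : set T) (N : T -> R).
Hypothesis BA : banach_algebra S N.

Lemma ba0 : S 0.
Proof. by have := ba_lin BA (-1) (ba1 BA) (ba1 BA); rewrite scaleN1r addNr. Qed.

Lemma ba_add u v : S u -> S v -> S (u + v).
Proof. by move=> su sv; rewrite -[u]scale1r; exact: (ba_lin BA). Qed.

Lemma ba_scale (c : C) u : S u -> S (c *: u).
Proof. by move=> su; rewrite -[_ *: _]addr0; apply: (ba_lin BA) => //; exact: ba0. Qed.

Lemma ba_opp u : S u -> S (- u).
Proof. by move=> su; rewrite -scaleN1r; apply: ba_scale. Qed.

Lemma ba_sub u v : S u -> S v -> S (u - v).
Proof. by move=> su sv; apply: ba_add => //; exact: ba_opp. Qed.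

Lemma cst_scale1 (c : C) : cst c = c *: (1 : T).
Proof. apply/funext => x. exact: (esym (mulr1 c)). Qed.

Lemma ba_cst (c : C) : S (cst c).
Proof. by rewrite cst_scale1; apply: ba_scale; exact: (ba1 BA). Qed.

Lemma ba_exp u n : S u -> S (u ^+ n).
Proof.
move=> su; elim: n => [|n ih]; first by rewrite expr0; exact: (ba1 BA).
by rewrite exprS; exact: (ba_mul BA).
Qed.

Lemma ba_sum (I : Type) (s : seq I) (P : pred I) (F : I -> T) :
  (forall i, S (F i)) -> S (\sum_(i <- s | P i) F i).
Proof. by move=> h; elim/big_ind : _ => //; [exact: ba0|exact: ba_add]. Qed.

Lemma ba_norm0 : N 0 = 0.
Proof.
apply/eqP; rewrite eq_le (ba_ge0 BA)// andbT.
by have := ba_normZ BA 0 ba0; rewrite scale0r modulus0 mul0r.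
Qed.

Lemma ba_normN u : S u -> N (- u) = N u.
Proof.
have le v : S v -> N (- v) <= N v.
  by move=> sv; have := ba_normZ BA (-1) sv; rewrite scaleN1r modulusN modulus1 mul1r.
move=> su; apply/eqP; rewrite eq_le le //=.
by rewrite -{1}[u]opprK le//; exact: ba_opp.
Qed.

Lemma ba_normB u v : S u -> S v -> N (u - v) <= N u + N v.
Proof.
by move=> su sv; rewrite -(ba_normN sv); apply: (ba_normD BA) => //; exact: ba_opp.
Qed.

Lemma ba_normX u r n : S u -> N u <= r -> N (u ^+ n) <= N 1 * r ^+ n.
Proof.
move=> su ur; have r0 : 0 <= r := le_trans (ba_ge0 BA u) ur.
elim: n => [|n ih]; first by rewrite !expr0 mulr1.
rewrite exprSr (le_trans (ba_normM BA (ba_exp _ su) su))//.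
by rewrite exprSr mulrA ler_pM ?(ba_ge0 BA).
Qed.

Lemma ba_cvg_pointwise (F : nat -> T) s x : S s -> (forall n, S (F n)) ->
  N (s - F n) @[n --> \oo] --> (0 : R) ->
  modulus (s x - F n x) @[n --> \oo] --> (0 : R).
Proof.
move=> ss sF h; apply: (squeeze_cvgr _ (cvg_cst 0) h).
  near=> n; rewrite modulus_ge0/=.
  by have := ba_sup BA x (ba_sub ss (sF n)).
Unshelve. all: by end_near. Qed.

(** Limits in norm are computed pointwise. *)
Lemma ba_limit_eq (F : nat -> T) s (l : T) : S s -> (forall n, S (F n)) ->
  N (s - F n) @[n --> \oo] --> (0 : R) ->
  (forall x, modulus (l x - F n x) @[n --> \oo] --> (0 : R)) -> s = l.
Proof.
move=> ss sF h1 h2; apply/funext => x.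
apply: (modulus_limit_unique (z := fun n => F n x)
  (ba_cvg_pointwise x ss sF h1) (h2 x)) => n; exact: lexx.
Qed.

(** The inverse is the geometric series. *)
Lemma neumann u : S u -> N u < 1 -> exists2 v, S v & (1 - u) * v = 1.
Proof.
move=> su u1; have u0 := ba_ge0 BA u.
have nu1 : `|N u| < 1 by rewrite ger0_norm.
have [] := @ba_complete S N BA (fun k => u ^+ k) (fun k => N 1 * N u ^+ k).
- by move=> k; exact: ba_exp.
- by move=> k; exact: ba_normX.
- exact: (is_cvg_geometric_series nu1).
move=> v sv cv; exists v => //.
have sF n : S (\sum_(k < n) u ^+ k) by apply: ba_sum => i; exact: ba_exp.
apply/funext => x.
have h1 := ba_cvg_pointwise x sv sF cv.
have ux1 : `|modulus (u x)| < 1.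
  by rewrite ger0_norm ?modulus_ge0// (le_lt_trans (ba_sup BA x su)).
have h2 : modulus (u x) ^+ n @[n --> \oo] --> (0 : R) by exact: cvg_expr.
have h3 : modulus (1 - u x) * modulus (v x - (\sum_(k < n) u ^+ k) x) @[n --> \oo]
    --> (0 : R).
  by rewrite -(mulr0 (modulus (1 - u x))); apply: cvgM => //; exact: cvg_cst.
have geo n : 1 - u x ^+ n = (1 - u x) * (\sum_(k < n) u ^+ k) x.
  rewrite fct_sumE -[LHS]opprB subrX1 -mulNr opprB; congr (_ * _).
  by apply: eq_bigr => k _; rewrite fctE.
apply: (modulus_limit_unique (z := fun n => 1 - u x ^+ n) h3 h2) => n.
  by rewrite geo -modulusM mulrBr.
by rewrite opprB addrC subrK modulusX.
Qed.

End theory.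
End banach_function_algebras.

(** * Maximal ideals *)

Section maximal_ideals.
Variables (R : realType) (X : Type).
Local Notation C := (Cplx R).
Local Notation T := (X -> C).
Variables (S : set T) (N : T -> R).
Hypothesis BA : banach_algebra S N.
Implicit Types (u v w m : T) (M : set T).

Definition combination_closed M := forall a b s t,
  M a -> M b -> S s -> S t -> M (s * a + t * b).

(** Maximality in the form in which it is used: every element outside M is
    invertible modulo M. *)
Record maximal_ideal M : Prop := MaximalIdeal {
  mi_sub : M `<=` S ;
  mi_comb : combination_closed M ;
  mi_proper : ~ M 1 ;
  mi_0 : M 0 ;
  mi_max : forall v, S v -> ~ M v -> exists w m, [/\ S w, M m & v * w + m = 1] }.

Lemma exists_maximal_ideal u : S u -> (forall v, S v -> u * v <> 1) ->
  exists2 M, maximal_ideal M & M u.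
Proof.
move=> su uninv.
(* The union of an empty chain is empty, hence the membership of u is required
   only of nonempty sets. *)
pose P := [set M | [/\ M `<=` S, combination_closed M, ~ M 1 & M !=set0 -> M u]].
have [|M [[MS Mc M1 Mu] Mmax]] := @Zorn_bigcup _ P.
  move=> F FP Ftot; split.
  - by move=> a [M FM Ma]; have [h _ _ _] := FP _ FM; exact: h.
  - move=> a b s t [M1 FM1 M1a] [M2 FM2 M2b] ss st.
    have [_ c1 _ _] := FP _ FM1; have [_ c2 _ _] := FP _ FM2.
    have [h|h] := Ftot _ _ FM1 FM2.
      by exists M2 => //; apply: c2 => //; exact: h.
    by exists M1 => //; apply: c1 => //; exact: h.
  - by move=> [M FM M1]; have [_ _ h _] := FP _ FM.
  - move=> [a [M FM Ma]]; exists M => //; have [_ _ _ h] := FP _ FM.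
    by apply: h; exists a.
have [M0|/set0P/Mu {}Mu] := eqVneq M set0.
  pose U := [set u * v | v in S].
  exfalso; apply: (Mmax U).
    split; first by rewrite M0.
    move=> /(_ u); rewrite M0; apply; exists 1; first exact: (ba1 BA).
    by rewrite mulr1.
  split.
  - by move=> _ [v sv <-]; exact: (ba_mul BA).
  - move=> _ _ s t [v sv <-] [w sw <-] ss st; exists (s * v + t * w); last by ring.
    by apply: (ba_add BA); exact: (ba_mul BA).
  - by move=> [v sv]; exact: uninv.
  - by move=> _; exists 1; [exact: (ba1 BA)|rewrite mulr1].
have M0 : M 0.
  by have := Mc _ _ _ _ Mu Mu (ba0 BA) (ba0 BA); rewrite mul0r addr0.
exists M => //; split => // v sv Mv.
apply: contrapT => h.
pose M' := [set v * w + m | w in S & m in M].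
have MM' : M `<=` M'.
  move=> m Mm; exists 0; first exact: (ba0 BA).
  by exists m => //; rewrite mulr0 add0r.
apply: (Mmax M').
  split=> // M'M; apply: Mv; apply: M'M; exists 1; first exact: (ba1 BA).
  by exists 0 => //; rewrite mulr1 addr0.
split.
- move=> _ [w sw [m Mm <-]]; apply: (ba_add BA); last exact: MS.
  exact: (ba_mul BA).
- move=> _ _ s t [w sw [m Mm <-]] [w' sw' [m' Mm' <-]] ss st.
  exists (s * w + t * w'); first by apply: (ba_add BA); exact: (ba_mul BA).
  by exists (s * m + t * m'); [exact: Mc|ring].
- by move=> [w sw [m Mm e]]; apply: h; exists w, m.
- by move=> _; exact: MM'.
Qed.

Variable M : set T.
Hypothesis MI : maximal_ideal M.

Lemma mi_add a b : M a -> M b -> M (a + b).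
Proof.
move=> ma mb; have := mi_comb MI ma mb (ba1 BA) (ba1 BA).
by rewrite !mul1r.
Qed.

Lemma mi_mul s a : S s -> M a -> M (s * a).
Proof.
move=> ss ma; have := mi_comb MI ma (mi_0 MI) ss (ba0 BA).
by rewrite mul0r addr0.
Qed.

Lemma mi_opp a : M a -> M (- a).
Proof. by move=> ma; rewrite -mulN1r; apply: mi_mul => //; exact/(ba_opp BA)/(ba1 BA). Qed.

Definition congr_mod u v := M (u - v).

Lemma congr_mod_sym u v : congr_mod u v -> congr_mod v u.
Proof. by move=> /mi_opp; rewrite opprB. Qed.

Lemma congr_modD u v u' v' :
  congr_mod u v -> congr_mod u' v' -> congr_mod (u + u') (v + v').
Proof.
rewrite /congr_mod => h1 h2; have := mi_add h1 h2.
by congr M; ring.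
Qed.

Lemma congr_modM u v u' v' : S v -> S u' ->
  congr_mod u v -> congr_mod u' v' -> congr_mod (u * u') (v * v').
Proof.
rewrite /congr_mod => sv su' h1 h2.
have := mi_comb MI h1 h2 su' sv; by congr M; ring.
Qed.

Lemma congr_modMl w u v : S w -> congr_mod u v -> congr_mod (w * u) (w * v).
Proof. by rewrite /congr_mod => sw; rewrite -mulrBr; exact: mi_mul. Qed.

Lemma congr_mod_mul1 w t : S w -> congr_mod t 1 -> congr_mod w (w * t).
Proof. by move=> sw /(congr_modMl sw); rewrite mulr1 => /congr_mod_sym. Qed.

(** The distance to M, that is, the quotient seminorm of S / M. *)
Definition quotient_norm v := inf [set N (v - m) | m in M].

Lemma quotient_norm_ge0 v : 0 <= quotient_norm v.
Proof. by apply: inf_ge0 => _ [m _ <-]; exact: (ba_ge0 BA). Qed.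

Lemma quotient_norm_le v m : M m -> quotient_norm v <= N (v - m).
Proof. by move=> Mm; apply: ge_inf_of_ge0; [move=> _ [? _ <-]; exact: (ba_ge0 BA)|exists m]. Qed.

Lemma quotient_norm_lt v t : quotient_norm v < t -> exists2 m, M m & N (v - m) < t.
Proof.
have h0 : [set N (v - m) | m in M] !=set0.
  by exists (N (v - 0)); exists 0 => //; exact: (mi_0 MI).
by move=> /(inf_lt h0)[_ [m Mm <-] h]; exists m.
Qed.

Lemma quotient_norm_congr u v : congr_mod u v -> quotient_norm u = quotient_norm v.
Proof.
move=> h; congr inf; apply/seteqP; split=> _ [m Mm <-].
  exists (m - (u - v)); last by congr N; ring.
  by apply: mi_add => //; exact: mi_opp.
exists (m + (u - v)); first exact: mi_add.
by congr N; ring.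
Qed.

Lemma quotient_normD u v : S u -> S v ->
  quotient_norm (u + v) <= quotient_norm u + quotient_norm v.
Proof.
move=> su sv; apply/ler_addgt0Pr => e e0.
have e2 : 0 < e / 2 by rewrite divr_gt0.
have [m Mm h1] : exists2 m, M m & N (u - m) < quotient_norm u + e / 2.
  by apply: quotient_norm_lt; rewrite ltrDl.
have [m' Mm' h2] : exists2 m, M m & N (v - m) < quotient_norm v + e / 2.
  by apply: quotient_norm_lt; rewrite ltrDl.
apply: (le_trans (quotient_norm_le _ (mi_add Mm Mm'))).
have -> : u + v - (m + m') = (u - m) + (v - m') by ring.
apply: (le_trans (ba_normD BA _ _)).
- by apply: (ba_sub BA) => //; exact: (mi_sub MI).
- by apply: (ba_sub BA) => //; exact: (mi_sub MI).
lra.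
Qed.

Lemma quotient_normM u v : S u -> S v ->
  quotient_norm (u * v) <= quotient_norm u * quotient_norm v.
Proof.
move=> su sv; apply: le_mul_approx; [exact: quotient_norm_ge0..|].
move=> a b /quotient_norm_lt[m Mm ha] /quotient_norm_lt[m' Mm' hb].
have su' : S (u - m) by apply: (ba_sub BA) => //; exact: (mi_sub MI).
have sv' : S (v - m') by apply: (ba_sub BA) => //; exact: (mi_sub MI).
have /quotient_norm_congr -> : congr_mod (u * v) ((u - m) * (v - m')).
  rewrite /congr_mod; have -> : u * v - (u - m) * (v - m') = v * m + (u - m) * m'.
    by ring.
  exact: (mi_comb MI).
apply: (le_trans (quotient_norm_le _ (mi_0 MI))); rewrite subr0.
apply: (le_trans (ba_normM BA su' sv')).
by apply: ler_pM; rewrite ?(ba_ge0 BA)// ltW.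
Qed.

Lemma quotient_normZ (c : C) u : S u ->
  quotient_norm (c *: u) <= modulus c * quotient_norm u.
Proof.
move=> su; apply/ler_addgt0Pr => e e0.
pose d := e / (modulus c + 1).
have c0 := modulus_ge0 c.
have c1 : 0 < modulus c + 1 by lra.
have d0 : 0 < d by rewrite divr_gt0.
have [m Mm h] : exists2 m, M m & N (u - m) < quotient_norm u + d.
  by apply: quotient_norm_lt; rewrite ltrDl.
have Mcm : M (c *: m).
  have -> : c *: m = cst c * m by apply/funext.
  by apply: mi_mul => //; exact: (ba_cst BA).
apply: (le_trans (quotient_norm_le _ Mcm)).
rewrite -scalerBr.
have s1 : S (u - m) by apply: (ba_sub BA) => //; exact: (mi_sub MI).
apply: (le_trans (ba_normZ BA _ s1)).
have : d * (modulus c + 1) = e by rewrite divfK// gt_eqF.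
nra.
Qed.

(** A maximal ideal is closed: if v is close to M but not in M, then an inverse
    of v modulo M would bring an element of M within distance 1 of 1. *)
Lemma quotient_norm_gt0 v : S v -> ~ M v -> 0 < quotient_norm v.
Proof.
move=> sv Mv; rewrite lt_def quotient_norm_ge0 andbT; apply/negP => /eqP v0.
have [w [m [sw Mm vw]]] := mi_max MI sv Mv.
have e0 : 0 < (N w + 1)^-1.
  by rewrite invr_gt0 ltr_wpDl// (ba_ge0 BA).
have [m' Mm' h] : exists2 m, M m & N (v - m) < (N w + 1)^-1.
  by apply: quotient_norm_lt; rewrite v0.
have sv' : S (v - m') by apply: (ba_sub BA) => //; exact: (mi_sub MI).
have lt1 : N ((v - m') * w) < 1.
  apply: (le_lt_trans (ba_normM BA sv' sw)).
  have w0 := ba_ge0 BA w.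
  have : N (v - m') * (N w + 1) < 1.
    by rewrite -ltr_pdivlMr ?ltr_wpDl// div1r.
  have := ba_ge0 BA (v - m'); nra.
have [z sz hz] := neumann BA (ba_mul BA sv' sw) lt1.
apply: (mi_proper MI); rewrite -hz mulrC.
apply: mi_mul => //.
have -> : 1 - (v - m') * w = w * m' + m by rewrite -vw; ring.
by apply: mi_add => //; exact: mi_mul.
Qed.

End maximal_ideals.

(** * The Gelfand-Mazur theorem *)

Section gelfand_mazur.
Variables (R : realType) (X : Type).
Local Notation C := (Cplx R).
Local Notation T := (X -> C).
Variables (S : set T) (N : T -> R).
Hypothesis BA : banach_algebra S N.
Variable M : set T.
Hypothesis MI : maximal_ideal S M.
Local Notation p := (quotient_norm N M).
Local Notation "u == v %[M]" := (congr_mod M u v) (at level 70, v at next level).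

Section resolvent.
Variables (v : T) (w : C -> T).
Hypothesis Sv : S v.
Hypothesis Sw : forall l, S (w l).
Hypothesis resolvent : forall l, (v - cst l) * w l == 1 %[M].

Let f (l : C) : R := p (w l).

Let f_ge0 l : 0 <= f l. Proof. exact: (quotient_norm_ge0 BA). Qed.

Let S_shift l : S (v - cst l).
Proof. by apply: (ba_sub BA) => //; exact: (ba_cst BA). Qed.

Lemma resolvent_gt0 l : 0 < f l.
Proof.
apply: (quotient_norm_gt0 BA MI) => // Mw; apply: (mi_proper MI).
have := mi_add BA MI (mi_mul BA MI (S_shift l) Mw) (mi_opp BA MI (resolvent l)).
by congr M; ring.
Qed.

(** Resolvent identity w(l) - w(m) = (l - m) w(l) w(m) modulo M. *)
Lemma resolvent_lipschitz l m : f l <= f m + modulus (l - m) * (f l * f m).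
Proof.
have e : w l == w m + (l - m) *: (w l * w m) %[M].
  have h := mi_comb MI (resolvent m) (resolvent l) (ba_opp BA (Sw l)) (Sw m).
  move: h; rewrite /congr_mod; congr M.
  have ->: (l - m) *: (w l * w m) = (cst l - cst m) * (w l * w m) by apply/funext => x.
  ring.
rewrite [leLHS](quotient_norm_congr BA MI e).
have sww : S (w l * w m) by exact: (ba_mul BA).
apply: (le_trans (quotient_normD BA MI _ _)) => //; first exact: (ba_scale BA).
rewrite lerD2l; apply: (le_trans (quotient_normZ BA MI _ sww)).
apply: ler_wpM2l; first exact: modulus_ge0.
exact: (quotient_normM BA MI).
Qed.

(** w(l) = (v w(l) - 1) / l modulo M, so that the resolvent vanishes at infinity. *)
Lemma resolvent_infty l : modulus l * f l <= p v * f l + p 1.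
Proof.
have [->|l0] := eqVneq l 0.
  by rewrite modulus0 mul0r addr_ge0 ?mulr_ge0 ?(quotient_norm_ge0 BA).
have e : w l == l^-1 *: (v * w l - 1) %[M].
  have := mi_mul BA MI (ba_cst BA (- l^-1)) (resolvent l).
  rewrite /congr_mod; congr M; apply/funext => x; rewrite !fctE.
  have -> a : l^-1 *: a = l^-1 * a :> C by [].
  by field.
have svw : S (v * w l) by exact: (ba_mul BA).
have h : f l <= modulus l^-1 * (p v * f l + p 1).
  rewrite [leLHS](quotient_norm_congr BA MI e).
  have s' : S (- (1 : T)) by apply/(ba_opp BA)/(ba1 BA).
  apply: (le_trans (quotient_normZ BA MI _ _)); first exact: (ba_add BA).
  apply: ler_wpM2l; first exact: modulus_ge0.
  apply: (le_trans (quotient_normD BA MI svw s')).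
  apply: lerD; first exact: (quotient_normM BA MI).
  have := quotient_normZ BA MI (-1) (ba1 BA).
  by rewrite scaleN1r modulusN modulus1 mul1r.
have l1 : 0 < modulus l by rewrite modulus_gt0.
by move: h; rewrite modulusV mulrC ler_pdivlMr// mulrC.
Qed.

Lemma resolvent_locally_lipschitz m l : modulus (l - m) * (2 * f m) <= 1 ->
  `|f l - f m| <= modulus (l - m) * (2 * f m ^+ 2).
Proof.
move=> h; have h1 := resolvent_lipschitz l m; have h2 := resolvent_lipschitz m l.
rewrite modulus_sub in h2.
have l0 := f_ge0 l; have m0 := f_ge0 m; have d0 := modulus_ge0 (l - m).
have fl2 : f l <= 2 * f m by nra.
have fle : modulus (l - m) * (f l * f m) <= modulus (l - m) * (2 * f m ^+ 2).
  by rewrite ler_wpM2l//; nra.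
rewrite ler_norml; apply/andP; split; lra.
Qed.

(** Averaging over the vertices l + r, l + i r, l - r, l - i r of a square replaces
    Cauchy's formula.  As the product of the four numbers y - r i^k is
    y^4 - r^4, partial fractions give, modulo M,
    w(l1) + w(l2) + w(l3) + w(l4) = 4 w(l) + 4 r^4 w(l) w(l1) w(l2) w(l3) w(l4),
    so that the mean differs from the value at the centre only by O(r^4). *)
Lemma resolvent_mean (l : C) (r : R) : 0 <= r ->
  4 * f l <= f (l + rc r) + f (l + ii * rc r) + f (l - rc r) + f (l - ii * rc r)
    + 4 * r ^+ 4 * (f l * (f (l + rc r) * f (l + ii * rc r) *
        (f (l - rc r) * f (l - ii * rc r)))).
Proof.
move=> r0.
set l1 := l + rc r; set l2 := l + ii * rc r; set l3 := l - rc r.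
set l4 := l - ii * rc r.
pose t k := (v - cst k) * w k.
have St k : S (t k) by exact: (ba_mul BA).
have t1 k : t k == 1 %[M] by exact: resolvent.
have t2 k k' : t k * t k' == 1 %[M].
  by have := congr_modM MI (ba1 BA) (St k') (t1 k) (t1 k'); rewrite mulr1.
have t3 k k' k'' : t k * t k' * t k'' == 1 %[M].
  by have := congr_modM MI (ba1 BA) (St k'') (t2 k k') (t1 k''); rewrite mulr1.
have t4 : t l1 * t l2 * (t l3 * t l4) == 1 %[M].
  have := congr_modM MI (ba1 BA) (ba_mul BA (St l3) (St l4)) (t2 l1 l2) (t2 l3 l4).
  by rewrite mulr1.
pose P := w l1 * w l2 * (w l3 * w l4).
have SP : S P by apply: (ba_mul BA); exact: (ba_mul BA).
have SwP : S (w l * P) by exact: (ba_mul BA).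
have e1 := congr_mod_mul1 BA MI (Sw l1) (t3 l2 l3 l4).
have e2 := congr_mod_mul1 BA MI (Sw l2) (t3 l1 l3 l4).
have e3 := congr_mod_mul1 BA MI (Sw l3) (t3 l1 l2 l4).
have e4 := congr_mod_mul1 BA MI (Sw l4) (t3 l1 l2 l3).
(* Each w(lk) is expanded over the common denominator by inserting the
   factors (v - lj) w(lj), which are 1 modulo M. *)
have es := congr_modD BA MI (congr_modD BA MI e1 e2) (congr_modD BA MI e3 e4).
have e0 := congr_mod_mul1 BA MI (Sw l) t4.
pose y := v - cst l.
have ey : y ^+ 3 * P * t l == y ^+ 3 * P %[M].
  apply: (congr_mod_sym BA MI); apply: (congr_mod_mul1 BA MI) => //.
  by apply: (ba_mul BA) => //; apply: (ba_exp BA); exact: S_shift.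
have key : (4 : C) *: w l ==
    (w l1 + w l2 + (w l3 + w l4)) - rc (4 * r ^+ 4) *: (w l * P) %[M].
  have h := mi_add BA MI (mi_mul BA MI (ba_cst BA 4) e0) (mi_opp BA MI es).
  have {h} := mi_add BA MI h (mi_mul BA MI (ba_cst BA 4) ey).
  rewrite /congr_mod; congr M; apply/funext => x; rewrite /P /t /y !fctE.
  have sc (a b : C) : a *: b = a * b by [].
  rewrite !sc /l1 /l2 /l3 /l4.
  set a := w _ x; set b := w _ x; set c := w _ x; set d := w _ x; set e := w _ x.
  have i2 := ii2 R; have r4 : rc (4 * r ^+ 4) = 4 * rc r ^+ 4 by rewrite rcM rcX rc_nat.
  rewrite r4; clear -i2.
  move: (v x) (rc r) ii i2 => vx q i i2.
  have i4 : i * i * (i * i) = 1 by rewrite i2 mulrNN mulr1.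
  ring: i2 i4.
have s4 : S ((4 : C) *: w l) by exact: (ba_scale BA).
have f4 : 4 * f l <= p ((4 : C) *: w l).
  have := quotient_normZ BA MI (4^-1) s4.
  rewrite scalerA mulVf ?pnatr_eq0// scale1r -/(f l) modulusV.
  have -> : modulus (4 : C) = 4 by rewrite -(rc_nat R 4) modulus_rc ger0_norm.
  lra.
have s12 : S (w l1 + w l2) by exact: (ba_add BA).
have s34 : S (w l3 + w l4) by exact: (ba_add BA).
have n12 := quotient_normD BA MI (Sw l1) (Sw l2).
have n34 := quotient_normD BA MI (Sw l3) (Sw l4).
have n1234 := quotient_normD BA MI s12 s34.
have sZ := ba_scale BA (- rc (4 * r ^+ 4)) SwP.
have nD := quotient_normD BA MI (ba_add BA s12 s34) sZ.
have nZ := quotient_normZ BA MI (- rc (4 * r ^+ 4)) SwP.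
have r4 : 0 <= 4 * r ^+ 4 by rewrite mulr_ge0// exprn_ge0.
rewrite modulusN modulus_ge0_rc// in nZ.
have nP : p (w l * P) <= f l * (f l1 * f l2 * (f l3 * f l4)).
  apply: (le_trans (quotient_normM BA MI (Sw l) SP)).
  apply: ler_wpM2l; first exact: (quotient_norm_ge0 BA).
  apply: (le_trans (quotient_normM BA MI (ba_mul BA (Sw l1) (Sw l2))
    (ba_mul BA (Sw l3) (Sw l4)))).
  by apply: ler_pM; rewrite ?(quotient_norm_ge0 BA)//; exact: (quotient_normM BA MI).
have nP4 := ler_wpM2l r4 nP.
rewrite (quotient_norm_congr BA MI key) -scaleNr in f4.
rewrite /f in f4 n12 n34 nP4 *; lra.
Qed.

Lemma within_box (L r a s : R) : r <= L - `|a| -> `|s| <= r -> - L <= a + s <= L.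
Proof.
move=> h1 h2; rewrite -ler_norml (le_trans (ler_normD _ _))//; lra.
Qed.

(** Maximum principle for f, the norm of the resolvent.  Outside a large square f
    is at most f(0) / 4; so for a small e > 0 the maximum over the square of
    f(z) + e |z|^2 is attained in the interior.  At such a point z the mean of
    f over four points at distance r is at most f(z) - e r^2, which contradicts
    the error of order r^4 when r is small. *)
Lemma resolvent_absurd : False.
Proof.
have f0 := resolvent_gt0 0; have p1 := quotient_norm_ge0 BA M 1.
have pv := quotient_norm_ge0 BA M v.
(* L makes f at most f(0) / 4 beyond modulus L, and e makes e |z|^2 at most
   f(0) / 4 on the square of half-side L, so the maximum is interior. *)
pose L := p v + 4 * p 1 / f 0 + 1.
have L0 : 1 <= L by rewrite lerDr addr_ge0// divr_ge0// ?mulr_ge0// ltW.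
have far l : L <= modulus l -> f l <= f 0 / 4.
  move=> Ll; have := resolvent_infty l; have fl0 := f_ge0 l => h.
  have h1 : f l * (4 * p 1 / f 0 + 1) <= p 1.
    have : L * f l <= modulus l * f l by rewrite ler_wpM2r.
    rewrite /L; lra.
  have h2 : f l * (4 * p 1 / f 0) = 4 * (f l * p 1 / f 0) by ring.
  have h3 : f l * p 1 / f 0 * f 0 = f l * p 1 by rewrite divfK// gt_eqF.
  have h4 : 0 <= f l * p 1 / f 0 by rewrite divr_ge0 ?mulr_ge0// ltW.
  rewrite mulrDr mulr1 h2 in h1.
  have [p10|p10] := eqVneq (p 1) 0; first by rewrite p10 in h1 h3 h4 *; lra.
  have pp : 0 < p 1 by rewrite lt_def p10.
  nra.
pose e := f 0 / (8 * L ^+ 2).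
have L2 : 0 < 8 * L ^+ 2 by rewrite mulr_gt0// exprn_gt0//; lra.
have e0 : 0 < e by rewrite divr_gt0.
have eL : e * L ^+ 2 = f 0 / 8.
  by rewrite /e; field; rewrite ?gt_eqF//; lra.
pose z (q : R * R) : C := rc q.1 + ii * rc q.2.
pose g (q : R * R) : R := f (z q) + e * (q.1 ^+ 2 + q.2 ^+ 2).
have cg : continuous g.
  move=> q.
  apply: cvgD; last first.
    apply: cvgM; first exact: cvg_cst.
    have c1 : (fun x : R * R => x.1) x @[x --> q] --> q.1 by exact: cvg_fst.
    have c2 : (fun x : R * R => x.2) x @[x --> q] --> q.2 by exact: cvg_snd.
    by apply: cvgD; [exact: (cvgM c1 c1)|exact: (cvgM c2 c2)].
  apply/cvgrPdist_lt => d d0.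
  pose c := 2 * (2 * f (z q)) + 2 * (2 * f (z q) ^+ 2) / d + 1.
  have fz := f_ge0 (z q).
  have fz2 : 0 <= f (z q) ^+ 2 by exact: exprn_ge0.
  have fd : 0 <= 2 * (2 * f (z q) ^+ 2) / d by rewrite divr_ge0// ?mulr_ge0// ltW.
  have c0 : 0 < c by rewrite /c; lra.
  have c1 : 0 < c^-1 by rewrite invr_gt0.
  have U1 : \forall q' \near q, `|q.1 - q'.1| < c^-1.
    have c1' : (fun x : R * R => x.1) x @[x --> q] --> q.1 by exact: cvg_fst.
    by move/cvgrPdist_lt : c1'; exact.
  have U2 : \forall q' \near q, `|q.2 - q'.2| < c^-1.
    have c2' : (fun x : R * R => x.2) x @[x --> q] --> q.2 by exact: cvg_snd.
    by move/cvgrPdist_lt : c2'; exact.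
  near=> q'.
  have h1 : `|q.1 - q'.1| < c^-1 by near: q'.
  have h2 : `|q.2 - q'.2| < c^-1 by near: q'.
  have h3 : modulus (z q' - z q) < 2 * c^-1.
    have -> : z q' - z q = rc (q'.1 - q.1) + ii * rc (q'.2 - q.2).
      by rewrite /z !rcB; ring.
    rewrite (le_lt_trans (modulusD _ _))// modulusM modulus_ii mul1r !modulus_rc.
    rewrite distrC in h1; rewrite distrC in h2; lra.
  have h4 : modulus (z q' - z q) * c < 2 by rewrite -ltr_pdivlMr.
  have m0 := modulus_ge0 (z q' - z q).
  have hle : modulus (z q' - z q) * (2 * f (z q)) <= 1.
    move: h4; rewrite /c; nra.
  rewrite distrC (le_lt_trans (resolvent_locally_lipschitz hle))//.
  have h5 : modulus (z q' - z q) * (2 * (2 * f (z q) ^+ 2) / d) < 2.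
    move: h4; rewrite /c; nra.
  move: h5; rewrite mulrA ltr_pdivrMr//; lra.
have cB : compact (`[- L, L]%classic `*` `[- L, L]%classic : set (R * R)).
  by apply: compact_setX; exact: segment_compact.
have B0 : (`[- L, L]%classic `*` `[- L, L]%classic : set (R * R)) (0, 0).
  by split; rewrite /= in_itv /=; apply/andP; split; lra.
have [|q /set_mem[]] := compact_EVT_max _ cB (continuous_subspaceT cg).
  by exists (0, 0).
rewrite /= !in_itv /= => /andP[q1 q2] /andP[q3 q4] gmax.
have g0 : g (0, 0) = f 0.
  have z0 : z (0, 0) = 0 by apply: cplx_eqP; rewrite /= !(mul0r, mulr0, addr0, subr0).
  by rewrite /g z0 /=; ring.
have gq : f 0 <= g q by rewrite -g0; apply: gmax; exact/mem_set.
have le_g q' : - L <= q'.1 -> q'.1 <= L -> - L <= q'.2 -> q'.2 <= L -> g q' <= g q.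
  by move=> *; apply: gmax; apply/mem_set; split; rewrite /= in_itv /=; apply/andP.
have zRe q' : complex.Re (z q') = q'.1 by rewrite /z /=; ring.
have zIm q' : complex.Im (z q') = q'.2.
  by rewrite /z /=; ring.
have inside : L > `|q.1| /\ L > `|q.2|.
  have sq (a : R) : - L <= a -> a <= L -> a ^+ 2 <= L ^+ 2 by move=> *; nra.
  have s1 := sq _ q1 q2; have s2 := sq _ q3 q4.
  have fq : f 0 / 4 < f (z q).
    by have := gq; rewrite /g; have := ler_wpM2l (ltW e0) s1;
       have := ler_wpM2l (ltW e0) s2; rewrite eL; lra.
  split; rewrite ltNge; apply/negP => h; move: fq; rewrite ltNge => /negP; apply;
    apply: far; apply: (le_trans h).
    by rewrite -zRe Re_le_modulus.
  by rewrite -zIm Im_le_modulus.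
have [in1 in2] := inside.
pose G := g q.
have G0 : 0 < G by exact: lt_le_trans gq.
have G5 : 0 < G ^+ 5 by rewrite exprn_gt0.
(* r keeps the four points in the square and makes r^2 G^5 smaller than e. *)
pose r := Num.min (Num.min 1 (e / (2 * G ^+ 5))) (Num.min (L - `|q.1|) (L - `|q.2|)).
have r0 : 0 < r.
  have d1 : 0 < e / (2 * G ^+ 5) by apply: divr_gt0 => //; apply: mulr_gt0 => //; lra.
  rewrite !lt_min ltr01 d1 /=; apply/andP; split; lra.
have r1 : r <= 1 by rewrite !ge_min lexx.
have r2 : r * (2 * G ^+ 5) <= e.
  by rewrite -ler_pdivlMr ?mulr_gt0// !ge_min lexx !orbT.
have r3 : r <= L - `|q.1| by rewrite !ge_min lexx !orbT.
have r4 : r <= L - `|q.2| by rewrite !ge_min lexx !orbT.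
have mean := resolvent_mean (z q) (ltW r0).
have in_box q' : - L <= q'.1 <= L -> - L <= q'.2 <= L -> g q' <= g q.
  by move=> /andP[? ?] /andP[? ?]; exact: le_g.
have r_le : `|r| <= r by rewrite ger0_norm// ltW.
have Nr_le : `|- r| <= r by rewrite normrN.
have o_le : `|0 : R| <= r by rewrite normr0 ltW.
have /= g1 := in_box (q.1 + r, q.2 + 0) (within_box r3 r_le) (within_box r4 o_le).
have /= g2 := in_box (q.1 + 0, q.2 + r) (within_box r3 o_le) (within_box r4 r_le).
have /= g3 := in_box (q.1 - r, q.2 + 0) (within_box r3 Nr_le) (within_box r4 o_le).
have /= g4 := in_box (q.1 + 0, q.2 - r) (within_box r3 o_le) (within_box r4 Nr_le).
rewrite !addr0 in g1 g2 g3 g4.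
have z1 : z (q.1 + r, q.2) = z q + rc r by rewrite /z rcD /=; ring.
have z2 : z (q.1, q.2 + r) = z q + ii * rc r by rewrite /z rcD /=; ring.
have z3 : z (q.1 - r, q.2) = z q - rc r by rewrite /z rcB /=; ring.
have z4 : z (q.1, q.2 - r) = z q - ii * rc r by rewrite /z rcB /=; ring.
rewrite -z1 -z2 -z3 -z4 in mean.
have fg q' : 0 <= f (z q') <= g q'.
  by rewrite f_ge0 lerDl mulr_ge0 ?(ltW e0)// addr_ge0// sqr_ge0.
have /andP[a0 b0] := fg q.
have /andP[a1 b1] := fg (q.1 + r, q.2); have /andP[a2 b2] := fg (q.1, q.2 + r).
have /andP[a3 b3] := fg (q.1 - r, q.2); have /andP[a4 b4] := fg (q.1, q.2 - r).
have {}b1 := le_trans b1 g1; have {}b2 := le_trans b2 g2.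
have {}b3 := le_trans b3 g3; have {}b4 := le_trans b4 g4.
have prod : f (z q) * (f (z (q.1 + r, q.2)) * f (z (q.1, q.2 + r)) *
   (f (z (q.1 - r, q.2)) * f (z (q.1, q.2 - r)))) <= G ^+ 5.
  have -> : G ^+ 5 = G * (G * G * (G * G)) by ring.
  apply: ler_pM => //; first by rewrite !mulr_ge0.
  by apply: ler_pM; rewrite ?mulr_ge0//; apply: ler_pM.
have r40 : 0 <= 4 * r ^+ 4 by rewrite mulr_ge0// exprn_ge0// ltW.
have prod4 := ler_wpM2l r40 prod.
have sum : f (z (q.1 + r, q.2)) + f (z (q.1, q.2 + r)) + f (z (q.1 - r, q.2)) +
  f (z (q.1, q.2 - r)) <= 4 * f (z q) - 4 * e * r ^+ 2.
  move: g1 g2 g3 g4; rewrite /g /=; clear; nra.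
have fin : e * r ^+ 2 <= r ^+ 4 * G ^+ 5.
  by move: mean sum prod4; clear; lra.
have fin2 : e <= r ^+ 2 * G ^+ 5.
  rewrite -(ler_pM2r (x := r ^+ 2)) ?exprn_gt0//.
  by move: fin; congr (_ <= _); ring.
have : r ^+ 2 * G ^+ 5 <= r * G ^+ 5.
  by rewrite ler_wpM2r ?(ltW G5)// expr2 ler_piMr// ltW.
move: fin2 r2 e0; clear; lra.
Unshelve. all: by end_near. Qed.

End resolvent.

(** Gelfand-Mazur theorem: otherwise v - l would be invertible modulo M for every
    l, and its inverses would form an entire resolvent that vanishes at
    infinity. *)
Theorem gelfand_mazur v : S v -> exists l : C, M (v - cst l).
Proof.
move=> Sv; apply: contrapT => h.
have /choice[w hw] (l : C) : exists w, S w /\ (v - cst l) * w == 1 %[M].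
  have Ml : ~ M (v - cst l) by move=> Ml; apply: h; exists l.
  have [] := mi_max MI _ Ml; first by apply: (ba_sub BA) => //; exact: (ba_cst BA).
  move=> w [m [Sw Mm e]]; exists w; split => //.
  rewrite /congr_mod -e opprD addrA subrr sub0r; exact: (mi_opp BA MI).
exact: (resolvent_absurd Sv (fun l => (hw l).1) (fun l => (hw l).2)).
Qed.

End gelfand_mazur.

Section characters.
Variables (R : realType) (X : Type).
Local Notation C := (Cplx R).
Local Notation T := (X -> C).
Variables (S : set T) (N : T -> R).
Hypothesis BA : banach_algebra S N.

Record character (chi : T -> C) : Prop := Character {
  chi_lin : forall (c : C) u v, S u -> S v -> chi (c *: u + v) = c * chi u + chi v ;
  chi_mul : forall u v, S u -> S v -> chi (u * v) = chi u * chi v ;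
  chi_1 : chi 1 = 1 }.

Lemma character_of_maximal_ideal M : maximal_ideal S M ->
  exists2 chi, character chi & forall u, M u -> chi u = 0.
Proof.
move=> MI.
have /choice[chi hchi] (v : T) : exists l : C, S v -> M (v - cst l).
  have [Sv|nSv] := pselect (S v); last by exists 0.
  by have [l] := gelfand_mazur BA MI Sv; exists l.
have uniq v l : S v -> M (v - cst l) -> chi v = l.
  move=> Sv Ml; apply/eqP; rewrite -subr_eq0; apply/negPn/negP => n0.
  apply: (mi_proper MI).
  have := mi_mul BA MI (ba_cst BA (chi v - l)^-1)
    (mi_add BA MI Ml (mi_opp BA MI (hchi _ Sv))).
  congr M; apply/funext => x; rewrite !fctE.
  by field.
exists chi.
  split.
  - move=> c u v Su Sv; apply: uniq; first exact: (ba_lin BA).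
    have := mi_add BA MI (mi_mul BA MI (ba_cst BA c) (hchi _ Su)) (hchi _ Sv).
    congr M; apply/funext => x; rewrite !fctE.
    have -> : c *: u x = c * u x by [].
    ring.
  - move=> u v Su Sv; apply: uniq; first exact: (ba_mul BA).
    have := mi_comb MI (hchi _ Su) (hchi _ Sv) Sv (ba_cst BA (chi u)).
    by congr M; apply/funext => x; rewrite !fctE; ring.
  - apply: uniq; first exact: (ba1 BA).
    have -> : 1 - cst (1 : C) = 0 :> T by apply/funext => x; rewrite !fctE subrr.
    exact: (mi_0 MI).
move=> u Mu; apply: uniq; first exact: (mi_sub MI).
have -> : u - cst (0 : C) = u by apply/funext => x; rewrite !fctE subr0.
done.
Qed.

(** A noninvertible element lies in a maximal ideal, which is the kernel of a
    character. *)
Theorem exists_character u : S u -> (forall v, S v -> u * v <> 1) ->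
  exists2 chi, character chi & chi u = 0.
Proof.
move=> Su uninv; have [M MI Mu] := exists_maximal_ideal BA Su uninv.
have [chi h1 h2] := character_of_maximal_ideal MI.
by exists chi => //; exact: h2.
Qed.

End characters.

(** * The complex exponential *)

Section exponential_series.
Variable R : realType.
Local Notation C := (Cplx R).
Implicit Types (z w : C) (j : nat).

Definition exp_partial (K : numFieldType) j n (z : K) : K :=
  \sum_(k < n) (k + j)`!%:R^-1 * z ^+ k.

Lemma exp_partial_series (x : R) n : exp_partial 0 n x = series (exp_coeff x) n.
Proof.
rewrite /exp_partial /series /= big_mkord; apply: eq_bigr => k _.
by rewrite addn0 mulrC.
Qed.

Lemma invfact_ge0 n : 0 <= n`!%:R^-1 :> R.
Proof. by rewrite invr_ge0 ler0n. Qed.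

Lemma modulus_invfact n : modulus (n`!%:R^-1 : C) = n`!%:R^-1.
Proof. by rewrite modulusV -rc_nat modulus_rc ger0_norm. Qed.

Lemma invfact_le k j : (k + j)`!%:R^-1 <= k`!%:R^-1 :> R.
Proof.
rewrite lef_pV2 ?posrE ?ltr0n ?fact_gt0// ler_nat.
elim: j => [|j ih]; first by rewrite addn0.
by rewrite addnS factS (leq_trans ih)// leq_pmull.
Qed.

Lemma exp_coeff_series_cvg (x : R) : cvgn (series (exp_coeff x)).
Proof. exact: is_cvg_series_exp_coeff. Qed.

Lemma exp_series_limit j z : exists l : C, forall n,
  modulus (l - exp_partial j n z) <= tail (exp_coeff (modulus z)) n.
Proof.
apply: (@complex_series_cvg _ (fun k => (k + j)`!%:R^-1 * z ^+ k));
  last exact: exp_coeff_series_cvg.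
move=> k; rewrite modulusM modulus_invfact modulusX /exp_coeff /= mulrC.
by rewrite ler_wpM2l ?exprn_ge0 ?modulus_ge0// invfact_le.
Qed.

(** The entire function with coefficients 1 / (k + j)!: expser 0 is the exponential,
    expser 1 is (e^z - 1) / z and expser 2 is (e^z - 1 - z) / z^2.  Their common
    majorant is the real exponential series. *)
Definition expser j z : C := projT1 (cid (exp_series_limit j z)).

Lemma expser_approx j z n :
  modulus (expser j z - exp_partial j n z) <= tail (exp_coeff (modulus z)) n.
Proof. by rewrite /expser; case: cid. Qed.

Lemma exp_tail_cvg0 (x : R) : tail (exp_coeff x) n @[n --> \oo] --> (0 : R).
Proof. by apply: tail_cvg0; exact: exp_coeff_series_cvg. Qed.

Lemma expser_unique j z (l : C) (t : R^nat) : t n @[n --> \oo] --> (0 : R) ->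
  (forall n, modulus (l - exp_partial j n z) <= t n) -> expser j z = l.
Proof.
move=> t0 h; exact: (modulus_limit_unique (exp_tail_cvg0 (modulus z)) t0
  (expser_approx j z) h).
Qed.

Lemma modulus_expser_le j z : modulus (expser j z) <= expR (modulus z).
Proof.
have := expser_approx j z 0.
by rewrite /exp_partial big_ord0 subr0 /tail /series /= big_geq// subr0.
Qed.

Lemma expser_rec j z : expser j z = j`!%:R^-1 + z * expser j.+1 z.
Proof.
have ct : modulus z * tail (exp_coeff (modulus z)) n @[n --> \oo] --> (0 : R).
  by rewrite -(mulr0 (modulus z)); apply: cvgM; [exact: cvg_cst|exact: exp_tail_cvg0].
apply: (modulus_limit_unique (z := fun n => exp_partial j n.+1 z) _ ct).
- have := exp_tail_cvg0 (modulus z); rewrite -(cvg_shiftS _) => h; exact: h.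
- by move=> n; exact: expser_approx.
move=> n; rewrite /exp_partial big_ord_recl /= add0n expr0 mulr1.
have -> : \sum_(i < n) (bump 0 i + j)`!%:R^-1 * z ^+ bump 0 i =
    z * exp_partial j.+1 n z.
  rewrite /exp_partial mulr_sumr; apply: eq_bigr => i _.
  by rewrite /bump /= add1n addSnnS exprS; ring.
have -> : j`!%:R^-1 + z * expser j.+1 z - (j`!%:R^-1 + z * exp_partial j.+1 n z) =
  z * (expser j.+1 z - exp_partial j.+1 n z) by ring.
by rewrite modulusM ler_wpM2l ?modulus_ge0// expser_approx.
Qed.

Definition cexp z := expser 0 z.

Lemma cexp_rec1 z : cexp z = 1 + z * expser 1 z.
Proof. by rewrite /cexp expser_rec fact0 invr1. Qed.

Lemma expser1_rec z : expser 1 z = 1 + z * expser 2 z.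
Proof. by rewrite expser_rec (_ : 1`! = 1%N)// invr1. Qed.

Lemma cexp_rec2 z : cexp z = 1 + z + z ^+ 2 * expser 2 z.
Proof. by rewrite cexp_rec1 expser1_rec; ring. Qed.

Lemma cexp0 : cexp 0 = 1.
Proof. by rewrite cexp_rec1 mul0r addr0. Qed.

Lemma exp_partialD (K : numFieldType) n (x y : K) :
  exp_partial 0 n (x + y) = \sum_(i < n) i`!%:R^-1 * x ^+ i *
    \sum_(j < n - i) j`!%:R^-1 * y ^+ j.
Proof.
rewrite /exp_partial; elim: n => [|n ih]; first by rewrite !big_ord0.
rewrite big_ord_recr /= ih [in RHS]big_ord_recr /= subSn// subnn.
rewrite big_ord1 /= fact0 invr1 expr0 mulr1 addn0.
under [in RHS]eq_bigr => i _.
  rewrite subSn; last exact: ltnW.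
  rewrite big_ord_recr /= mulrDr.
  over.
rewrite big_split /= -!addrA; congr (_ + _).
have term (i : nat) : (i <= n)%N -> n`!%:R^-1 * (y ^+ (n - i) * x ^+ i *+ 'C(n, i)) =
    i`!%:R^-1 * x ^+ i * ((n - i)`!%:R^-1 * y ^+ (n - i)).
  move=> le_in; have fN0 m : m`!%:R != 0 :> K by rewrite pnatr_eq0 gtn_eqF ?fact_gt0.
  rewrite -(bin_fact le_in) !natrM -mulr_natr; field.
  by rewrite !fN0 pnatr_eq0 gtn_eqF ?bin_gt0.
rewrite [x + y]addrC exprDn mulr_sumr big_ord_recr /= (term n)// subnn fact0 invr1.
rewrite expr0 !mulr1; congr (_ + _).
by apply: eq_bigr => i _; rewrite term// ltnW.
Qed.

Lemma exp_partialM_sub (K : numFieldType) n (x y : K) :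
  exp_partial 0 n x * exp_partial 0 n y - exp_partial 0 n (x + y) =
  \sum_(i < n) i`!%:R^-1 * x ^+ i * \sum_(n - i <= j < n) j`!%:R^-1 * y ^+ j.
Proof.
rewrite exp_partialD [exp_partial 0 n x]/exp_partial mulr_suml -sumrB.
apply: eq_bigr => i _; rewrite addn0 -mulrBr; congr (_ * _).
rewrite /exp_partial; under eq_bigr do rewrite addn0.
rewrite -!(big_mkord xpredT (fun j => j`!%:R^-1 * y ^+ j)).
by rewrite (@big_cat_nat _ _ _ (n - i))//= ?leq_subr// addrAC subrr add0r.
Qed.

Lemma exp_partial_tail n (x : R) :
  exp_partial 0 n x = expR x - tail (exp_coeff x) n.
Proof. by rewrite exp_partial_series /tail opprB addrC subrK. Qed.

(** The defect of multiplicativity of the partial sums is a polynomial with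
    nonnegative coefficients, hence is dominated by the defect for the moduli,
    which tends to 0 by the functional equation of the real exponential. *)
Lemma cexpD z w : cexp (z + w) = cexp z * cexp w.
Proof.
pose x := modulus z; pose y := modulus w.
have dom n : modulus (exp_partial 0 n z * exp_partial 0 n w - exp_partial 0 n (z + w))
    <= exp_partial 0 n x * exp_partial 0 n y - exp_partial 0 n (x + y).
  rewrite !exp_partialM_sub (le_trans (modulus_sum _ _ _))//; apply: ler_sum => i _.
  rewrite !modulusM modulus_invfact modulusX ler_wpM2l//.
    by rewrite mulr_ge0 ?invfact_ge0// exprn_ge0// modulus_ge0.
  rewrite (le_trans (modulus_sum _ _ _))//; apply: ler_sum => k _.
  by rewrite modulusM modulus_invfact modulusX.
pose d n : R := exp_partial 0 n x * exp_partial 0 n y - exp_partial 0 n (x + y).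
have cp (t : R) : exp_partial 0 n t @[n --> \oo] --> expR t.
  have -> : (exp_partial 0)^~ t = series (exp_coeff t).
    by apply/funext => n; exact: exp_partial_series.
  exact: exp_coeff_series_cvg.
have d0 : d n @[n --> \oo] --> (0 : R).
  have -> : 0 = expR x * expR y - expR (x + y) by rewrite expRD subrr.
  by apply: cvgB; [apply: cvgM|]; exact: cp.
pose t1 n := tail (exp_coeff x) n; pose t2 n := tail (exp_coeff y) n.
have partial_le n (v : C) : modulus (exp_partial 0 n v) <= expR (modulus v).
  rewrite (le_trans (modulus_sum _ _ _))//.
  apply: (@le_trans _ _ (exp_partial 0 n (modulus v))).
    by apply: ler_sum => i _; rewrite modulusM modulus_invfact modulusX.
  rewrite exp_partial_tail gerBl tail_ge0//; last exact: exp_coeff_series_cvg.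
  by move=> k; rewrite exp_coeff_ge0// modulus_ge0.
apply: (@expser_unique _ _ _ (fun n => t1 n * expR y + expR x * t2 n + d n)).
  have -> : 0 = 0 * expR y + expR x * 0 + 0 :> R by rewrite mul0r mulr0 !addr0.
  apply: cvgD => //; apply: cvgD; apply: cvgM;
    by [exact: exp_tail_cvg0|exact: cvg_cst].
move=> n.
have -> : cexp z * cexp w - exp_partial 0 n (z + w) =
  (cexp z - exp_partial 0 n z) * cexp w + exp_partial 0 n z * (cexp w - exp_partial 0 n w)
  + (exp_partial 0 n z * exp_partial 0 n w - exp_partial 0 n (z + w)) by ring.
rewrite (le_trans (modulusD _ _))//; apply: lerD => //.
rewrite (le_trans (modulusD _ _))//; apply: lerD; rewrite modulusM.
  by apply: ler_pM; rewrite ?modulus_ge0//; [exact: expser_approx|exact: modulus_expser_le].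
by apply: ler_pM; rewrite ?modulus_ge0//; exact: expser_approx.
Qed.

Lemma cexpN z : cexp z * cexp (- z) = 1.
Proof. by rewrite -cexpD subrr cexp0. Qed.

Lemma cexp_neq0 z : cexp z != 0.
Proof.
apply/negP => /eqP e; have := cexpN z; rewrite e mul0r => /eqP.
by rewrite eq_sym oner_eq0.
Qed.

Lemma modulus_cexp_sub1 z : modulus (cexp z - 1) <= modulus z * expR (modulus z).
Proof.
rewrite cexp_rec1 addrC addKr modulusM ler_wpM2l ?modulus_ge0//.
exact: modulus_expser_le.
Qed.

(** A zero z of (e^z - 1) / z = 1 + z expser 2 z would satisfy
    1 = |z expser 2 z| <= |z| e^|z|, which is less than 1. *)
Lemma expser1_neq0 z : modulus z < 2^-1 -> expser 1 z != 0.
Proof.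
move=> hz; apply/negP => /eqP e0.
have : modulus (z * expser 2 z) = 1.
  have := expser1_rec z.
  rewrite e0 => /esym/eqP; rewrite addrC addr_eq0 => /eqP ->.
  by rewrite modulusN modulus1.
rewrite modulusM => h.
have h2 := modulus_expser_le 2 z.
have h3 : expR (modulus z) < 2.
  rewrite -[ltLHS]invrK -expRN invf_plt ?posrE ?expR_gt0//.
  by rewrite (lt_le_trans _ (expR_ge1Dx _))//; lra.
have := modulus_ge0 z; have := modulus_ge0 (expser 2 z); nra.
Qed.

End exponential_series.

(** * Exponentials and logarithms in Banach algebras *)

Section exponentials_in_algebras.
Variables (R : realType) (X : Type).
Local Notation C := (Cplx R).
Local Notation T := (X -> C).
Variables (S : set T) (N : T -> R).
Hypothesis BA : banach_algebra S N.
Implicit Types (a b r : T).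

Lemma exp_partial_ba j n a : S a -> S (fun x => exp_partial j n (a x)).
Proof.
move=> Sa; have -> : (fun x => exp_partial j n (a x)) =
    \sum_(k < n) ((k + j)`!%:R^-1 : C) *: a ^+ k.
  by apply/funext => x; rewrite fct_sumE; apply: eq_bigr => k _; rewrite !fctE.
by apply: (ba_sum BA) => k; apply: (ba_scale BA); exact: (ba_exp BA).
Qed.

(** Power series of elements converge in norm, and their sums are computed
    pointwise. *)
Lemma expser_ba j a : S a -> S (fun x => expser j (a x)) /\
  N ((fun x => expser j (a x)) - (fun x => exp_partial j n (a x))) @[n --> \oo] --> (0 : R).
Proof.
move=> Sa; pose u k : T := ((k + j)`!%:R^-1 : C) *: a ^+ k.
have Su k : S (u k) by apply: (ba_scale BA); exact: (ba_exp BA).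
have uE n : \sum_(k < n) u k = (fun x => exp_partial j n (a x)).
  by apply/funext => x; rewrite fct_sumE; apply: eq_bigr => k _; rewrite /u !fctE.
have [] := @ba_complete _ _ _ _ BA u (N 1 *: exp_coeff (N a)) Su.
- move=> k; apply: (le_trans (ba_normZ BA _ (ba_exp BA k Sa))).
  rewrite modulus_invfact.
  have -> : (N 1 *: exp_coeff (N a)) k = k`!%:R^-1 * (N 1 * N a ^+ k).
    by rewrite [LHS](_ : _ = N 1 * (N a ^+ k / k`!%:R))//; ring.
  apply: ler_pM; rewrite ?(ba_ge0 BA) ?invfact_ge0 ?invfact_le//.
  exact: (ba_normX BA).
- by apply: is_cvg_seriesZ; exact: exp_coeff_series_cvg.
move=> s Ss cs.
suff -> : (fun x => expser j (a x)) = s.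
  by split=> //; under eq_fun do rewrite -uE.
apply/esym; apply: (ba_limit_eq (F := fun n => \sum_(k < n) u k) BA) => //.
  by move=> n; apply: (ba_sum BA).
move=> x; apply: (squeeze_cvgr _ (cvg_cst 0) (exp_tail_cvg0 (modulus (a x)))).
by near=> n; rewrite modulus_ge0 uE expser_approx.
Unshelve. all: by end_near. Qed.

Lemma ba_cexp a : S a -> S (cexp (R := R) \o a).
Proof. by move=> Sa; have [] := expser_ba 0 Sa. Qed.

Lemma expser_ba_norm j a : S a -> N (fun x => expser j (a x)) <= N 1 * expR (N a).
Proof.
move=> Sa; have [Ss cs] := expser_ba j Sa.
set s := fun x => _ in Ss cs *.
have le n : N s <= N (s - (fun x => exp_partial j n (a x))) + N 1 * expR (N a).
  have Sp := exp_partial_ba j n Sa.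
  rewrite -[in leLHS](subrK (fun x => exp_partial j n (a x)) s).
  rewrite (le_trans (ba_normD BA _ _))//; first exact: (ba_sub BA).
  rewrite lerD2l.
  have -> : (fun x => exp_partial j n (a x)) =
    \sum_(k < n) ((k + j)`!%:R^-1 : C) *: a ^+ k.
    by apply/funext => x; rewrite fct_sumE; apply: eq_bigr => k _; rewrite !fctE.
  apply: (@le_trans _ _ (N 1 * series (exp_coeff (N a)) n)).
    rewrite /series /= big_mkord mulr_sumr.
    have Su (k : nat) : S (((k + j)`!%:R^-1 : C) *: a ^+ k).
      by apply: (ba_scale BA); exact: (ba_exp BA).
    elim: n {Sp} => [|n ih]; first by rewrite !big_ord0 (ba_norm0 BA).
    rewrite !big_ord_recr /= (le_trans (ba_normD BA _ (Su n)))//.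
      by apply: (ba_sum BA).
    apply: lerD => //; apply: (le_trans (ba_normZ BA _ (ba_exp BA n Sa))).
    rewrite modulus_invfact.
    have -> : N 1 * exp_coeff (N a) n = n`!%:R^-1 * (N 1 * N a ^+ n).
      by rewrite /exp_coeff /=; ring.
    apply: ler_pM; rewrite ?(ba_ge0 BA) ?invfact_ge0 ?invfact_le//.
    exact: (ba_normX BA).
  rewrite ler_wpM2l ?(ba_ge0 BA)//.
  have cN : cvgn (series (exp_coeff (N a))) by exact: exp_coeff_series_cvg.
  have := tail_ge0 n (fun k => exp_coeff_ge0 k (ba_ge0 BA a)) cN.
  by rewrite /tail subr_ge0.
have c0 : N (s - (fun x => exp_partial j n (a x))) + N 1 * expR (N a) @[n --> \oo] -->
    (0 + N 1 * expR (N a) : R) by apply: cvgD => //; exact: cvg_cst.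
rewrite add0r in c0; apply: (ler_cvg_to (cvg_cst (N s)) c0).
by near=> n; exact: le.
Unshelve. all: by end_near. Qed.

(** If r is taken as an approximate logarithm of 1 + r, the quotient
    (1 + r) / e^r is 1 + log_error r. *)
Definition log_error r : T := fun x => (1 + r x) * cexp (- r x) - 1.

Lemma log_errorE r : log_error r =
  r ^+ 2 * ((fun x => expser 2 ((- r) x)) * (1 + r) - 1).
Proof.
by apply/funext => x; rewrite /log_error cexp_rec2 !fctE; ring.
Qed.

Lemma log_error_ba r : S r -> S (log_error r).
Proof.
move=> Sr; rewrite log_errorE.
have [Sh _] := expser_ba 2 (ba_opp BA Sr).
apply: (ba_mul BA); first exact: (ba_exp BA).
apply: (ba_sub BA); last exact: (ba1 BA).
by apply: (ba_mul BA) => //; apply: (ba_add BA) => //; exact: (ba1 BA).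
Qed.

(** The error is of second order, as its factorization by r^2 shows. *)
Lemma log_error_small : exists2 d : R, 0 < d &
  forall r, S r -> N r <= d -> N (log_error r) <= N r / 2.
Proof.
have n1 := ba_ge0 BA 1; have e1 := expR_gt0 (1 : R).
pose K := N 1 * expR 1 * (N 1 + 1) + N 1.
have K0 : 0 <= K by rewrite addr_ge0// mulr_ge0 ?mulr_ge0 ?addr_ge0// ltW.
exists (2 * (K + 1))^-1; first by rewrite invr_gt0; lra.
move=> r Sr rd; have r0 := ba_ge0 BA r.
have rK : N r * (2 * (K + 1)) <= 1 by rewrite -ler_pdivlMr ?div1r//; lra.
have r1 : N r <= 1 by nra.
have [Sh _] := expser_ba 2 (ba_opp BA Sr).
have hle := expser_ba_norm 2 (ba_opp BA Sr).
have hle' : N (fun x => expser 2 ((- r) x)) <= N 1 * expR 1.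
  apply: (le_trans hle); rewrite ler_wpM2l// ler_expR (ba_normN BA)//.
have S1r : S (1 + r) by apply: (ba_add BA) => //; exact: (ba1 BA).
have Sp : S ((fun x => expser 2 ((- r) x)) * (1 + r)) by exact: (ba_mul BA).
have bound : N ((fun x => expser 2 ((- r) x)) * (1 + r) - 1) <= K.
  apply: (le_trans (ba_normB BA Sp (ba1 BA))); rewrite lerD2r.
  apply: (le_trans (ba_normM BA Sh S1r)).
  apply: ler_pM; rewrite ?(ba_ge0 BA)//.
  by apply: (le_trans (ba_normD BA (ba1 BA) Sr)); rewrite lerD2l.
rewrite log_errorE.
have SX : S (r ^+ 2) by exact: (ba_exp BA).
apply: (le_trans (ba_normM BA SX (ba_sub BA Sp (ba1 BA)))).
have rr : N (r ^+ 2) <= N r * N r by rewrite expr2; exact: (ba_normM BA).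
have := ba_ge0 BA (r ^+ 2).
have := ba_ge0 BA ((fun x => expser 2 ((- r) x)) * (1 + r) - 1).
move=> h1 h2; apply: (@le_trans _ _ (N r * N r * K)); first exact: ler_pM.
nra.
Qed.

(** Newton iteration: divide 1 + r by e^r, replace r by the error and repeat.  The
    successive errors decrease geometrically and their sum is a logarithm. *)
Lemma log_near1 : exists2 d : R, 0 < d &
  forall r, S r -> N r <= d -> exists2 b, S b & cexp (R := R) \o b = 1 + r.
Proof.
have [d d0 hd] := log_error_small; exists d => // r Sr rd.
pose rr k := iter k log_error r.
have Srr k : S (rr k) by elim: k => // k ih; exact: log_error_ba.
have rrd k : N (rr k) <= N r * 2^-1 ^+ k.
  elim: k => [|k ih]; first by rewrite expr0 mulr1.
  have n0 := ba_ge0 BA r.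
  have p0 : 0 <= (2^-1 : R) ^+ k by rewrite exprn_ge0.
  have p1 : (2^-1 : R) ^+ k <= 1 by rewrite exprn_ile1//; lra.
  apply: (le_trans (hd _ (Srr k) _)).
    by apply: (le_trans ih); apply: le_trans rd; rewrite ler_piMr.
  by rewrite exprSr mulrA ler_wpM2r.
have cg : cvgn (series (geometric (N r) 2^-1)).
  by apply: is_cvg_geometric_series; rewrite ger0_norm//; lra.
have [b Sb cb] := ba_complete BA Srr rrd cg.
exists b => //.
have SP n : S (\sum_(k < n) rr k) by apply: (ba_sum BA).
have inv n x : (1 + r x) * cexp (- (\sum_(k < n) rr k) x) = 1 + rr n x.
  elim: n => [|n ih]; first by rewrite big_ord0 oppr0 cexp0 mulr1.
  rewrite big_ord_recr /= (_ : (_ + rr n) x = (\sum_(k < n) rr k) x + rr n x)// opprD cexpD mulrA ih /= /log_error.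
  by ring.
apply/funext => x /=.
have c1 := ba_cvg_pointwise BA x Sb SP cb.
pose y n := b x - (\sum_(k < n) rr k) x.
pose w : C := (1 + r x) * cexp (- b x) - 1.
have wE n : w = rr n x * cexp (- y n) + (cexp (- y n) - 1).
  have -> : w = (1 + r x) * cexp (- (\sum_(k < n) rr k) x) * cexp (- y n) - 1.
    by rewrite -mulrA -cexpD /w; congr (_ * cexp _ - 1); rewrite /y; ring.
  by rewrite inv; ring.
have c2 : (N r * 2^-1 ^+ n + modulus (y n)) * expR 1 @[n --> \oo] --> (0 : R).
  have -> : 0 = (N r * 0 + 0) * expR 1 :> R by rewrite mulr0 add0r mul0r.
  apply: cvgM; last exact: cvg_cst.
  apply: cvgD => //; apply: cvgM; first exact: cvg_cst.
  by apply: cvg_expr; rewrite ger0_norm//; lra.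
have w0 : modulus w <= 0.
  apply: (ler_cvg_to (cvg_cst (modulus w)) c2); near=> n.
  have y1 : modulus (y n) < 1.
    near: n; move/cvgrPdist_lt : c1 => /(_ _ ltr01); apply: filterS => n.
    by rewrite sub0r normrN ger0_norm ?modulus_ge0.
  rewrite (wE n) mulrDl (le_trans (modulusD _ _))//; apply: lerD.
    rewrite modulusM ler_pM ?modulus_ge0//.
      exact: (le_trans (ba_sup BA x (Srr n)) (rrd n)).
    by rewrite (le_trans (modulus_expser_le _ _))// modulusN ler_expR ltW.
  rewrite (le_trans (modulus_cexp_sub1 _))// modulusN ler_wpM2l ?modulus_ge0//.
  by rewrite ler_expR ltW.
have : w = 0 by apply/eqP; rewrite -modulus_eq0 eq_le w0 modulus_ge0.
rewrite /w => /eqP; rewrite subr_eq0 => /eqP e.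
suff : cexp (b x) = 1 + r x by [].
by rewrite -[LHS]mul1r -{1}e -mulrA [cexp (- _) * _]mulrC cexpN mulr1.
Unshelve. all: by end_near. Qed.

(** The set of the t in [0, 1] for which 1 + t b is an exponential contains 0, and
    it is open and closed: if 1 + t b is invertible, then for s close to t the
    quotient (1 + s b) / (1 + t b) is close to 1, hence is an exponential. *)
Lemma log_of_invertible_segment b : S b ->
  (forall t : R, 0 <= t -> t <= 1 -> exists2 v, S v & (1 + rc t *: b) * v = 1) ->
  exists2 c, S c & cexp (R := R) \o c = 1 + b.
Proof.
move=> Sb inv; have [d d0 hd] := log_near1.
pose E (t : R) := exists2 c, S c & cexp (R := R) \o c = 1 + rc t *: b.
have step (t : R) : 0 <= t -> t <= 1 -> exists2 e : R, 0 < e &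
    forall s, `|s - t| <= e -> (E t <-> E s).
  move=> t0 t1; have [v Sv hv] := inv t t0 t1.
  have n0 := ba_ge0 BA (b * v).
  have Sbv : S (b * v) by exact: (ba_mul BA).
  exists (d / (N (b * v) + 1)); first by rewrite divr_gt0// ltr_wpDl.
  move=> s st; pose r := rc (s - t) *: (b * v).
  have Sr : S r by exact: (ba_scale BA).
  have Nr : N r <= d.
    apply: (le_trans (ba_normZ BA _ Sbv)); rewrite modulus_rc.
    move: st; rewrite ler_pdivlMr ?ltr_wpDl//.
    by have := normr_ge0 (s - t); nra.
  have [c Sc hc] := hd r Sr Nr.
  have fac x : 1 + rc s * b x = (1 + rc t * b x) * cexp (c x).
    have hcx : cexp (c x) = 1 + rc (s - t) * (b x * v x) by have := congr1 (@^~ x) hc.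
    have hvx : (1 + rc t * b x) * v x = 1 by have := congr1 (@^~ x) hv.
    rewrite hcx mulrDr mulr1.
    have -> : (1 + rc t * b x) * (rc (s - t) * (b x * v x)) =
      rc (s - t) * b x * ((1 + rc t * b x) * v x) by ring.
    by rewrite hvx rcB; ring.
  split=> -[c' Sc' hc'].
    exists (c' + c); first exact: (ba_add BA).
    apply/funext => x /=; rewrite (_ : (c' + c) x = c' x + c x)// cexpD.
    have -> : cexp (c' x) = 1 + rc t * b x by have := congr1 (@^~ x) hc'.
    by rewrite -fac.
  exists (c' - c); first exact: (ba_sub BA).
  apply/funext => x /=; rewrite (_ : (c' - c) x = c' x - c x)// cexpD.
  have -> : cexp (c' x) = 1 + rc s * b x by have := congr1 (@^~ x) hc'.
  by rewrite fac -mulrA cexpN mulr1.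
pose A := [set t : R | [/\ 0 <= t, t <= 1 & E t]].
have A0 : A 0.
  split=> //; exists 0; first exact: (ba0 BA).
  apply/funext => x /=; rewrite cexp0.
  have -> : (1 + rc 0 *: b) x = 1 + rc 0 * b x by [].
  by rewrite (_ : rc 0 = 0 :> C)// mul0r addr0.
have ubA : ubound A 1 by move=> t [].
have hsA : has_sup A by split; [exists 0|exists 1].
pose s := sup A.
have s0 : 0 <= s by apply: ub_le_sup => //; exists 1.
have s1 : s <= 1 by apply: ge_sup => //; exists 0.
have [e e0 he] := step s s0 s1.
have Es : E s.
  have [t At lt] := sup_adherent e0 hsA.
  have ts : t <= s by apply: ub_le_sup => //; exists 1.
  apply/(he t); last by case: At.
  by rewrite distrC ger0_norm ?subr_ge0//; rewrite -/s in lt; lra.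
have E1 : E 1.
  have [s_1|s_1] := eqVneq s 1; first by rewrite -s_1.
  have lt1 : s < 1 by rewrite lt_neqAle s_1.
  pose t := Num.min 1 (s + e).
  have t1 : t <= 1 by rewrite ge_min lexx.
  have t2 : t <= s + e by rewrite ge_min lexx orbT.
  have t3 : s < t by rewrite lt_min lt1 ltrDl.
  have : t <= s.
    apply: ub_le_sup; first by exists 1.
    split => //; first lra.
    by apply/(he t) => //; rewrite ger0_norm; lra.
  lra.
have [c Sc hc] := E1; exists c => //; rewrite hc.
by apply/funext => x; rewrite !fctE; congr (_ + _); exact: mul1r.
Qed.

End exponentials_in_algebras.

(** * Positive definite functions *)

Section positive_definite_functions.
Variables (R : realType) (G : topologicalGroupType).
Local Notation C := (Cplx R).
Local Notation T := (G -> C).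
Implicit Types (phi psi u v : T) (x y : G).

(** A finite sequence of pairs (c, x) stands for the combination of the point
    masses c delta_x, and kernel_form phi for the sesquilinear form
    that phi induces on such combinations. *)
Definition kernel_form phi (s t : seq (C * G)) : C :=
  \sum_(p <- s) \sum_(q <- t) p.1 * Num.conj q.1 * phi (q.2^-1 * p.2)%g.

Lemma kernel_form_ge0 phi s : positive_definite phi -> 0 <= kernel_form phi s s.
Proof.
move=> h; have := h (size s) (fun i => (tnth (in_tuple s) i).2)
  (fun i => (tnth (in_tuple s) i).1).
congr (_ <= _); rewrite exchange_big /= /kernel_form [RHS]big_tnth.
apply: eq_bigr => j _; rewrite [RHS]big_tnth; apply: eq_bigr => i _.
by rewrite [X in _ = X * _]mulrC.
Qed.

Lemma pd1_ge0 phi : positive_definite phi -> 0 <= phi 1%g.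
Proof.
move=> /kernel_form_ge0 => /(_ [:: (1, 1%g)]).
by rewrite /kernel_form !big_seq1 /= conjC1 !mul1r invg1 mulg1.
Qed.

Lemma pd_two_points phi x (t : C) : positive_definite phi ->
  0 <= phi 1%g + Num.conj t * phi x^-1%g + t * phi x + t * Num.conj t * phi 1%g.
Proof.
move=> /kernel_form_ge0 => /(_ [:: (1, 1%g); (t, x)]).
rewrite /kernel_form !big_cons !big_nil /= conjC1 !addr0 !mul1r !mulr1 invg1.
by rewrite !mulg1 mulVg mul1g addrA.
Qed.

Lemma pd_inv phi x : positive_definite phi -> phi x^-1%g = Num.conj (phi x).
Proof.
move=> h; have /ge0_rc[e _] := pd1_ge0 h.
have h1 := pd_two_points x 1 h; have h2 := pd_two_points x ii h.
move: h1 h2 => /ge0_rc[h1 _] /ge0_rc[h2 _].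
move/(congr1 (@complex.Im R)) : h1; move/(congr1 (@complex.Im R)) : h2.
rewrite conjC1 conj_ii mulrN ii2 opprK !mul1r e !ImD Im_rc.
case: (phi x) => a b; case: (phi x^-1%g) => c d /= h1 h2.
by apply: cplx_eqP => /=; lra.
Qed.

Lemma pd_le1 phi x : positive_definite phi -> modulus (phi x) <= complex.Re (phi 1%g).
Proof.
move=> h; have /ge0_rc[e e0] := pd1_ge0 h.
rewrite -ler_sqr ?nnegrE ?modulus_ge0// [leRHS]expr2.
apply: quadratic_discriminant => // t.
have /ge0_rc[_] := pd_two_points x (Num.conj t) h.
rewrite pd_inv// e conjCK; congr (_ <= complex.Re _).
rewrite /=; ring.
Qed.

Lemma pd_add phi psi : positive_definite phi -> positive_definite psi ->
  positive_definite (phi + psi).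
Proof.
move=> h1 h2 n x c; rewrite (_ : \sum_i _ = \sum_(i < n) \sum_(j < n)
    Num.conj (c i) * c j * phi ((x i)^-1 * x j)%g + \sum_(i < n) \sum_(j < n)
    Num.conj (c i) * c j * psi ((x i)^-1 * x j)%g) ?addr_ge0//.
rewrite -big_split; apply: eq_bigr => i _; rewrite -big_split; apply: eq_bigr => j _.
exact: mulrDr.
Qed.

Lemma pd_scale (a : R) phi : 0 <= a -> positive_definite phi ->
  positive_definite (rc a *: phi).
Proof.
move=> a0 h n x c; rewrite (_ : \sum_i _ = rc a * \sum_(i < n) \sum_(j < n)
    Num.conj (c i) * c j * phi ((x i)^-1 * x j)%g) ?mulr_ge0 ?rc_ge0//.
rewrite mulr_sumr; apply: eq_bigr => i _; rewrite mulr_sumr; apply: eq_bigr => j _.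
by rewrite [RHS]mulrCA; congr (_ * _).
Qed.

Lemma pd_conj phi : positive_definite phi ->
  positive_definite (fun x => Num.conj (phi x)).
Proof.
move=> h n x c; have := h n x (fun i => Num.conj (c i)).
rewrite -conjC_ge0; congr (_ <= _); rewrite rmorph_sum; apply: eq_bigr => i _.
by rewrite rmorph_sum; apply: eq_bigr => j _; rewrite !rmorphM /= !conjCK.
Qed.

Lemma pd_cst1 : positive_definite (1 : T).
Proof.
move=> n x c; rewrite (_ : \sum_i _ = Num.conj (\sum_i c i) * \sum_i c i).
  by rewrite mulrC mul_conjC_ge0.
rewrite rmorph_sum mulr_suml; apply: eq_bigr => i _; rewrite mulr_sumr.
by apply: eq_bigr => j _; exact: mulr1.
Qed.

(** Schur product theorem: diagonalize the matrix of one of the two factors; with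
    its nonnegative eigenvalues as coefficients, the form of the product
    becomes a combination of values of the form of the other factor. *)
Lemma pd_mul phi psi : positive_definite phi -> positive_definite psi ->
  positive_definite (phi * psi).
Proof.
move=> h1 h2 n x c.
pose A : 'M[C]_n := \matrix_(i, j) phi ((x i)^-1 * x j)%g.
have Aherm : A \is hermsymmx.
  apply/is_hermitianmxP; rewrite expr0 scale1r; apply/matrixP => i j; rewrite !mxE.
  by rewrite -pd_inv// invgM invgK.
have /orthomx_spectralP := hermitian_normalmx Aherm.
have Pu := spectral_unitarymx A.
set P := spectralmx A in Pu *; set d := spectral_diag A => AE.
rewrite invmx_unitary// in AE.
have dE : diag_mx d = P *m A *m (P ^t Num.conj)%sesqui.
  have /unitarymxP PP := Pu.
  by rewrite AE !mulmxA PP mul1mx -mulmxA PP mulmx1.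
have d0 k : 0 <= d 0 k.
  have -> : d 0 k = diag_mx d k k by rewrite mxE eqxx mulr1n.
  rewrite dE mxE.
  have := h1 n x (fun i => Num.conj (P k i)).
  rewrite exchange_big /=; congr (_ <= _); apply: eq_bigr => j _; rewrite !mxE mulr_suml.
  by apply: eq_bigr => i _; rewrite !mxE conjCK; ring.
have entry i j : phi ((x i)^-1 * x j)%g = \sum_k Num.conj (P k i) * d 0 k * P k j.
  have := congr1 (fun B : 'M[C]_n => fun_of_matrix B i j) AE; rewrite !mxE => ->.
  apply: eq_bigr => k _; congr (_ * _); rewrite mxE (bigD1 k) //= big1 ?addr0.
    by rewrite !mxE eqxx mulr1n.
  by move=> l lk; rewrite !mxE (negbTE lk) mulr0n mulr0.
rewrite (_ : \sum_i _ = \sum_k d 0 k * \sum_(i < n) \sum_(j < n)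
    Num.conj (P k i * c i) * (P k j * c j) * psi ((x i)^-1 * x j)%g).
  by apply: sumr_ge0 => k _; rewrite mulr_ge0//; exact: h2.
under [RHS]eq_bigr do rewrite mulr_sumr.
rewrite [RHS]exchange_big /=; apply: eq_bigr => i _.
under [RHS]eq_bigr do rewrite mulr_sumr.
rewrite [RHS]exchange_big /=; apply: eq_bigr => j _.
rewrite (_ : (phi * psi) _ = phi ((x i)^-1 * x j)%g * psi ((x i)^-1 * x j)%g)//.
rewrite entry mulr_suml mulr_sumr; apply: eq_bigr => k _.
by rewrite rmorphM /=; ring.
Qed.

Lemma ge0_limit (z : nat -> C) (l : C) : (forall n, 0 <= z n) ->
  modulus (l - z n) @[n --> \oo] --> (0 : R) -> 0 <= l.
Proof.
move=> z0 h.
have im : complex.Im l = 0.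
  apply/eqP; rewrite -normr_eq0 eq_le normr_ge0 andbT.
  apply: (ler_cvg_to (cvg_cst `|complex.Im l|) h); near=> n.
  have /ge0_rc[e _] := z0 n.
  rewrite (le_trans _ (Im_le_modulus _))// ImD ImN e Im_rc subr0//.
have re : 0 <= complex.Re l.
  rewrite -oppr_le0; apply: (ler_cvg_to (cvg_cst (- complex.Re l)) h); near=> n.
  have /ge0_rc[_ r0] := z0 n.
  have := Re_le_modulus (l - z n); rewrite ReD ReN.
  have := ler_norm (- (complex.Re l - complex.Re (z n))); rewrite normrN; lra.
by rewrite (_ : l = rc (complex.Re l)) ?rc_ge0//; exact: cplx_eqP.
Unshelve. all: by end_near. Qed.

Lemma pd_limit (f : nat -> T) phi (t : R^nat) : (forall n, positive_definite (f n)) ->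
  t n @[n --> \oo] --> (0 : R) -> (forall n x, modulus (phi x - f n x) <= t n) ->
  positive_definite phi.
Proof.
move=> pf t0 h n x c.
pose K : R := \sum_(i < n) \sum_(j < n) modulus (Num.conj (c i) * c j).
apply: (ge0_limit (fun m => pf m n x c)).
have Kt : K * t m @[m --> \oo] --> (0 : R).
  by rewrite -(mulr0 K); apply: cvgM => //; exact: cvg_cst.
apply: (squeeze_cvgr _ (cvg_cst 0) Kt); near=> m; rewrite modulus_ge0 /=.
rewrite -sumrB (le_trans (modulus_sum _ _ _))// /K mulr_suml; apply: ler_sum => i _.
rewrite -sumrB (le_trans (modulus_sum _ _ _))// mulr_suml; apply: ler_sum => j _.
by rewrite -mulrBr [leLHS]modulusM; apply: ler_wpM2l => //; exact: modulus_ge0.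
Unshelve. all: by end_near. Qed.

End positive_definite_functions.

(** * The Fourier-Stieltjes algebra as a Banach algebra *)

Section fourier_stieltjes_norm.
Variables (R : realType) (G : topologicalGroupType).
Local Notation C := (Cplx R).
Local Notation T := (G -> C).
Implicit Types (phi psi u v : T) (x y : G) (s t : R).

Definition cpd phi := continuous phi /\ positive_definite phi.

Lemma cpd0 : cpd 0.
Proof.
split; first by move=> x; exact: cvg_cst.
have := @pd_scale R G 0 1 (lexx 0) (@pd_cst1 R G).
by rewrite (_ : rc 0 = 0 :> C)// scale0r.
Qed.

Lemma cpd1 : cpd 1.
Proof. by split; [move=> x; exact: cvg_cst|exact: pd_cst1]. Qed.

Lemma cpd_add phi psi : cpd phi -> cpd psi -> cpd (phi + psi).
Proof.
move=> [h1 h2] [h3 h4].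
by split; [exact: (continuousC_D h1 h3)|exact: (pd_add h2 h4)].
Qed.

Lemma cpd_scale (a : R) phi : 0 <= a -> cpd phi -> cpd (rc a *: phi).
Proof.
move=> a0 [h1 h2].
by split; [exact: (continuousC_Z (c := rc a) h1)|exact: (pd_scale a0 h2)].
Qed.

Lemma cpd_mul phi psi : cpd phi -> cpd psi -> cpd (phi * psi).
Proof.
move=> [h1 h2] [h3 h4].
by split; [exact: (continuousC_M h1 h3)|exact: (pd_mul h2 h4)].
Qed.

Definition value1 phi : R := complex.Re (phi 1%g).

Lemma value1_ge0 phi : cpd phi -> 0 <= value1 phi.
Proof. by move=> [_ /pd1_ge0/ge0_rc[]]. Qed.

Lemma value1E phi : cpd phi -> phi 1%g = rc (value1 phi).
Proof. by move=> [_ /pd1_ge0/ge0_rc[]]. Qed.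

Lemma modulus_cpd phi x : cpd phi -> modulus (phi x) <= value1 phi.
Proof. by move=> [_ /pd_le1]. Qed.

(** [fs_rep u t] holds when u is a combination of continuous positive definite
    functions phi_i with coefficients c_i such that t = \sum_i |c_i| phi_i(1). *)
Inductive fs_rep : T -> R -> Prop :=
| fs_rep0 : fs_rep 0 0
| fs_repD u t (c : C) phi : fs_rep u t -> cpd phi ->
    fs_rep (c *: phi + u) (modulus c * value1 phi + t).

Lemma fs_rep_ge0 u t : fs_rep u t -> 0 <= t.
Proof.
elim=> // {}u {}t c phi _ t0 h; rewrite addr_ge0// mulr_ge0 ?modulus_ge0//.
exact: value1_ge0.
Qed.

Lemma fs_rep_add u v s t : fs_rep u s -> fs_rep v t -> fs_rep (u + v) (s + t).
Proof.
move=> hu hv; elim: hu => [|{}u {}s c phi _ ih h]; first by rewrite !add0r.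
by rewrite -!addrA; exact: fs_repD.
Qed.

Lemma fs_rep_cpd phi : cpd phi -> fs_rep phi (value1 phi).
Proof.
move=> h; have := fs_repD 1 fs_rep0 h.
by rewrite scale1r modulus1 mul1r !addr0.
Qed.

Lemma fs_rep_scale (c : C) u t : fs_rep u t -> fs_rep (c *: u) (modulus c * t).
Proof.
elim=> [|{}u {}t d phi _ ih h]; first by rewrite scaler0 mulr0; exact: fs_rep0.
by rewrite scalerDr scalerA mulrDr mulrA -modulusM; exact: fs_repD.
Qed.

Lemma fs_rep_mul u v s t : fs_rep u s -> fs_rep v t -> fs_rep (u * v) (s * t).
Proof.
have mulp phi w r : cpd phi -> fs_rep w r -> fs_rep (phi * w) (value1 phi * r).
  move=> hphi; elim=> [|{}w {}r c psi _ ih hpsi]; first by rewrite !mulr0; exact: fs_rep0.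
  have -> : phi * (c *: psi + w) = c *: (phi * psi) + phi * w.
    apply/funext => x; rewrite !fctE mulrDr; congr (_ + _); exact: mulrCA.
  rewrite mulrDr; have -> : value1 phi * (modulus c * value1 psi) =
    modulus c * value1 (phi * psi).
    have e : (phi * psi) 1%g = rc (value1 phi * value1 psi).
      by rewrite rcM -(value1E hphi) -(value1E hpsi).
    by rewrite [value1 (phi * psi)]/value1 e Re_rc mulrCA.
  by apply: fs_repD => //; exact: cpd_mul.
move=> hu hv; elim: hu => [|{}u {}s c phi _ ih h].
  by rewrite !mul0r; exact: fs_rep0.
have -> : (c *: phi + u) * v = c *: (phi * v) + u * v.
  by apply/funext => x; rewrite !fctE mulrDl; congr (_ + _); exact/esym/mulrA.
rewrite mulrDl -mulrA; apply: fs_rep_add => //.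
by apply: fs_rep_scale; exact: mulp.
Qed.

Lemma fs_rep_sup u t x : fs_rep u t -> modulus (u x) <= t.
Proof.
elim=> [|{}u {}t c phi _ ih h]; first by rewrite modulus0.
apply: (le_trans (modulusD _ _)); apply: lerD => //.
by rewrite [leLHS]modulusM ler_wpM2l ?modulus_ge0// modulus_cpd.
Qed.

Lemma fs_rep_continuous u t : fs_rep u t -> continuous u.
Proof.
elim=> [|{}u {}t c phi _ ih [h _]]; first by move=> x; exact: cvg_cst.
exact: (continuousC_D (continuousC_Z (c := c) h) ih).
Qed.

Lemma FS_repP u : FS R G u <-> exists t, fs_rep u t.
Proof.
split=> [[n [c [phi [hphi ->]]]]|[t]].
  elim: n c phi hphi => [|n ih] c phi hphi.
    by exists 0; rewrite big_ord0; exact: fs_rep0.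
  rewrite big_ord_recl.
  have [|t ht] := ih (fun i => c (lift ord0 i)) (fun i => phi (lift ord0 i)).
    by move=> i; exact: hphi.
  exists (modulus (c ord0) * value1 (phi ord0) + t); exact: fs_repD.
elim=> [|{}u {}t c phi _ [n [d [psi [hpsi ->]]]] hphi].
  exists 0, (fun=> 0), (fun _ _ => 0); split; first by case.
  by rewrite big_ord0.
exists n.+1, (fun i => oapp d c (unlift ord0 i)), (fun i => oapp psi phi (unlift ord0 i)).
split=> [i|]; first by case: (unlift ord0 i).
rewrite big_ord_recl unlift_none /=; congr (_ + _).
by apply: eq_bigr => i _; rewrite liftK.
Qed.

(** A norm on B(G) whose submultiplicativity and completeness are elementary, the
    former because products of positive definite functions are positive
    definite.  It bounds the dual norm from above. *)
Definition pd_norm u : R := inf [set t | fs_rep u t].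

Lemma pd_norm_ge0 u : 0 <= pd_norm u.
Proof. by apply: inf_ge0 => t /fs_rep_ge0. Qed.

Lemma pd_norm_le u t : fs_rep u t -> pd_norm u <= t.
Proof. by move=> h; apply: ge_inf_of_ge0 => // s /fs_rep_ge0. Qed.

Lemma pd_norm_lt u t : FS R G u -> pd_norm u < t -> exists2 s, fs_rep u s & s < t.
Proof. by move=> /FS_repP[s hs] /inf_lt h; apply: h; exists s. Qed.

Lemma FS_cpd phi : cpd phi -> FS R G phi.
Proof. by move=> h; apply/FS_repP; exists (value1 phi); exact: fs_rep_cpd. Qed.

Lemma FS_continuous u : FS R G u -> continuous u.
Proof. by move=> /FS_repP[t]; exact: fs_rep_continuous. Qed.

Lemma FS_lin (c : C) u v : FS R G u -> FS R G v -> FS R G (c *: u + v).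
Proof.
move=> /FS_repP[s hs] /FS_repP[t ht]; apply/FS_repP; exists (modulus c * s + t).
by apply: fs_rep_add => //; exact: fs_rep_scale.
Qed.

Lemma FS_mul u v : FS R G u -> FS R G v -> FS R G (u * v).
Proof.
move=> /FS_repP[s hs] /FS_repP[t ht]; apply/FS_repP; exists (s * t).
exact: fs_rep_mul.
Qed.

Lemma FS_conj u : FS R G u -> FS R G (fun x => Num.conj (u x)).
Proof.
move=> /FS_repP[s hs]; apply/FS_repP; exists s.
elim: hs => [|{}u {}s c phi _ ih h].
  have -> : (fun x => Num.conj ((0 : T) x)) = 0 by apply/funext => x; exact: conjC0.
  exact: fs_rep0.
have -> : (fun x => Num.conj ((c *: phi + u) x)) = Num.conj c *: (fun x => Num.conj (phi x))
    + (fun x => Num.conj (u x)).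
  by apply/funext => x; rewrite fctE rmorphD; congr (_ + _); exact: rmorphM.
have -> : value1 phi = value1 (fun x => Num.conj (phi x)) by rewrite /value1 Re_conj.
rewrite -(modulus_conj c); apply: fs_repD => //.
by case: h => h1 h2; split; [exact: continuousC_conj|exact: pd_conj].
Qed.

(** Combinations of finitely many positive definite functions with complex
    coefficients are reduced to four functions of bounded size, on which series
    are summed separately. *)
Definition four_parts (f : 'I_4 -> T) : T :=
  f 0 - f 1 + ii *: (f 2%:R - f 3%:R).

Lemma fs_rep_four_parts u t : fs_rep u t -> exists f : 'I_4 -> T,
  [/\ forall i, cpd (f i), forall i, value1 (f i) <= t & u = four_parts f].
Proof.
elim=> [|{}u {}t c phi ru [f [f1 f2 ->]] h].
  exists (fun=> 0); split=> [_|_|]; [exact: cpd0|by rewrite /value1|].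
  by rewrite /four_parts subrr scaler0 addr0.
pose a := complex.Re c; pose b := complex.Im c.
pose k (i : 'I_4) : R := if i == 0 then Num.max a 0 else if i == 1 then Num.max (- a) 0
  else if i == 2%:R then Num.max b 0 else Num.max (- b) 0.
have k0 i : 0 <= k i by rewrite /k; do ?case: ifP => _; rewrite le_max lexx orbT.
have km i : k i <= modulus c.
  have := Re_le_modulus c; have := Im_le_modulus c; rewrite !ler_norml -/a -/b.
  have := modulus_ge0 c => m0 /andP[i1 i2] /andP[r1 r2].
  by rewrite /k; do ?case: ifP => _; rewrite ge_max m0 andbT //; lra.
exists (fun i => rc (k i) *: phi + f i); split.
- by move=> i; apply: cpd_add => //; exact: cpd_scale.
- move=> i; have -> : value1 (rc (k i) *: phi + f i) = k i * value1 phi + value1 (f i).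
    rewrite /value1 [(_ + _) _]/(rc (k i) * phi 1%g + f i 1%g) ReD value1E// -rcM.
    by rewrite Re_rc.
  by apply: lerD => //; rewrite ler_wpM2r ?value1_ge0.
have ka : rc (Num.max a 0) - rc (Num.max (- a) 0) = rc a :> C.
  by rewrite -rcB; congr rc; case: (leP a 0); case: (leP (- a) 0); lra.
have kb : rc (Num.max b 0) - rc (Num.max (- b) 0) = rc b :> C.
  by rewrite -rcB; congr rc; case: (leP b 0); case: (leP (- b) 0); lra.
have -> : c = (rc (k 0) - rc (k 1)) + ii * (rc (k 2%:R) - rc (k 3%:R)).
  by rewrite [LHS]cplxE -/a -/b -ka -kb.
apply/funext => x; rewrite /four_parts !fctE.
have E (z w : C) : z *: w = z * w by [].
rewrite !E; ring.
Qed.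

Lemma fs_rep_of_four_parts (f : 'I_4 -> T) t : (forall i, cpd (f i)) ->
  (forall i, value1 (f i) <= t) -> FS R G (four_parts f) /\
  pd_norm (four_parts f) <= 4 * t.
Proof.
move=> hf ft.
have h i := fs_rep_cpd (hf i).
have hn i := fs_rep_scale (-1) (h i).
have := fs_rep_add (fs_rep_add (h 0) (hn 1))
  (fs_rep_scale ii (fs_rep_add (h 2%:R) (hn 3%:R))).
rewrite !scaleN1r !modulusN modulus1 modulus_ii !mul1r => H; split.
  by apply/FS_repP; eexists; exact: H.
apply: (le_trans (pd_norm_le H)).
by have := (ft 0, ft 1, (ft 2%:R, ft 3%:R)) => -[[? ?] [? ?]]; lra.
Qed.

Lemma uniform_limit_continuous (f : nat -> T) phi (t : R^nat) :
  (forall n, continuous (f n)) -> t n @[n --> \oo] --> (0 : R) ->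
  (forall n x, modulus (phi x - f n x) <= t n) -> continuous phi.
Proof.
move=> cf t0 h; apply/continuousC_P => x e e0.
have e3 : 0 < e / 3 by rewrite divr_gt0.
have /cvgrPdist_lt/(_ _ e3)[n _ /(_ n (leqnn n))] := t0.
rewrite sub0r normrN => tn.
have tn' : t n < e / 3 by exact: le_lt_trans (ler_norm _) tn.
have /continuousC_P/(_ x _ e3) := cf n.
apply: filterS => y hy.
have -> : phi y - phi x = (phi y - f n y) - (phi x - f n x) + (f n y - f n x) by ring.
apply: (le_lt_trans (modulusD _ _)).
have := modulusB (phi y - f n y) (phi x - f n x); have := h n x; have := h n y; lra.
Qed.

(** The remainders of a series of positive definite functions are themselves
    positive definite, so that their norm is their value at 1. *)
Lemma cpd_series (f : nat -> T) (b : R^nat) : (forall k, cpd (f k)) ->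
  (forall k, value1 (f k) <= b k) -> cvgn (series b) ->
  exists psi, forall n, cpd (psi - \sum_(k < n) f k) /\
    value1 (psi - \sum_(k < n) f k) <= tail b n.
Proof.
move=> hf fb cb.
have fbx k x : modulus (f k x) <= b k by exact: le_trans (modulus_cpd x (hf k)) (fb k).
have /choice[psi hpsi] x := complex_series_cvg (fun k => fbx k x) cb.
exists psi => n.
have hn m x : modulus ((psi - \sum_(k < n) f k) x - (\sum_(n <= k < n + m) f k) x)
    <= tail b (n + m).
  have := hpsi x (n + m)%N; congr (modulus _ <= _).
  rewrite !fctE !fct_sumE -(big_mkord xpredT (fun k => f k x)).
  rewrite (@big_cat_nat _ _ _ n) ?leq_addr//= big_mkord; ring.
have t0 : tail b (n + m) @[m --> \oo] --> (0 : R).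
  have := tail_cvg0 cb; rewrite -(cvg_shiftn n); under eq_fun do rewrite addnC.
  exact.
have hs m : cpd (\sum_(n <= k < n + m) f k).
  by elim/big_ind : _ => //; [exact: cpd0|exact: cpd_add].
have hpd : cpd (psi - \sum_(k < n) f k).
  split; first exact: (uniform_limit_continuous (fun m => (hs m).1) t0 hn).
  exact: (pd_limit (fun m => (hs m).2) t0 hn).
split=> //; rewrite /value1 (le_trans (ler_norm _))// (le_trans (Re_le_modulus _))//.
by have := hpsi 1%g n; rewrite fctE fct_sumE.
Qed.

Lemma four_partsB (f g : 'I_4 -> T) :
  four_parts f - four_parts g = four_parts (fun i => f i - g i).
Proof.
apply/funext => x; rewrite /four_parts !fctE.
have E (z w : C) : z *: w = z * w by [].
by rewrite !E; ring.
Qed.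

Lemma four_parts_sum n (f : nat -> 'I_4 -> T) :
  \sum_(k < n) four_parts (f k) = four_parts (fun i => \sum_(k < n) f k i).
Proof.
elim: n => [|n ih].
  rewrite big_ord0; apply/esym; rewrite /four_parts !big_ord0 subrr scaler0.
  by rewrite addr0.
rewrite big_ord_recr /= ih.
have -> : (fun i => \sum_(k < n.+1) f k i) = (fun i => \sum_(k < n) f k i + f n i).
  by apply/funext => i; rewrite big_ord_recr.
apply/funext => x; rewrite /four_parts !fctE.
have E (z w : C) : z *: w = z * w by [].
by rewrite !E; ring.
Qed.

Lemma FS_complete (u : nat -> T) (a : R^nat) : (forall k, FS R G (u k)) ->
  (forall k, pd_norm (u k) <= a k) -> cvgn (series a) ->
  exists2 s, FS R G s & pd_norm (s - \sum_(k < n) u k) @[n --> \oo] --> (0 : R).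
Proof.
move=> hu ua ca.
(* The infimum that defines the norm need not be attained: the terms are
   represented with an excess 2^-k. *)
pose b k : R := a k + 2^-1 ^+ k.
have cb : cvgn (series b).
  have -> : series b = series a + series (geometric 1 2^-1).
    rewrite /b -[RHS]seriesD; congr series; apply/funext => k.
    by rewrite fctE /geometric /= mul1r.
  apply: is_cvgD => //; apply: is_cvg_geometric_series.
  by rewrite ger0_norm//; lra.
have /choice[f hf] k : exists f : 'I_4 -> T,
    [/\ forall i, cpd (f i), forall i, value1 (f i) <= b k & u k = four_parts f].
  have lt : pd_norm (u k) < b k.
    by rewrite (le_lt_trans (ua k))// ltrDl exprn_gt0// invr_gt0.
  have [t ht tb] := pd_norm_lt (hu k) lt.
  have [f [f1 f2 f3]] := fs_rep_four_parts ht; exists f; split => // i.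
  exact: le_trans (f2 i) (ltW tb).
have /choice[psi hpsi] (i : 'I_4) : exists psi, forall n,
    cpd (psi - \sum_(k < n) f k i) /\ value1 (psi - \sum_(k < n) f k i) <= tail b n.
  by apply: (@cpd_series (fun k => f k i)) => // k; have [h1 h2 _] := hf k.
have key n : FS R G (four_parts psi - \sum_(k < n) u k) /\
    pd_norm (four_parts psi - \sum_(k < n) u k) <= 4 * tail b n.
  have -> : \sum_(k < n) u k = \sum_(k < n) four_parts (f k).
    by apply: eq_bigr => k _; have [_ _ ->] := hf k.
  rewrite four_parts_sum four_partsB; apply: fs_rep_of_four_parts => i.
    by have [] := hpsi i n.
  by have [] := hpsi i n.
exists (four_parts psi).
  by have [] := key 0; rewrite big_ord0 subr0.
have c4 : 4 * tail b n @[n --> \oo] --> (0 : R).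
  by rewrite -(mulr0 4); apply: cvgM; [exact: cvg_cst|exact: tail_cvg0].
apply: (squeeze_cvgr _ (cvg_cst 0) c4); near=> n.
by rewrite pd_norm_ge0 /=; have [] := key n.
Unshelve. all: by end_near. Qed.

Theorem FS_banach_algebra : banach_algebra (FS R G) pd_norm.
Proof.
have approx u v t : FS R G u -> FS R G v ->
    (forall a b, fs_rep u a -> fs_rep v b -> t <= a + b) -> t <= pd_norm u + pd_norm v.
  move=> hu hv h; apply/ler_addgt0Pr => e e0.
  have e2 : 0 < e / 2 by rewrite divr_gt0.
  have [a ha ua] : exists2 s, fs_rep u s & s < pd_norm u + e / 2.
    by apply: pd_norm_lt => //; rewrite ltrDl.
  have [b hb vb] : exists2 s, fs_rep v s & s < pd_norm v + e / 2.
    by apply: pd_norm_lt => //; rewrite ltrDl.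
  by have := h _ _ ha hb; lra.
split.
- exact: FS_cpd cpd1.
- exact: FS_lin.
- exact: FS_mul.
- exact: pd_norm_ge0.
- move=> u x hu; rewrite leNgt; apply/negP => /(pd_norm_lt hu)[s hs].
  by rewrite ltNge (fs_rep_sup x hs).
- by move=> u v hu hv; apply: approx => // a b ha hb; apply: pd_norm_le; exact: fs_rep_add.
- move=> c u hu; have [->|c0] := eqVneq c 0.
    by rewrite modulus0 mul0r scale0r; exact: (pd_norm_le fs_rep0).
  have m0 : 0 < modulus c by rewrite modulus_gt0.
  rewrite -ler_pdivrMl//; have /FS_repP[s0 hs0] := hu.
  apply: lb_le_inf; first by exists s0.
  by move=> s hs; rewrite ler_pdivrMl//; apply: pd_norm_le; exact: fs_rep_scale.
- move=> u v hu hv; apply: le_mul_approx; [exact: pd_norm_ge0..|].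
  move=> a b /(pd_norm_lt hu)[s hs sa] /(pd_norm_lt hv)[t ht tb].
  apply: (le_trans (pd_norm_le (fs_rep_mul hs ht))).
  by apply: ler_pM; rewrite ?(fs_rep_ge0 hs) ?(fs_rep_ge0 ht) ?ltW.
- exact: FS_complete.
Qed.

End fourier_stieltjes_norm.

(** * Compactly supported functions *)

Section compactly_supported_functions.
Variables (R : realType) (G : topologicalGroupType).
Hypothesis hG : hausdorff_space G.
Hypothesis lcG : locally_compact [set: G].
Local Notation C := (Cplx R).
Local Notation T := (G -> C).
Implicit Types (f : T) (g h k : G -> R) (x y z : G).

Lemma translation_continuous y : continuous (fun x => (y * x)%g).
Proof.
move=> x; have c : (fun z : G => (y, z)) z @[z --> x] --> (y, x).
  by apply: cvg_pair; [exact: cvg_cst|exact: cvg_id].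
exact: (cvg_comp _ _ c (@mulg_continuous G (y, x))).
Qed.

Lemma compactly_supportedP f K : compact K -> (forall x, ~ K x -> f x = 0) ->
  compactly_supported f.
Proof.
move=> cK fK; apply: (subclosed_compact _ cK); first exact: closed_closure.
rewrite [X in _ `<=` X](closure_id K).1; last exact: compact_closed.
apply: closure_subset => x fx; apply: contrapT => /fK e; move: fx.
by rewrite /= e eqxx.
Qed.

Lemma support_closure f x : ~ closure [set x | f x != 0] x -> f x = 0.
Proof.
by move=> h; apply/eqP; apply: contra_notT h => fx; exact: subset_closure.
Qed.

Definition CcR g := Cc R G (fun x => rc (g x)).

Lemma CcRP g K : continuous g -> compact K -> (forall x, ~ K x -> g x = 0) -> CcR g.
Proof.
move=> cg cK gK; split; first exact: continuousC_rc.
by apply: compactly_supportedP cK _ => x /gK ->.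
Qed.

Lemma CcR_continuous g : CcR g -> continuous g.
Proof. by move=> [cg _]; exact: (continuousC_Re cg). Qed.

Lemma CcR_support g : CcR g -> exists2 K, compact K & forall x, ~ K x -> g x = 0.
Proof.
move=> [_ cs]; exists (closure [set x | (rc (g x) : C) != 0]) => // x hx.
by have := support_closure hx => /(@rcI R).
Qed.

Lemma CcR_add g h : CcR g -> CcR h -> CcR (fun x => g x + h x).
Proof.
move=> cg ch; have [K1 cK1 g0] := CcR_support cg; have [K2 cK2 h0] := CcR_support ch.
apply: (@CcRP _ (K1 `|` K2)).
- by move=> x; apply: cvgD; apply: CcR_continuous.
- exact: compactU.
- by move=> x /not_orP[n1 n2]; rewrite g0// h0// addr0.
Qed.

Lemma CcR_mul g h : CcR g -> continuous h -> CcR (fun x => g x * h x).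
Proof.
move=> cg ch; have [K cK g0] := CcR_support cg.
apply: (@CcRP _ K) => //.
- by move=> x; apply: cvgM; [exact: CcR_continuous|exact: ch].
- by move=> x nK; rewrite g0// mul0r.
Qed.

Lemma CcR_scale (a : R) g : CcR g -> CcR (fun x => a * g x).
Proof.
move=> cg; have -> : (fun x => a * g x) = (fun x => g x * cst a x).
  by apply/funext => x; rewrite mulrC.
by apply: CcR_mul => // x; exact: cvg_cst.
Qed.

Lemma CcR_sub g h : CcR g -> CcR h -> CcR (fun x => g x - h x).
Proof.
move=> cg ch; have := CcR_add cg (CcR_scale (-1) ch).
by congr CcR; apply/funext => x; rewrite mulN1r.
Qed.

Lemma CcR_translate y g : CcR g -> CcR (fun x => g (y * x)%g).
Proof.
move=> cg; have [K cK g0] := CcR_support cg.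
apply: (@CcRP _ ((fun x => (y^-1 * x)%g) @` K)).
- move=> x.
  have /(_ (y * x)%g) c := CcR_continuous cg.
  exact: (cvg_comp _ _ (@translation_continuous y x) c).
- apply: continuous_compact => //; apply: continuous_subspaceT.
  exact: translation_continuous.
- move=> x nK; apply: g0 => Kyx; apply: nK; exists (y * x)%g => //.
  by rewrite mulgA mulVg mul1g.
Qed.

Lemma CcR_modulus f : Cc R G f -> CcR (fun x => modulus (f x)).
Proof.
move=> [cf cs]; apply: (CcRP _ cs); first exact: continuous_modulus.
by move=> x /support_closure ->; rewrite modulus0.
Qed.

Lemma CcR_Re f : Cc R G f -> CcR (fun x => complex.Re (f x)).
Proof.
move=> [cf cs]; apply: (CcRP _ cs); first exact: continuousC_Re.
by move=> x /support_closure ->.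
Qed.

Lemma CcR_abs g : CcR g -> CcR (fun x => `|g x|).
Proof.
move=> /CcR_modulus; congr CcR; apply/funext => x; exact: modulus_rc.
Qed.

Lemma Cc_scale (c : C) f : Cc R G f -> Cc R G (c *: f).
Proof.
move=> [cf cs]; split; first exact: (continuousC_Z cf).
apply: compactly_supportedP cs _ => x /support_closure e.
by rewrite fctE e scaler0.
Qed.

Lemma Cc_add f f' : Cc R G f -> Cc R G f' -> Cc R G (f + f').
Proof.
move=> [cf cs] [cf' cs']; split; first exact: (continuousC_D cf cf').
apply: compactly_supportedP (compactU cs cs') _ => x /not_orP[n1 n2].
by rewrite fctE (support_closure n1) (support_closure n2) addr0.
Qed.

Lemma Cc_mul f u : Cc R G f -> continuous u -> Cc R G (f * u).
Proof.
move=> [cf cs] cu; split; first exact: (continuousC_M cf cu).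
apply: compactly_supportedP cs _ => x /support_closure e.
by rewrite fctE e mul0r.
Qed.

Lemma CcR_Im f : Cc R G f -> CcR (fun x => complex.Im (f x)).
Proof.
move=> /(Cc_scale (- ii)) /CcR_Re; congr CcR; apply/funext => x.
have -> : (- ii *: f) x = - ii * f x by [].
by case: (f x) => a b /=; ring.
Qed.

Lemma bump x (U : set G) : nbhs x U -> exists g, [/\ CcR g, forall z, 0 <= g z,
  g x = 1 & forall z, ~ U z -> g z = 0].
Proof.
move=> Ux; have [//|V] := @lcG x; rewrite withinET => Vx [cV clV].
have UVx : nbhs x (U `&` V) by exact: filterI.
pose B := ~` (U `&` V)°.
have clB : closed B by apply: open_closedC; exact: open_interior.
have nBx : ~ B x by apply; exact: UVx.
have := locally_compact_completely_regular (R := R) lcG hG clB nBx.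
move=> /(@uniform_separatorP _ R)[g [cg g01 gx gB]].
have gout z : ~ (U `&` V) z -> g z = 1.
  move=> nz; apply: gB; exists z => // /interior_subset; exact: nz.
have g1 z : g z <= 1.
  by have := g01 (g z); rewrite /= in_itv /= => h; have /andP[] := h (imageP _ I).
exists (fun z => 1 - g z); split.
- apply: (CcRP _ cV).
    by move=> z; apply: cvgB; [exact: cvg_cst|exact: cg].
  by move=> z nz; rewrite gout ?subrr// => -[_ /nz].
- by move=> z; rewrite subr_ge0.
- by rewrite (gx (g x)) ?subr0//; exists x.
- by move=> z nz; rewrite gout ?subrr// => -[/nz].
Qed.

(** Finitely many of the neighbourhoods cover K, and the sum of the functions that
    dominate k on them dominates k on K. *)
Lemma compact_domination (H : set (G -> R)) k K : compact K ->
  H (cst 0) -> (forall g h, H g -> H h -> H (fun x => g x + h x)) ->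
  (forall h x, H h -> 0 <= h x) ->
  (forall x, K x -> exists2 h, H h & \forall z \near x, k z < h z) ->
  exists2 h, H h & forall x, K x -> k x < h x.
Proof.
move=> cK H0 Hadd Hge0 loc.
pose F : set_system (G -> R) := [set P | exists2 h0, H h0 &
  forall h, (forall x, h0 x <= h x) -> P h].
have FF : Filter F.
  split.
  - by exists (cst 0).
  - move=> P Q [h1 H1 P1] [h2 H2 P2]; exists (fun x => h1 x + h2 x); first exact: Hadd.
    move=> h hle; split; [apply: P1|apply: P2] => x; apply: le_trans (hle x).
      by rewrite lerDl; exact: Hge0.
    by rewrite lerDr; exact: Hge0.
  - by move=> P Q PQ [h0 Hh0 P0]; exists h0 => // h /P0; exact: PQ.
have := (compact_near_coveringP K).1 cK _ F (fun h x => k x < h x) FF.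
case=> [x Kx|h0 Hh0 h0K].
  have [h Hh hx] := loc x Kx.
  exists ([set z | k z < h z], [set h' | forall z, h z <= h' z]).
    by split => //; exists h.
  by move=> [z h'] [/= h1 h2]; exact: lt_le_trans (h2 z).
by exists h0 => //; exact: h0K.
Qed.

Lemma compact_dominated K : compact K ->
  exists g, [/\ CcR g, forall x, 0 <= g x & forall x, K x -> 1 < g x].
Proof.
move=> cK.
have [] := @compact_domination [set h | CcR h /\ forall x, 0 <= h x] (cst 1) K cK.
- split=> //; apply: (@CcRP _ set0) => //; [by move=> x; exact: cvg_cst|exact: compact0].
- move=> g h [cg g0] [ch h0]; split; first exact: CcR_add.
  by move=> x; exact: addr_ge0.
- by move=> h x [].
- move=> x _; have [g [cg g0 gx _]] := bump (@filterT _ (nbhs x) _).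
  exists (fun z => 2 * g z).
    by split; [exact: CcR_scale|move=> z; rewrite mulr_ge0].
  have cx := CcR_continuous (CcR_scale 2 cg).
  have /cvgrPdist_lt/(_ _ (@ltr01 R)) := cx x.
  apply: filterS => z; rewrite gx /= ltr_norml => /andP[]; lra.
by move=> g [cg g0] gK; exists g.
Qed.

End compactly_supported_functions.

(** * Haar integral and lower bound for the dual norm *)

Section haar_integral.
Variables (R : realType) (G : topologicalGroupType).
Hypothesis hG : hausdorff_space G.
Hypothesis lcG : locally_compact [set: G].
Local Notation C := (Cplx R).
Local Notation T := (G -> C).
Variable I : T -> C.
Hypothesis HI : left_haar_integral I.
Implicit Types (f : T) (g h k : G -> R) (x y z : G).

Lemma Cc0 : Cc R G 0.
Proof.
split; first by move=> x; exact: cvg_cst.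
by apply: (compactly_supportedP hG compact0).
Qed.

Lemma haar0 : I 0 = 0.
Proof.
have := haar_linear HI (-1) Cc0 Cc0.
by rewrite scaler0 addr0 mulN1r addNr.
Qed.

Lemma haarZ (c : C) f : Cc R G f -> I (c *: f) = c * I f.
Proof. by move=> cf; have := haar_linear HI c cf Cc0; rewrite addr0 haar0 addr0. Qed.

Lemma haarD f f' : Cc R G f -> Cc R G f' -> I (f + f') = I f + I f'.
Proof. by move=> cf cf'; have := haar_linear HI 1 cf cf'; rewrite scale1r mul1r. Qed.

Lemma haarB f f' : Cc R G f -> Cc R G f' -> I (f - f') = I f - I f'.
Proof.
move=> cf cf'; rewrite -scaleN1r haarD ?haarZ ?mulN1r//; exact: (Cc_scale hG).
Qed.

Lemma haar_sum (J : Type) (s : seq J) (F : J -> T) : (forall j, Cc R G (F j)) ->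
  I (\sum_(j <- s) F j) = \sum_(j <- s) I (F j).
Proof.
move=> cF; suff [] : Cc R G (\sum_(j <- s) F j) /\
  I (\sum_(j <- s) F j) = \sum_(j <- s) I (F j) by [].
elim: s => [|j s [h1 h2]]; first by rewrite !big_nil haar0; split => //; exact: Cc0.
by rewrite !big_cons haarD// h2; split => //; exact: (Cc_add hG).
Qed.

Definition haar_real g : R := complex.Re (I (fun x => rc (g x))).

Lemma haar_realE g : CcR g -> I (fun x => rc (g x)) = rc (haar_real g).
Proof.
move=> cg; suff im0 : complex.Im (I (fun x => rc (g x))) = 0 by exact: cplx_eqP.
have ca := CcR_abs hG cg; have cs := CcR_add hG ca cg.
have /ge0_rc[e1 _] : 0 <= I (fun x => rc `|g x|).
  by apply: (haar_pos HI) => // x; rewrite rc_ge0.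
have /ge0_rc[e2 _] : 0 <= I (fun x => rc (`|g x| + g x)).
  apply: (haar_pos HI) => // x; rewrite rc_ge0.
  by have := ler_norm (- g x); rewrite normrN; lra.
have e3 : I (fun x => rc (`|g x| + g x)) = I (fun x => rc `|g x|) + I (fun x => rc (g x)).
  rewrite -haarD//; congr I; apply/funext => x; exact: rcD.
have := congr1 (@complex.Im R) e3; rewrite ImD e1 e2 !Im_rc.
by rewrite add0r => <-.
Qed.

Lemma haar_real_ge0 g : CcR g -> (forall x, 0 <= g x) -> 0 <= haar_real g.
Proof.
move=> cg g0; have := haar_pos HI cg.
by rewrite haar_realE// rc_ge0; apply => x; rewrite rc_ge0.
Qed.

Lemma haar_realD g h : CcR g -> CcR h ->
  haar_real (fun x => g x + h x) = haar_real g + haar_real h.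
Proof.
move=> cg ch; rewrite /haar_real -ReD -haarD//; congr (complex.Re (I _)).
by apply/funext => x; exact: rcD.
Qed.

Lemma haar_realZ (a : R) g : CcR g -> haar_real (fun x => a * g x) = a * haar_real g.
Proof.
move=> cg; apply: (@rcI R); rewrite rcM -!haar_realE//; last exact: (CcR_scale hG).
by rewrite -haarZ//; congr I; apply/funext => x; exact: rcM.
Qed.

Lemma haar_real_le g h : CcR g -> CcR h -> (forall x, g x <= h x) ->
  haar_real g <= haar_real h.
Proof.
move=> cg ch le; have cd := CcR_sub hG ch cg.
rewrite -subr_ge0.
have : haar_real (fun x => h x - g x) = haar_real h - haar_real g.
  rewrite -mulN1r -haar_realZ// -haar_realD//; last exact: (CcR_scale hG).
  by congr haar_real; apply/funext => x; rewrite mulN1r.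
by move=> <-; apply: haar_real_ge0 => // x; rewrite subr_ge0.
Qed.

Lemma haar_real_translate g y : CcR g ->
  haar_real (fun x => g (y * x)%g) = haar_real g.
Proof. by move=> cg; rewrite /haar_real -(haar_invariant HI y cg). Qed.

Lemma haar_Re f : Cc R G f -> complex.Re (I f) = haar_real (fun x => complex.Re (f x)).
Proof.
move=> cf; have cr := CcR_Re hG cf; have ci := CcR_Im hG cf.
have -> : f = (fun x => rc (complex.Re (f x))) + ii *: (fun x => rc (complex.Im (f x))).
  by apply/funext => x; exact: cplxE.
rewrite haarD//; last exact: (Cc_scale hG).
rewrite haarZ// !haar_realE// ReD Re_rc.
rewrite (_ : complex.Re (ii * rc _) = 0) ?addr0; last by rewrite /=; ring.
congr haar_real; apply/funext => x; rewrite fctE ReD Re_rc.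
rewrite (_ : complex.Re (ii *: rc _) = 0) ?addr0//.
by have -> (z w : C) : z *: w = z * w by []; rewrite /=; ring.
Qed.

(** Rotate f so that its integral becomes real. *)
Lemma modulus_haar_le f : Cc R G f -> modulus (I f) <= haar_real (fun x => modulus (f x)).
Proof.
move=> cf; have [I0|I0] := eqVneq (I f) 0.
  rewrite I0 modulus0; apply: haar_real_ge0; first exact: (CcR_modulus hG).
  by move=> x; exact: modulus_ge0.
have m0 : modulus (I f) != 0 by rewrite modulus_eq0.
pose c : C := Num.conj (I f) / rc (modulus (I f)).
have c1 : modulus c = 1.
  rewrite modulusM modulus_conj modulusV modulus_ge0_rc ?modulus_ge0//.
  by rewrite divff.
have cI : I (c *: f) = rc (modulus (I f)).
  rewrite haarZ// /c mulrAC [_ * I f]mulrC mulC_conj expr2 rcM mulfK//.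
  by rewrite -[0]/(rc 0) (inj_eq (@rcI R)).
have ccf := Cc_scale hG c cf.
have := haar_Re ccf; rewrite cI Re_rc => ->.
apply: haar_real_le; [exact: (CcR_Re hG)|exact: (CcR_modulus hG)|].
move=> x; apply: (le_trans (ler_norm _)); apply: (le_trans (Re_le_modulus _)).
by rewrite [leLHS](modulusM c (f x)) c1 mul1r.
Qed.

(** A function with nonzero integral is dominated by a sum of multiples of
    translates of g, whose integral is a multiple of that of g. *)
Lemma haar_real_gt0 g x0 : CcR g -> (forall x, 0 <= g x) -> 0 < g x0 ->
  0 < haar_real g.
Proof.
move=> cg g0 gx0; have [f0 cf0 If0] := haar_neq0 HI.
pose k x := modulus (f0 x); have ck : CcR k by exact: (CcR_modulus hG).
have k0 : 0 < haar_real k.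
  by apply: lt_le_trans (modulus_haar_le cf0); rewrite modulus_gt0.
have [K cK kK] := CcR_support ck.
pose H := [set h | [/\ CcR h, forall x, 0 <= h x &
  exists a, haar_real h = a * haar_real g]].
have [] := @compact_domination R G H k K cK.
- split=> //; first exact: Cc0.
  by exists 0; rewrite mul0r /haar_real haar0.
- move=> h1 h2 [c1 p1 [a1 e1]] [c2 p2 [a2 e2]]; split.
  + exact: (CcR_add hG).
  + by move=> x; exact: addr_ge0.
  + by exists (a1 + a2); rewrite haar_realD// e1 e2 mulrDl.
- by move=> h x [].
- move=> x _; pose a := (k x + 1) / g x0.
  have a0 : 0 <= a by rewrite divr_ge0 ?addr_ge0 ?modulus_ge0// ltW.
  pose h z := a * g (x0 * x^-1 * z)%g.
  have ch : CcR h by apply: (CcR_scale hG); exact: (CcR_translate hG).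
  exists h.
    split => //; first by move=> z; exact: mulr_ge0.
    exists a; rewrite haar_realZ; last exact: (CcR_translate hG).
    by rewrite haar_real_translate.
  have cd : {for x, continuous (fun z => h z - k z)}.
    have /(_ x) c1 := CcR_continuous ch; have /(_ x) c2 := CcR_continuous ck.
    exact: cvgB.
  have /cvgrPdist_lt/(_ _ ltr01) := cd.
  apply: filterS => z.
  have -> : h x = k x + 1 by rewrite /h -mulgA mulVg mulg1 divfK// gt_eqF.
  rewrite ltr_norml => /andP[_]; lra.
move=> h [ch h0 [a ha]] hK.
have kh : haar_real k <= a * haar_real g.
  rewrite -ha; apply: haar_real_le => // x.
  have [Kx|nKx] := pselect (K x); first by rewrite ltW// hK.
  by rewrite kK.
have := haar_real_ge0 cg g0; rewrite le_eqVlt => /predU1P[e|//].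
by move: kh; rewrite -e mulr0 leNgt k0.
Qed.

End haar_integral.

Section hilbert_cauchy_schwarz.
Variables (R : realType).
Local Notation C := (Cplx R).
Variables (H : completeNormedModType C) (ip : {dot H for @Num.conj C}).
Hypothesis hip : hilbert_product ip.

Definition hnorm (xi : H) : R := complex.Re `|xi|.

Lemma hnormE (xi : H) : `|xi| = rc (hnorm xi).
Proof. by have /ge0_rc[] := normr_ge0 xi. Qed.

Lemma hnorm_ge0 (xi : H) : 0 <= hnorm xi.
Proof. by have /ge0_rc[] := normr_ge0 xi. Qed.

Lemma hilbert_cauchy_schwarz (xi eta : H) : modulus (ip xi eta) <= hnorm xi * hnorm eta.
Proof.
rewrite -ler_sqr ?nnegrE ?modulus_ge0 ?mulr_ge0 ?hnorm_ge0// exprMn.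
apply: quadratic_discriminant; rewrite ?exprn_ge0 ?hnorm_ge0// => t.
have := dnorm_ge0 ip (xi + t *: eta).
rewrite dnormD dnormZ normC_modulus -!hip !hnormE -!rcX.
rewrite linearZr_LR /= => /ge0_rc[_]; congr (_ <= complex.Re _).
rewrite mulC_conj (rmorphM (@Num.conj C)) /= conjCK.
ring.
Qed.

End hilbert_cauchy_schwarz.

Section fs_norm_lower_bound.
Variables (R : realType) (G : topologicalGroupType).
Hypothesis hG : hausdorff_space G.
Hypothesis lcG : locally_compact [set: G].
Local Notation C := (Cplx R).
Local Notation T := (G -> C).
Variable I : T -> C.
Hypothesis HI : left_haar_integral I.

(** Coefficients of unitary representations at vectors of norm at most 1 are
    bounded by 1. *)
Lemma cstar_norm_le_integral (g : G -> R) : CcR g -> (forall x, 0 <= g x) ->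
  (cstar_norm I (fun x => rc (g x)) <= (haar_real I g)%:E)%E.
Proof.
move=> cg g0; apply: ge_ereal_sup => _ [H [ip [pi [hip [p1 pM pU pC] ->]]]].
apply: ge_ereal_sup => _ [xi [eta [xi1 eta1 ->]]]; rewrite lee_fin.
pose w x := ip (pi x xi) eta.
have xi1' : hnorm xi <= 1.
  by move: xi1; rewrite hnormE -subr_ge0 -[1]/(rc 1) -rcB rc_ge0 subr_ge0.
have eta1' : hnorm eta <= 1.
  by move: eta1; rewrite hnormE -subr_ge0 -[1]/(rc 1) -rcB rc_ge0 subr_ge0.
have pin x : hnorm (pi x xi) = hnorm xi.
  apply/eqP; rewrite -(@eqrXn2 _ 2) ?hnorm_ge0//; apply/eqP/(@rcI R).
  by rewrite !rcX -!hnormE !hip pU.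
have w1 x : modulus (w x) <= 1.
  rewrite (le_trans (hilbert_cauchy_schwarz hip _ _))// pin.
  by rewrite mulr_ile1 ?hnorm_ge0.
have cw : continuous w.
  apply/continuousC_P => x e e0.
  have e0' : (0 : C) < rc e by rewrite lt_def rc_ge0 ltW// andbT (inj_eq (@rcI R)) gt_eqF.
  have /cvgrPdist_lt/(_ _ e0') := pC xi x.
  apply: filterS => y hy.
  have -> : w y - w x = ip (pi y xi - pi x xi) eta by rewrite /w linearBl.
  apply: (le_lt_trans (hilbert_cauchy_schwarz hip _ _)).
  have hy' : hnorm (pi y xi - pi x xi) < e.
    by move: hy; rewrite distrC hnormE -subr_gt0 -rcB lt_def rc_ge0 -[0]/(rc 0)
      (inj_eq (@rcI R)) -lt_def subr_gt0.
  by apply: le_lt_trans hy'; rewrite ler_piMr ?hnorm_ge0.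
have cgw := Cc_mul hG cg cw.
apply: (le_trans (modulus_haar_le hG HI cgw)).
apply: (haar_real_le hG HI); [exact: (CcR_modulus hG)|by []|] => x.
rewrite [leLHS](modulusM (rc (g x)) (w x)) modulus_ge0_rc//.
by rewrite ler_piMr.
Qed.

(** Test u against a bump at x of integral 1, whose norm in C*(G) is at most 1. *)
Lemma sup_le_fs_norm (u : T) x : continuous u ->
  ((modulus (u x))%:E <= fs_norm I u)%E.
Proof.
move=> cu; apply/lee_addgt0Pr => e e0.
have /continuousC_P/(_ x e e0) Ux := cu.
have [g [cg g0 gx gU]] := bump R hG lcG Ux.
have Ig : 0 < haar_real I g.
  by apply: (haar_real_gt0 hG HI (x0 := x)) => //; rewrite gx.
pose h z := (haar_real I g)^-1 * g z.
have ch : CcR h by exact: (CcR_scale hG).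
have h0 z : 0 <= h z by rewrite mulr_ge0// invr_ge0 ltW.
have Ih : haar_real I h = 1.
  by rewrite /h haar_realZ// mulVf// gt_eqF.
have chu := Cc_mul hG ch cu.
have close : modulus (u x) <= modulus (I ((fun z => rc (h z)) * u)) + e.
  have cxh : Cc R G (u x *: (fun z => rc (h z))) by exact: (Cc_scale hG).
  have ux : u x = I (u x *: (fun z => rc (h z))).
    by rewrite (haarZ hG HI)// haar_realE// Ih mulr1.
  have -> : u x = I ((fun z => rc (h z)) * u) -
      I ((fun z => rc (h z)) * u - u x *: (fun z => rc (h z))).
    by rewrite (haarB hG HI)// -ux opprB addrC subrK.
  apply: (le_trans (modulusB _ _)); rewrite lerD2l.
  set F : T := _ - _.
  have cF : Cc R G F.
    by have := Cc_add hG chu (Cc_scale hG (-1) cxh); rewrite scaleN1r.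
  apply: (le_trans (modulus_haar_le hG HI cF)).
  have -> : e = haar_real I (fun z => e * h z) by rewrite haar_realZ// Ih mulr1.
  apply: (haar_real_le hG HI); [exact: (CcR_modulus hG)|exact: (CcR_scale hG)|] => z.
  have -> : F z = rc (h z) * (u z - u x).
    by rewrite /F !fctE; have -> (a b : C) : a *: b = a * b by []; ring.
  rewrite modulusM modulus_ge0_rc// mulrC.
  have [Uz|nUz] := pselect (modulus (u z - u x) < e); first by rewrite ler_wpM2r// ltW.
  by rewrite /h (gU z nUz) !mulr0.
apply: (@le_trans _ _ ((modulus (I ((fun z => rc (h z)) * u)))%:E + e%:E)%E).
  by rewrite -EFinD lee_fin.
apply: leeD => //; apply: ereal_sup_ubound.
exists (fun z => rc (h z)) => //; split=> //.
by apply: (le_trans (cstar_norm_le_integral ch h0)); rewrite Ih.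
Qed.

End fs_norm_lower_bound.

(** * Autocorrelations *)

Section autocorrelation.
Variables (R : realType) (G : topologicalGroupType).
Hypothesis hG : hausdorff_space G.
Hypothesis lcG : locally_compact [set: G].
Local Notation C := (Cplx R).
Local Notation T := (G -> C).
Variable I : T -> C.
Hypothesis HI : left_haar_integral I.
Variable h : G -> R.
Hypothesis ch : CcR h.
Hypothesis h0 : forall x, 0 <= h x.
Implicit Types x y z : G.

Definition shift x : G -> R := fun y => h (x^-1 * y)%g.

Let cshift x : CcR (shift x). Proof. exact: (CcR_translate hG). Qed.

Let cprod x y : CcR (fun z => shift x z * shift y z).
Proof. by apply: (CcR_mul hG) => //; apply: CcR_continuous. Qed.

(** The coefficient x |-> <lambda(x) h, h> of the left regular representation. *)
Definition autocorrelation x : R := haar_real I (fun y => h y * shift x y).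

Let shift1 : shift 1%g = h.
Proof. by apply/funext => y; rewrite /shift invg1 mul1g. Qed.

Let cprod1 x : CcR (fun y => h y * shift x y).
Proof. by have := cprod 1%g x; rewrite shift1. Qed.

Lemma autocorrelation_ge0 x : 0 <= autocorrelation x.
Proof. by apply: (haar_real_ge0 hG HI) => // y; apply: mulr_ge0 => //; exact: h0. Qed.

Lemma autocorrelation_gt0 x : 0 < h x -> 0 < h 1%g -> 0 < autocorrelation x.
Proof.
move=> hx h1; apply: (haar_real_gt0 hG HI (x0 := x)) => //.
  by move=> y; apply: mulr_ge0 => //; exact: h0.
by rewrite /shift mulVg mulr_gt0.
Qed.

Lemma autocorrelation_pd : positive_definite (fun x => rc (autocorrelation x) : C).
Proof.
move=> n x c.
have eq_shift i j : rc (autocorrelation ((x i)^-1 * x j)%g) =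
    I (fun z => rc (shift (x i) z * shift (x j) z)).
  rewrite (haar_realE hG HI (cprod _ _)); congr rc.
  rewrite /autocorrelation -(haar_real_translate HI (x i)^-1%g (cprod1 _)).
  congr haar_real; apply/funext => z; rewrite /shift; congr (_ * h _).
  by rewrite invgM invgK mulgA -(mulgA _ (x i)) mulgV mulg1.
pose F : T := \sum_(i < n) \sum_(j < n)
  (Num.conj (c i) * c j) *: (fun z => rc (shift (x i) z * shift (x j) z)).
have cF i j : Cc R G ((Num.conj (c i) * c j) *:
   (fun z => rc (shift (x i) z * shift (x j) z))) by exact: (Cc_scale hG (Num.conj (c i) * c j) (cprod (x i) (x j))).
have csum i : Cc R G (\sum_(j < n) (Num.conj (c i) * c j) *:
   (fun z => rc (shift (x i) z * shift (x j) z))).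
  by elim/big_ind : _ => //; [exact: (Cc0 R hG)|exact: (Cc_add hG)].
have -> : \sum_(i < n) \sum_(j < n) Num.conj (c i) * c j *
    rc (autocorrelation ((x i)^-1 * x j)%g) = I F.
  rewrite /F (haar_sum hG HI)//; apply: eq_bigr => i _.
  rewrite (haar_sum hG HI)//; apply: eq_bigr => j _.
  by rewrite (haarZ hG HI _ (cprod (x i) (x j))); congr (_ * _); exact: eq_shift.
apply: (haar_pos HI).
  by rewrite /F; elim/big_ind : _ => //; [exact: (Cc0 R hG)|exact: (Cc_add hG)].
move=> z; have -> : F z = Num.conj (\sum_(i < n) c i * rc (shift (x i) z)) *
    \sum_(i < n) c i * rc (shift (x i) z).
  rewrite /F fct_sumE rmorph_sum mulr_suml; apply: eq_bigr => i _.
  rewrite fct_sumE mulr_sumr; apply: eq_bigr => j _.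
  rewrite (rmorphM (@Num.conj C)) /= conj_rc.
  have -> : ((Num.conj (c i) * c j) *: (fun z => rc (shift (x i) z * shift (x j) z))) z =
    Num.conj (c i) * c j * rc (shift (x i) z * shift (x j) z) by [].
  by rewrite rcM; ring.
by rewrite mulrC mul_conjC_ge0.
Qed.

Lemma autocorrelation_continuous : continuous autocorrelation.
Proof.
move=> x0; apply/cvgrPdist_le => e e0.
have [K cK hK] := CcR_support ch.
have Ih := haar_real_ge0 hG HI ch h0.
pose d := e / (haar_real I h + 1).
have d0 : 0 < d by rewrite divr_gt0// ltr_wpDl.
have unif : \forall x \near x0, K `<=` (fun y => `|shift x0 y - shift x y| < d).
  apply: ((compact_near_coveringP K).1 cK _ (nbhs x0)
    (fun x y => `|shift x0 y - shift x y| < d) _) => y _.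
  have cs : (fun p : G * G => h (p.2^-1 * p.1)%g) p @[p --> (y, x0)] --> shift x0 y.
    have c1 : (fun p : G * G => (p.2^-1, p.1)%g) p @[p --> (y, x0)] --> (x0^-1%g, y).
      apply: cvg_pair; last exact: cvg_fst.
      by apply: (cvg_comp _ _ cvg_snd); exact: (@invg_continuous G).
    have c2 := cvg_comp _ _ c1 (@mulg_continuous G (x0^-1%g, y)).
    have /(_ (x0^-1 * y)%g) c3 := CcR_continuous ch.
    exact: (cvg_comp _ _ c2 c3).
  have cs0 : (fun p : G * G => shift x0 p.1) p @[p --> (y, x0)] --> shift x0 y.
    have /(_ y) c3 := CcR_continuous (cshift x0).
    have c1 : (fun p : G * G => p.1) p @[p --> (y, x0)] --> y by exact: cvg_fst.
    exact: (cvg_comp _ _ c1 c3).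
  have : (fun p : G * G => shift x0 p.1 - h (p.2^-1 * p.1)%g) p @[p --> (y, x0)]
    --> shift x0 y - shift x0 y by apply: cvgB.
  rewrite subrr => /cvgrPdist_lt/(_ _ d0).
  by apply: filterS => -[y' x] /=; rewrite sub0r normrN.
apply: filterS unif => x hx.
have c1 := cprod1 x0; have c2 := cprod1 x.
have -> : autocorrelation x0 - autocorrelation x =
   haar_real I (fun y => h y * (shift x0 y - shift x y)).
  rewrite /autocorrelation -mulN1r -(haar_realZ hG HI)//.
  rewrite -(haar_realD HI)//; last exact: (CcR_scale hG).
  by congr haar_real; apply/funext => y; ring.
have cd : CcR (fun y => h y * (shift x0 y - shift x y)).
  by apply: (CcR_mul hG) => //; apply: CcR_continuous; exact: (CcR_sub hG).
have := modulus_haar_le hG HI cd; rewrite (haar_realE hG HI cd) modulus_rc.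
move=> /le_trans; apply; apply: (@le_trans _ _ (haar_real I (fun y => d * h y))).
  apply: (haar_real_le hG HI); [exact: (CcR_modulus hG)|exact: (CcR_scale hG)|].
  move=> y; rewrite modulus_rc normrM (ger0_norm (h0 y)) mulrC.
  have [Ky|nKy] := pselect (K y); last by rewrite hK// !mulr0.
  by rewrite ler_wpM2r// ltW// hx.
rewrite (haar_realZ hG HI)//.
have : d * (haar_real I h + 1) = e by rewrite divfK// gt_eqF// ltr_wpDl.
lra.
Qed.

Lemma autocorrelation_cs : compactly_supported (fun x => rc (autocorrelation x) : C).
Proof.
have [K cK hK] := CcR_support ch.
apply: (@compactly_supportedP R G hG _ ((fun p : G * G => (p.1 * p.2^-1)%g) @` (K `*` K))).
  apply: continuous_compact; last exact: compact_setX.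
  apply: continuous_subspaceT => -[a b].
  have c1 : (fun p : G * G => (p.1, p.2^-1)%g) p @[p --> (a, b)] --> (a, b^-1%g).
    apply: cvg_pair; first exact: cvg_fst.
    by apply: (cvg_comp _ _ cvg_snd); exact: (@invg_continuous G).
  exact: (cvg_comp _ _ c1 (@mulg_continuous G (a, b^-1%g))).
move=> x nKx; rewrite /autocorrelation (_ : (fun y => _) = fun=> 0).
  by rewrite /haar_real (haar0 hG HI).
apply/funext => y; have [Ky|nKy] := pselect (K y); last by rewrite hK// mul0r.
have [Kxy|nKxy] := pselect (K (x^-1 * y)%g); last by rewrite /shift (hK _ nKxy) mulr0.
exfalso; apply: nKx; exists (y, (x^-1 * y)%g) => //=.
by rewrite invgM invgK mulgA mulgV mul1g.
Qed.

End autocorrelation.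

(** Elements of A(G) that are positive on a given compact set: the autocorrelation
    of a function that is positive on K and at 1. *)
Lemma exists_cpd_positive (R : realType) (G : topologicalGroupType)
    (I : (G -> Cplx R) -> Cplx R) (K : set G) :
  hausdorff_space G -> locally_compact [set: G] -> left_haar_integral I ->
  compact K -> exists v : G -> R, [/\ cpd (fun x => rc (v x) : Cplx R),
    compactly_supported (fun x => rc (v x) : Cplx R),
    forall x, 0 <= v x & forall x, K x -> 0 < v x].
Proof.
move=> hG lcG HI cK.
have cK1 : compact (K `|` [set 1%g]) by apply: compactU => //; exact: compact_set1.
have [h [ch h0 hK]] := compact_dominated R hG lcG cK1.
exists (autocorrelation I h); split.
- split; last exact: autocorrelation_pd.
  by apply: continuousC_rc; exact: autocorrelation_continuous.
- exact: autocorrelation_cs.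
- exact: autocorrelation_ge0.
- move=> x Kx; apply: autocorrelation_gt0 => //; apply: lt_trans (hK _ _) => //.
    by left.
  by right.
Qed.

(** * The form of a positive definite function *)

Section cauchy_sequences.
Variable R : realType.
Local Notation C := (Cplx R).

(** Cauchy sequences for a distance between terms that is not derived from a
    metric on a type. *)
Definition small_distance (d : nat -> nat -> R) := forall e : R, 0 < e ->
  exists n0, forall n m, (n0 <= n)%N -> (n0 <= m)%N -> d n m <= e.

Lemma real_cauchy_cvg (x : R^nat) :
  small_distance (fun n m => `|x n - x m|) -> cvgn x.
Proof.
move=> h; apply/cauchy_cvgP; apply: cauchy_exP => e e0.
have e2 : 0 < e / 2 by rewrite divr_gt0.
have [n0 hn] := h _ e2; exists (x n0); exists n0 => // n /= n0n.
apply: (@le_lt_trans _ _ (e / 2)); last lra.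
exact: hn.
Qed.

Lemma complex_cauchy_cvg (z : nat -> C) :
  small_distance (fun n m => modulus (z n - z m)) -> exists l : C, z n @[n --> \oo] --> l.
Proof.
move=> h.
have cr : cvgn (fun n => complex.Re (z n) : R).
  apply: real_cauchy_cvg => e /h[n0 hn]; exists n0 => n m h1 h2.
  by rewrite -ReN -ReD (le_trans (Re_le_modulus _))// hn.
have ci : cvgn (fun n => complex.Im (z n) : R).
  apply: real_cauchy_cvg => e /h[n0 hn]; exists n0 => n m h1 h2.
  by rewrite -ImN -ImD (le_trans (Im_le_modulus _))// hn.
set a := limn _ in cr; set b := limn _ in ci.
exists (rc a + ii * rc b); apply/cvgC_modulusP => e e0.
have e2 : 0 < e / 2 by rewrite divr_gt0.
have /cvgrPdist_lt/(_ _ e2) hr := cr; have /cvgrPdist_lt/(_ _ e2) hi := ci.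
near=> n.
have h1 : `|a - complex.Re (z n)| < e / 2 by near: n.
have h2 : `|b - complex.Im (z n)| < e / 2 by near: n.
have -> : z n - (rc a + ii * rc b) = rc (complex.Re (z n) - a) + ii * rc (complex.Im (z n) - b).
  by rewrite {1}[z n]cplxE !rcB; ring.
rewrite (le_lt_trans (modulusD _ _))// modulusM modulus_ii mul1r !modulus_rc.
rewrite distrC in h1; rewrite distrC in h2; lra.
Unshelve. all: by end_near. Qed.

Lemma cvgC_0P (z : nat -> C) (l : C) :
  z n @[n --> \oo] --> l <-> modulus (z n - l) @[n --> \oo] --> (0 : R).
Proof.
split=> [/cvgC_modulusP h|/cvgrPdist_lt h].
  apply/cvgrPdist_lt => e /h; apply: filterS => n.
  by rewrite sub0r normrN ger0_norm ?modulus_ge0.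
apply/cvgC_modulusP => e /h; apply: filterS => n.
by rewrite sub0r normrN ger0_norm ?modulus_ge0.
Qed.

Lemma cvgC_unique (z : nat -> C) (l l' : C) :
  z n @[n --> \oo] --> l -> z n @[n --> \oo] --> l' -> l = l'.
Proof. by move=> h h'; apply: (cvg_unique _ h h'); exact: hausdorffC. Qed.

End cauchy_sequences.

Section kernel_form_theory.
Variables (R : realType) (G : topologicalGroupType).
Local Notation C := (Cplx R).
Local Notation T := (G -> C).
Variable phi : T.
Hypothesis hphi : positive_definite phi.
Local Notation V := (seq (C * G)).
Local Notation B := (kernel_form phi).
Implicit Types (s t : V) (x y : G) (c : C).

Definition vscale c s : V := [seq (c * p.1, p.2) | p <- s].
Definition vsub s t : V := s ++ vscale (-1) t.
Definition vtrans x s : V := [seq (p.1, (x * p.2)%g) | p <- s].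
Definition vpoint y : V := [:: (1, y)].

Lemma formDl s s' t : B (s ++ s') t = B s t + B s' t.
Proof. by rewrite /kernel_form big_cat. Qed.

Lemma formDr s t t' : B s (t ++ t') = B s t + B s t'.
Proof.
rewrite /kernel_form -big_split; apply: eq_bigr => p _.
by rewrite big_cat.
Qed.

Lemma formZl c s t : B (vscale c s) t = c * B s t.
Proof.
rewrite /kernel_form big_map mulr_sumr; apply: eq_bigr => p _.
by rewrite mulr_sumr; apply: eq_bigr => q _ /=; rewrite !mulrA.
Qed.

Lemma formZr c s t : B s (vscale c t) = Num.conj c * B s t.
Proof.
rewrite /kernel_form mulr_sumr; apply: eq_bigr => p _.
rewrite big_map mulr_sumr; apply: eq_bigr => q _ /=.
by rewrite (rmorphM (@Num.conj C)) /=; ring.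
Qed.

Lemma form_herm s t : B s t = Num.conj (B t s).
Proof.
rewrite /kernel_form rmorph_sum exchange_big /=; apply: eq_bigr => p _.
rewrite rmorph_sum; apply: eq_bigr => q _ /=.
rewrite !(rmorphM (@Num.conj C)) /= conjCK -pd_inv// invgM invgK.
by rewrite [_ * q.1]mulrC.
Qed.

Lemma form_trans x s t : B (vtrans x s) (vtrans x t) = B s t.
Proof.
rewrite /kernel_form big_map; apply: eq_bigr => p _; rewrite big_map.
apply: eq_bigr => q _ /=; congr (_ * phi _).
by rewrite invgM mulgA -(mulgA _ x^-1%g) mulVg mulg1.
Qed.

Definition vnorm s : R := Num.sqrt (complex.Re (B s s)).

Lemma vnorm_ge0 s : 0 <= vnorm s. Proof. exact: sqrtr_ge0. Qed.

Lemma formE s : B s s = rc (vnorm s ^+ 2).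
Proof.
by have /ge0_rc[e h] := kernel_form_ge0 s hphi; rewrite /vnorm sqr_sqrtr.
Qed.

Lemma form_CS s t : modulus (B s t) <= vnorm s * vnorm t.
Proof.
rewrite -ler_sqr ?nnegrE ?modulus_ge0 ?mulr_ge0 ?vnorm_ge0// exprMn.
apply: quadratic_discriminant; rewrite ?exprn_ge0 ?vnorm_ge0// => r.
have /ge0_rc[_] := kernel_form_ge0 (s ++ vscale r t) hphi.
rewrite formDl !formDr !formZl !formZr -!formE; congr (_ <= complex.Re _).
rewrite (form_herm t s); ring.
Qed.

Lemma vnormZ c s : vnorm (vscale c s) = modulus c * vnorm s.
Proof.
apply/eqP; rewrite -(@eqrXn2 _ 2) ?vnorm_ge0 ?mulr_ge0 ?modulus_ge0 ?vnorm_ge0//.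
apply/eqP/(@rcI R); rewrite -formE formZl formZr exprMn rcM -mulC_conj -formE.
by rewrite mulrA.
Qed.

Lemma vnormD s t : vnorm (s ++ t) <= vnorm s + vnorm t.
Proof.
have vs := vnorm_ge0 s; have vt := vnorm_ge0 t.
rewrite -ler_sqr ?nnegrE ?vnorm_ge0 ?addr_ge0//.
have : rc (vnorm (s ++ t) ^+ 2) = rc (vnorm s ^+ 2) + rc (vnorm t ^+ 2) +
    rc (2 * complex.Re (B s t)).
  by rewrite -!formE formDl !formDr (form_herm t s) -addC_conj; ring.
rewrite -!rcD => /(@rcI R) ->.
have := Re_le_modulus (B s t); have := ler_norm (complex.Re (B s t)).
have := form_CS s t; nra.
Qed.

Lemma formBl s s' t : B (vsub s s') t = B s t - B s' t.
Proof. by rewrite formDl formZl mulN1r. Qed.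

Lemma formBr s t t' : B s (vsub t t') = B s t - B s t'.
Proof. by rewrite formDr formZr (rmorphN (@Num.conj C)) /= conjC1 mulN1r. Qed.

(** Norms depend only on the vector that a formal combination represents, and this
    vector is determined by its products with all the others. *)
Lemma vnorm_ext s s' : (forall t, B s t = B s' t) -> vnorm s = vnorm s'.
Proof. by move=> h; rewrite /vnorm h form_herm h -form_herm. Qed.

Lemma vnorm_le_sub s t : vnorm s <= vnorm t + vnorm (vsub s t).
Proof.
have -> : vnorm s = vnorm (t ++ vsub s t).
  by apply: vnorm_ext => w; rewrite formDl formBl; ring.
exact: vnormD.
Qed.

Lemma vnorm_trans x s : vnorm (vtrans x s) = vnorm s.
Proof. by rewrite /vnorm form_trans. Qed.

Definition vcauchy (s : nat -> V) := small_distance (fun n m => vnorm (vsub (s n) (s m))).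

Lemma vcauchy_bounded (s : nat -> V) : vcauchy s ->
  exists2 M, 0 < M & exists n0, forall n, (n0 <= n)%N -> vnorm (s n) <= M.
Proof.
move=> /(_ 1 ltr01)[n0 h]; exists (vnorm (s n0) + 1).
  by rewrite ltr_wpDl ?vnorm_ge0.
exists n0 => n n0n; apply: (le_trans (vnorm_le_sub _ (s n0))).
by rewrite lerD2l h.
Qed.

Lemma vcauchyD (s t : nat -> V) : vcauchy s -> vcauchy t -> vcauchy (fun n => s n ++ t n).
Proof.
move=> hs ht e e0; have e2 : 0 < e / 2 by rewrite divr_gt0.
have [n1 h1] := hs _ e2; have [n2 h2] := ht _ e2; exists (maxn n1 n2) => n m.
rewrite !geq_max => /andP[a1 a2] /andP[b1 b2].
have -> : vnorm (vsub (s n ++ t n) (s m ++ t m)) =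
    vnorm (vsub (s n) (s m) ++ vsub (t n) (t m)).
  by apply: vnorm_ext => w; rewrite /vsub !(formDl, formZl); ring.
apply: (le_trans (vnormD _ _)); have := h1 _ _ a1 b1; have := h2 _ _ a2 b2; lra.
Qed.

Lemma vcauchyZ c (s : nat -> V) : vcauchy s -> vcauchy (fun n => vscale c (s n)).
Proof.
move=> hs e e0; have c0 := modulus_ge0 c.
have c1 : 0 < modulus c + 1 by lra.
have e2 : 0 < e / (modulus c + 1) by rewrite divr_gt0.
have [n1 h1] := hs _ e2; exists n1 => n m a b.
have -> : vnorm (vsub (vscale c (s n)) (vscale c (s m))) =
    vnorm (vscale c (vsub (s n) (s m))).
  by apply: vnorm_ext => w; rewrite /vsub !(formDl, formZl); ring.
rewrite vnormZ; have := h1 _ _ a b; rewrite ler_pdivlMr//.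
have := vnorm_ge0 (vsub (s n) (s m)); nra.
Qed.

Lemma vcauchy_trans x (s : nat -> V) : vcauchy s -> vcauchy (fun n => vtrans x (s n)).
Proof.
move=> hs e /hs[n0 h]; exists n0 => n m a b.
have -> : vsub (vtrans x (s n)) (vtrans x (s m)) = vtrans x (vsub (s n) (s m)).
  by rewrite /vsub /vtrans map_cat /vscale -!map_comp.
by rewrite vnorm_trans h.
Qed.

Lemma vcauchy_cst s : vcauchy (fun=> s).
Proof.
move=> e e0; exists 0%N => n m _ _; rewrite (_ : vnorm _ = 0) ?ltW//.
have -> : vnorm (vsub s s) = vnorm [::].
  by apply: vnorm_ext => t; rewrite formBl subrr /kernel_form big_nil.
by rewrite /vnorm /kernel_form big_nil sqrtr0.
Qed.

Lemma form_cauchy (s t : nat -> V) : vcauchy s -> vcauchy t ->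
  exists l : C, B (s n) (t n) @[n --> \oo] --> l.
Proof.
move=> hs ht; apply: complex_cauchy_cvg => e e0.
have [M M0 [n1 h1]] := vcauchy_bounded hs; have [K K0 [n2 h2]] := vcauchy_bounded ht.
have eM : 0 < e / (2 * M) by rewrite divr_gt0// mulr_gt0.
have eK : 0 < e / (2 * K) by rewrite divr_gt0// mulr_gt0.
have [n3 h3] := hs _ eK; have [n4 h4] := ht _ eM.
exists (maxn (maxn n1 n2) (maxn n3 n4)) => n m.
rewrite !geq_max => /andP[/andP[a1 a2] /andP[a3 a4]] /andP[/andP[b1 b2] /andP[b3 b4]].
have -> : B (s n) (t n) - B (s m) (t m) =
    B (vsub (s n) (s m)) (t n) + B (s m) (vsub (t n) (t m)).
  by rewrite formBl formBr; ring.
apply: (le_trans (modulusD _ _)).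
have c1 := form_CS (vsub (s n) (s m)) (t n); have c2 := form_CS (s m) (vsub (t n) (t m)).
have d1 : vnorm (vsub (s n) (s m)) * vnorm (t n) <= e / (2 * K) * K.
  by apply: ler_pM; rewrite ?vnorm_ge0//; [exact: h3|exact: h2].
have d2 : vnorm (s m) * vnorm (vsub (t n) (t m)) <= M * (e / (2 * M)).
  by apply: ler_pM; rewrite ?vnorm_ge0//; [exact: h1|exact: h4].
have e1 : e / (2 * K) * K = e / 2 by field; rewrite gt_eqF.
have e2 : M * (e / (2 * M)) = e / 2 by field; rewrite gt_eqF.
rewrite e1 in d1; rewrite e2 in d2; lra.
Qed.

Lemma form_points (s : nat -> V) t (F : T) :
  (forall y, B (s n) (vpoint y) @[n --> \oo] --> F y) ->
  B (s n) t @[n --> \oo] --> \sum_(q <- t) Num.conj q.1 * F q.2.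
Proof.
move=> h; elim: t => [|q t ih].
  rewrite big_nil; under eq_fun => n.
    have -> : B (s n) [::] = 0 by rewrite /kernel_form big1// => p _; rewrite big_nil.
    over.
  exact: cvg_cst.
rewrite big_cons.
have -> : (fun n => B (s n) (q :: t)) =
    (fun n => Num.conj q.1 * B (s n) (vpoint q.2) + B (s n) t).
  apply/funext => n; rewrite -formZr -formDr; congr B.
  by rewrite /vscale /vpoint /= mulr1; case: q.
have c1 : Num.conj q.1 * B (s n) (vpoint q.2) @[n --> \oo] --> Num.conj q.1 * F q.2.
  exact: (cvgM (cvg_cst _) (h q.2)).
exact: (cvgD c1 ih).
Qed.

(** Replace t n by a fixed far term of t; its products with the terms of s are finite
    combinations of the values of s at points. *)
Lemma vcauchy_null (s t : nat -> V) : vcauchy s -> vcauchy t ->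
  (forall y, B (s n) (vpoint y) @[n --> \oo] --> (0 : C)) ->
  B (s n) (t n) @[n --> \oo] --> (0 : C).
Proof.
move=> hs ht s0; apply/cvgC_modulusP => e e0.
have [M M0 [n1 h1]] := vcauchy_bounded hs.
have eM : 0 < e / (2 * M) by rewrite divr_gt0// mulr_gt0.
have [n2 h2] := ht _ eM.
have := form_points (t := t n2) s0.
rewrite big1 => [|q _]; last by rewrite mulr0.
have e2 : 0 < e / 2 by rewrite divr_gt0.
move=> /cvgC_modulusP/(_ _ e2) h3.
near=> n.
have a1 : (n1 <= n)%N by near: n; exists n1.
have a2 : (n2 <= n)%N by near: n; exists n2.
have a3 : modulus (B (s n) (t n2) - 0) < e / 2 by near: n.
have -> : B (s n) (t n) - 0 = B (s n) (vsub (t n) (t n2)) + (B (s n) (t n2) - 0).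
  by rewrite formBr; ring.
apply: (le_lt_trans (modulusD _ _)).
have c1 := form_CS (s n) (vsub (t n) (t n2)).
have d1 : vnorm (s n) * vnorm (vsub (t n) (t n2)) <= M * (e / (2 * M)).
  by apply: ler_pM; rewrite ?vnorm_ge0//; [exact: h1|exact: h2].
have e3 : M * (e / (2 * M)) = e / 2 by field; rewrite gt_eqF.
rewrite e3 in d1; lra.
Unshelve. all: by end_near. Qed.

(** F is the limit of s in the reproducing kernel Hilbert space of phi. *)
Definition represents (s : nat -> V) (F : T) := vcauchy s /\
  forall y, B (s n) (vpoint y) @[n --> \oo] --> F y.

Lemma representsD (s t : nat -> V) F K : represents s F -> represents t K ->
  represents (fun n => s n ++ t n) (F + K).
Proof.
move=> [c1 h1] [c2 h2]; split; first exact: vcauchyD.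
by move=> y; under eq_fun do rewrite formDl; exact: (cvgD (h1 y) (h2 y)).
Qed.

Lemma representsZ c (s : nat -> V) F : represents s F -> represents (fun n => vscale c (s n)) (c *: F).
Proof.
move=> [c1 h1]; split; first exact: vcauchyZ.
move=> y; under eq_fun do rewrite formZl.
by apply: (@cvgM _ _ _ _ (cst c)) (h1 y); exact: cvg_cst.
Qed.

Lemma represents_cst s : represents (fun=> s) (fun y => B s (vpoint y)).
Proof. by split; [exact: vcauchy_cst|move=> y; exact: cvg_cst]. Qed.

Lemma represents0 : represents (fun=> [::]) 0.
Proof.
have := represents_cst [::]; congr represents.
by apply/funext => y; rewrite /kernel_form big_nil.
Qed.

Lemma represents_trans x (s : nat -> V) F : represents s F ->
  represents (fun n => vtrans x (s n)) (fun y => F (x^-1 * y)%g).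
Proof.
move=> [c1 h1]; split; first exact: vcauchy_trans.
move=> y.
suff <- : (fun n => B (s n) (vpoint (x^-1 * y)%g)) =
    (fun n => B (vtrans x (s n)) (vpoint y)) by exact: h1.
apply/funext => n; rewrite -[LHS](form_trans x) /vtrans /vpoint /= mulgA mulgV mul1g.
by [].
Qed.

(** The scalar product with the limit F does not depend on the sequence that
    represents F. *)
Lemma form_limit_unique (s s' t : nat -> V) F : represents s F -> represents s' F -> vcauchy t ->
  B (s n) (t n) - B (s' n) (t n) @[n --> \oo] --> (0 : C).
Proof.
move=> rs rs' ct; have [c h] := representsD rs (representsZ (-1) rs').
have F0 : F + -1 *: F = 0 by rewrite scaleN1r subrr.
rewrite F0 in h; have := vcauchy_null c ct h.
by under eq_fun do rewrite formDl formZl mulN1r.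
Qed.

End kernel_form_theory.

(** * The GNS space *)

Section gns_space.
Variables (R : realType) (G : topologicalGroupType).
Local Notation C := (Cplx R).
Local Notation T := (G -> C).

Definition gns_pred (phi : T) (hphi : positive_definite phi) : {pred T} :=
  fun F => `[< exists s, represents phi s F >].

Variable phi : T.
Hypothesis hphi : positive_definite phi.

Fact gns_submod_closed : submod_closed (gns_pred hphi).
Proof.
split; first by apply/asboolP; exists (fun=> [::]); exact: represents0.
move=> c F K /asboolP[s hs] /asboolP[t ht]; apply/asboolP.
exists (fun n => vscale c (s n) ++ t n).
exact: (representsD hphi (representsZ hphi c hs) ht).
Qed.

HB.instance Definition _ :=
  GRing.isSubmodClosed.Build C T (gns_pred hphi) gns_submod_closed.

(** The Hilbert space of the GNS construction, realized as the reproducing kernel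
    space of (x, y) |-> phi (y^-1 x): a space of functions on G, in which a vector
    is determined by its values and no quotient is needed. *)
Definition gns : Type := {F : T | F \in gns_pred hphi}.

HB.instance Definition _ := [isSub of gns for @sval T _].
HB.instance Definition _ := [Choice of gns by <:].
HB.instance Definition _ := [SubChoice_isSubLmodule of gns by <:].

Local Notation V := (seq (C * G)).
Local Notation B := (kernel_form phi).
Local Notation H := gns.
Implicit Types (F K L : H) (c : C) (x y : G).

Lemma gnsP F : exists s, represents phi s (val F).
Proof. by have /asboolP := valP F. Qed.

Definition gns_seq F : nat -> V := projT1 (cid (gnsP F)).

Lemma gns_seqP F : represents phi (gns_seq F) (val F).
Proof. by rewrite /gns_seq; case: cid. Qed.

Definition gns_of (f : T) (s : nat -> V) (h : represents phi s f) : H :=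
  exist _ f (asboolT (ex_intro _ s h)).

Definition gns_ip_def F K : C :=
  projT1 (cid (form_cauchy hphi (gns_seqP F).1 (gns_seqP K).1)).

Fact gns_ip_key : unit. Proof. by []. Qed.

(** Sealed, since a scalar product is only ever identified as the limit in the next
    lemma, never through the chosen sequences. *)
Definition gns_ip : H -> H -> C := locked_with gns_ip_key gns_ip_def.

Lemma gns_ip_lim (s t : nat -> V) F K : represents phi s (val F) ->
  represents phi t (val K) -> B (s n) (t n) @[n --> \oo] --> gns_ip F K.
Proof.
move=> rs rt; set l := gns_ip F K.
have hl : B (gns_seq F n) (gns_seq K n) @[n --> \oo] --> l.
  by rewrite /l /gns_ip unlock /gns_ip_def; case: cid.
have h1 := form_limit_unique hphi rs (gns_seqP F) rt.1.
have h2 := form_limit_unique hphi rt (gns_seqP K) (gns_seqP F).1.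
have h3 : Num.conj (B (t n) (gns_seq F n) - B (gns_seq K n) (gns_seq F n))
    @[n --> \oo] --> (0 : C).
  apply/cvgC_modulusP => e e0; have /cvgC_modulusP/(_ _ e0) := h2.
  by apply: filterS => n; rewrite !subr0 modulus_conj.
have -> : l = 0 + 0 + l by rewrite !add0r.
suff -> : (fun n => B (s n) (t n)) = (fun n => B (s n) (t n) - B (gns_seq F n) (t n) +
    Num.conj (B (t n) (gns_seq F n) - B (gns_seq K n) (gns_seq F n)) +
    B (gns_seq F n) (gns_seq K n)) by exact: (cvgD (cvgD h1 h3) hl).
apply/funext => n; rewrite (rmorphB (@Num.conj C)) /= -!(form_herm hphi).
by rewrite addrA subrK subrK.
Qed.

Lemma gns_ip_linear c F K L : gns_ip (c *: F + K) L = c * gns_ip F L + gns_ip K L.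
Proof.
have rF := gns_seqP F; have rK := gns_seqP K; have rL := gns_seqP L.
have h1 : represents phi (fun n => vscale c (gns_seq F n) ++ gns_seq K n)
   (val (c *: F + K)) by exact: (representsD hphi (representsZ hphi c rF) rK).
apply: (cvgC_unique (gns_ip_lim h1 rL)).
under eq_fun do rewrite formDl formZl.
have c1 : c * B (gns_seq F n) (gns_seq L n) @[n --> \oo] --> c * gns_ip F L.
  exact: (cvgM (cvg_cst c) (gns_ip_lim rF rL)).
exact: (cvgD c1 (gns_ip_lim rK rL)).
Qed.

Lemma gns_ip_herm F K : gns_ip F K = Num.conj (gns_ip K F).
Proof.
apply: (cvgC_unique (gns_ip_lim (gns_seqP F) (gns_seqP K))).
under eq_fun do rewrite form_herm//.
apply/cvgC_modulusP => e e0.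
have /cvgC_modulusP/(_ _ e0) := gns_ip_lim (gns_seqP K) (gns_seqP F).
by apply: filterS => n; rewrite -rmorphB modulus_conj.
Qed.

Lemma gns_ip_ge0 F : 0 <= gns_ip F F.
Proof.
have /cvgC_0P := gns_ip_lim (gns_seqP F) (gns_seqP F).
under eq_fun do rewrite modulus_sub.
by move=> h; apply: (ge0_limit (z := fun n => B (gns_seq F n) (gns_seq F n))) h => n;
  exact: kernel_form_ge0.
Qed.

Definition gns_point (y : G) : H := gns_of (represents_cst hphi (vpoint R y)).

(** The values of the elements are their products with the kernel functions. *)
Lemma gns_reproducing F y : val F y = gns_ip F (gns_point y).
Proof.
have [_ h] := gns_seqP F.
have rp : represents phi (fun=> vpoint R y) (val (gns_point y)).
  exact: (represents_cst hphi).
exact: (cvgC_unique (h y) (gns_ip_lim (gns_seqP F) rp)).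
Qed.

Lemma gns_ip_linearr c F K L : gns_ip L (c *: F + K) = Num.conj c * gns_ip L F + gns_ip L K.
Proof.
rewrite gns_ip_herm gns_ip_linear (rmorphD (@Num.conj C)) (rmorphM (@Num.conj C)) /=.
by rewrite -(gns_ip_herm L F) -(gns_ip_herm L K).
Qed.

Lemma gns_ipZ c d F K : gns_ip (c *: F) (d *: K) = c * Num.conj d * gns_ip F K.
Proof.
have Z L : gns_ip 0 L = 0.
  by have := gns_ip_linear (-1) 0 0 L; rewrite scaler0 addr0 mulN1r addNr.
have Z' L : gns_ip L 0 = 0 by rewrite gns_ip_herm Z conjC0.
rewrite -[c *: F]addr0 -[d *: K]addr0 gns_ip_linear gns_ip_linearr Z Z'.
by rewrite !addr0 mulrA.
Qed.

Lemma gns_ip_eq0 F : gns_ip F F = 0 -> F = 0.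
Proof.
move=> F0; apply/val_inj/funext => y; rewrite gns_reproducing.
suff : modulus (gns_ip F (gns_point y)) ^+ 2 <=
    0 * complex.Re (gns_ip (gns_point y) (gns_point y)).
  rewrite mul0r => h; apply/eqP; rewrite -modulus_eq0 -sqrf_eq0.
  by rewrite eq_le h exprn_ge0// modulus_ge0.
have /ge0_rc[e h] := gns_ip_ge0 (gns_point y).
apply: quadratic_discriminant => // t.
have /ge0_rc[_] := gns_ip_ge0 (t *: gns_point y + F).
rewrite gns_ip_linear !gns_ip_linearr F0 -e.
rewrite (gns_ip_herm (gns_point y) F); congr (_ <= complex.Re _).
by rewrite (_ : rc 0 = 0 :> C)//; ring.
Qed.

Fact gns_ip_bilinear : @bilinear_for C H H C (GRing.Scale.Law.clone _ _ ( *%R ) _)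
  (GRing.Scale.Law.clone _ _ (@Num.conj C \; *%R) _) gns_ip.
Proof.
by split=> [L|L] c F K /=; [exact: gns_ip_linear|exact: gns_ip_linearr].
Qed.

HB.instance Definition _ := bilinear_isBilinear.Build C H H C
  (GRing.Scale.Law.clone _ _ ( *%R ) _) (GRing.Scale.Law.clone _ _ (@Num.conj C \; *%R) _)
  gns_ip gns_ip_bilinear.

Fact gns_ip_hermitian F K : gns_ip F K = (-1) ^+ false * Num.conj (gns_ip K F).
Proof. by rewrite expr0 mul1r; exact: gns_ip_herm. Qed.

HB.instance Definition _ :=
  @isHermitianSesquilinear.Build C H false (@Num.conj C) gns_ip gns_ip_hermitian.

Fact gns_ip_gt0 F : F != 0 -> 0 < gns_ip F F.
Proof.
move=> F0; rewrite lt_def gns_ip_ge0 andbT; apply: contra F0 => /eqP e.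
by apply/eqP; exact: gns_ip_eq0.
Qed.

HB.instance Definition _ := isDotProduct.Build C H gns_ip gns_ip_gt0.

Definition gns_dot : {dot H for @Num.conj C} := gns_ip.

Definition gns_rnorm F : R := Num.sqrt (complex.Re (gns_ip F F)).

Lemma gns_rnorm_ge0 F : 0 <= gns_rnorm F. Proof. exact: sqrtr_ge0. Qed.

Lemma gns_ipE F : gns_ip F F = rc (gns_rnorm F ^+ 2).
Proof. by have /ge0_rc[e h] := gns_ip_ge0 F; rewrite /gns_rnorm sqr_sqrtr. Qed.

Lemma gns_CS F K : modulus (gns_ip F K) <= gns_rnorm F * gns_rnorm K.
Proof.
rewrite -ler_sqr ?nnegrE ?modulus_ge0 ?mulr_ge0 ?gns_rnorm_ge0// exprMn.
apply: quadratic_discriminant; rewrite ?exprn_ge0 ?gns_rnorm_ge0// => t.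
have /ge0_rc[_] := gns_ip_ge0 (t *: K + F).
rewrite gns_ip_linear !gns_ip_linearr (gns_ip_herm K F) -!gns_ipE.
by congr (_ <= complex.Re _); ring.
Qed.

Lemma gns_rnormD F K : gns_rnorm (F + K) <= gns_rnorm F + gns_rnorm K.
Proof.
have vs := gns_rnorm_ge0 F; have vt := gns_rnorm_ge0 K.
rewrite -ler_sqr ?nnegrE ?gns_rnorm_ge0 ?addr_ge0//.
have : rc (gns_rnorm (F + K) ^+ 2) = rc (gns_rnorm F ^+ 2) + rc (gns_rnorm K ^+ 2) +
    rc (2 * complex.Re (gns_ip F K)).
  rewrite -!gns_ipE -{1 2}[F]scale1r gns_ip_linear !gns_ip_linearr.
  by rewrite (gns_ip_herm K F) -addC_conj conjC1; ring.
rewrite -!rcD => /(@rcI R) ->.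
have := Re_le_modulus (gns_ip F K); have := ler_norm (complex.Re (gns_ip F K)).
have := gns_CS F K; nra.
Qed.

Definition gns_norm F : C := rc (gns_rnorm F).

Fact gns_normD F K : gns_norm (F + K) <= gns_norm F + gns_norm K.
Proof. by rewrite /gns_norm -rcD -subr_ge0 -rcB rc_ge0 subr_ge0 gns_rnormD. Qed.

Fact gns_normZ c F : gns_norm (c *: F) = `|c| * gns_norm F.
Proof.
rewrite normC_modulus /gns_norm -rcM; congr rc.
apply/eqP; rewrite -(@eqrXn2 _ 2) ?mulr_ge0 ?gns_rnorm_ge0 ?modulus_ge0//.
apply/eqP/(@rcI R); rewrite -gns_ipE exprMn rcM -mulC_conj -gns_ipE.
by rewrite gns_ipZ.
Qed.

Fact gns_norm_eq0 F : gns_norm F = 0 -> F = 0.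
Proof.
by move=> /(@rcI R) h; apply: gns_ip_eq0; rewrite gns_ipE h expr0n.
Qed.

HB.instance Definition _ :=
  Lmodule_isNormed.Build C H gns_normD gns_normZ gns_norm_eq0.

End gns_space.

(** * GNS representation and upper bound for the dual norm *)

Section gns_hilbert.
Variables (R : realType) (G : topologicalGroupType).
Local Notation C := (Cplx R).
Local Notation T := (G -> C).
Variable phi : T.
Hypothesis hphi : positive_definite phi.
Local Notation V := (seq (C * G)).
Local Notation B := (kernel_form phi).
Local Notation H := (gns hphi).
Local Notation rnorm := (@gns_rnorm R G phi hphi).
Implicit Types (F K L : H) (c : C) (x y : G).

Lemma gns_rnorm_le (s : nat -> V) F (e : R) n0 : represents phi s (val F) -> 0 <= e ->
  (forall n, (n0 <= n)%N -> vnorm phi (s n) <= e) -> rnorm F <= e.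
Proof.
move=> rs e0 h; rewrite leNgt; apply/negP => lt.
have d0 : 0 < rnorm F ^+ 2 - e ^+ 2 by rewrite subr_gt0 ltr_sqr ?nnegrE// gns_rnorm_ge0.
have /cvgC_modulusP/(_ _ d0)[n1 _ h1] := gns_ip_lim rs rs.
have := h1 (maxn n0 n1) (leq_maxr _ _); have := h _ (leq_maxl n0 n1).
move: (s _) => v hv; rewrite gns_ipE formE// -rcB modulus_rc => hd.
have h2 : vnorm phi v ^+ 2 <= e ^+ 2 by rewrite ler_sqr ?nnegrE// vnorm_ge0.
by move: hd; rewrite ltr_norml => /andP[+ _]; lra.
Qed.

Definition gns_cst (s : V) : H := gns_of hphi (represents_cst hphi s).

Lemma gns_cst_rnorm (s : V) : rnorm (gns_cst s) = vnorm phi s.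
Proof.
rewrite /gns_rnorm /vnorm; congr (Num.sqrt (complex.Re _)).
have rs : represents phi (fun=> s) (val (gns_cst s)) by exact: (represents_cst hphi).
exact: (cvgC_unique (gns_ip_lim rs rs) (cvg_cst _)).
Qed.

Lemma representsB (s t : nat -> V) F K : represents phi s (val F) ->
  represents phi t (val K) -> represents phi (fun n => vsub (s n) (t n)) (val (F - K)).
Proof.
move=> rs rt; rewrite -scaleN1r.
exact: (representsD hphi rs (representsZ hphi (-1) rt)).
Qed.

Lemma gns_cstB (s t : V) : gns_cst s - gns_cst t = gns_cst (vsub s t).
Proof.
apply/val_inj/funext => y.
have -> : val (gns_cst s - gns_cst t) y = B s (vpoint R y) - B t (vpoint R y) by [].
by rewrite -formBl.
Qed.

Lemma gns_dense F (e : R) : 0 < e -> exists s, rnorm (F - gns_cst s) <= e.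
Proof.
move=> e0; have rF := gns_seqP F; have [n0 h] := rF.1 e e0.
exists (gns_seq F n0).
have rs : represents phi (fun=> gns_seq F n0) (val (gns_cst (gns_seq F n0))).
  exact: (represents_cst hphi).
apply: (gns_rnorm_le (n0 := n0) (representsB rF rs) (ltW e0)) => n n0n.
exact: h.
Qed.

Lemma gns_rnorm_sub F K : rnorm (F - K) = rnorm (K - F).
Proof.
have := gns_normZ (-1) (F - K); rewrite scaleN1r opprB normrN normr1 mul1r.
by move=> /(@rcI R).
Qed.

Lemma gns_rnorm_triangle F K L : rnorm (F - L) <= rnorm (F - K) + rnorm (K - L).
Proof. by rewrite -{1}(subrK K F) -addrA gns_rnormD. Qed.

Lemma gns_ballE F (e : R) : ball F (rc e) = [set K | rnorm (F - K) < e].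
Proof.
have E K : (`|F - K| < rc e) = (rnorm (F - K) < e).
  rewrite -[`|F - K|]/(rc (rnorm (F - K))) -subr_gt0 -rcB lt_def rc_ge0 -[0]/(rc 0).
  by rewrite (inj_eq (@rcI R)) -lt_def subr_gt0.
by rewrite -ball_normE; apply/seteqP; split => K /=; rewrite E.
Qed.

Lemma gns_limit (s : nat -> V) : vcauchy phi s ->
  exists F, represents phi s (val F).
Proof.
move=> cs.
have /choice[f hf] y : exists l : C, B (s n) (vpoint R y) @[n --> \oo] --> l.
  exact: (form_cauchy hphi cs (vcauchy_cst hphi _)).
have rs : represents phi s f by split.
by exists (gns_of hphi rs).
Qed.

(** Approximate the Cauchy filter by a sequence of finite combinations; this
    sequence is Cauchy and its pointwise limit is the limit in norm. *)
Lemma gns_complete (Fl : set_system H) : ProperFilter Fl -> cauchy Fl -> cvg Fl.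
Proof.
move=> PF /cauchyP cF.
pose e k : R := k.+1%:R^-1.
have e0 k : 0 < e k by rewrite invr_gt0.
have e_le k m : (k <= m)%N -> e m <= e k.
  by move=> km; rewrite lef_pV2 ?posrE// ler_nat.
have rce k : (0 : C) < rc (e k).
  by rewrite lt_def rc_ge0 ltW// andbT -[0]/(rc 0) (inj_eq (@rcI R)) gt_eqF.
have /choice[f hf] k : exists F, Fl (ball F (rc (e k))) by exact: cF.
have /choice[s hs] k : exists s, rnorm (f k - gns_cst s) <= e k by exact: gns_dense.
have ff n m : rnorm (f n - f m) <= e n + e m.
  have hI : Fl (ball (f n) (rc (e n)) `&` ball (f m) (rc (e m))).
    by apply: filterI; exact: hf.
  have [K [h1 h2]] := filter_ex hI.
  move: h1 h2; rewrite !gns_ballE /= => h1 h2.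
  rewrite (le_trans (gns_rnorm_triangle _ K _))// (gns_rnorm_sub K).
  by apply: lerD; exact: ltW.
have ss n m : vnorm phi (vsub (s n) (s m)) <= 2 * e n + 2 * e m.
  rewrite -gns_cst_rnorm -gns_cstB.
  have := gns_rnorm_triangle (gns_cst (s n)) (f n) (gns_cst (s m)).
  have := gns_rnorm_triangle (f n) (f m) (gns_cst (s m)).
  have := hs n; have := hs m; have := ff n m; rewrite (gns_rnorm_sub _ (f n)); lra.
have small (d : R) : 0 < d -> exists n, e n < d.
  move=> d0; have [n hn] : exists n : nat, d^-1 < n.+1%:R.
    exists (Num.bound d^-1); rewrite (lt_le_trans (archi_boundP _))//.
      by rewrite invr_ge0 ltW.
    by rewrite ler_nat.
  by exists n; rewrite /e -[d]invrK ltf_pV2 ?posrE ?invr_gt0.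
have cs : vcauchy phi s.
  move=> d d0; have d4 : 0 < d / 4 by rewrite divr_gt0.
  have [n0 hn0] := small _ d4; exists n0 => n m nn nm.
  have := ss n m; have := e_le _ _ nn; have := e_le _ _ nm; lra.
have [F rF] := gns_limit cs.
have fF n : rnorm (F - f n) <= 5 * e n.
  have rs : represents phi (fun=> s n) (val (gns_cst (s n))) by exact: (represents_cst hphi).
  have e4 : 0 <= 4 * e n by rewrite mulr_ge0// ltW.
  have := gns_rnorm_le (n0 := n) (representsB rF rs) e4 _.
  have h : forall m, (n <= m)%N -> vnorm phi (vsub (s m) (s n)) <= 4 * e n.
    by move=> m nm; have := ss m n; have := e_le _ _ nm; lra.
  move=> /(_ h) h1; have := gns_rnorm_triangle F (gns_cst (s n)) (f n).
  have := hs n; rewrite gns_rnorm_sub; lra.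
apply/cvg_ex; exists F; apply/cvg_ballP => d d0.
have [r r0 dr] := ge0_rcP (ltW d0).
have rp : 0 < r.
  by move: d0; rewrite dr lt_def rc_ge0 -[0]/(rc 0) (inj_eq (@rcI R)) -lt_def.
have r6 : 0 < r / 6 by rewrite divr_gt0.
have [n hn] := small _ r6; rewrite dr gns_ballE.
near=> K => /=.
have : ball (f n) (rc (e n)) K by near: K; exact: hf.
rewrite gns_ballE /= => h1.
have := gns_rnorm_triangle F (f n) K; have := fF n; lra.
Unshelve. all: by end_near. Qed.

HB.instance Definition _ := Uniform_isComplete.Build H gns_complete.

Lemma gns_hilbert : hilbert_product (gns_dot hphi : {dot H for @Num.conj C}).
Proof.
by move=> F; rewrite -[`|F|]/(rc (rnorm F)) -rcX -gns_ipE.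
Qed.

Definition gns_pi_fun x F : H := gns_of hphi (represents_trans x (gns_seqP F)).

Fact gns_pi_linear x : linear (gns_pi_fun x).
Proof. by move=> c F K; apply/val_inj/funext. Qed.

HB.instance Definition _ x := GRing.isLinear.Build C H H _ (gns_pi_fun x) (gns_pi_linear x).

Definition gns_pi x : {linear H -> H} := gns_pi_fun x.

Lemma gns_pi_val x F y : val (gns_pi x F) y = val F (x^-1 * y)%g.
Proof. by []. Qed.

Lemma gns_pi_unitary x F K : gns_ip (gns_pi x F) (gns_pi x K) = gns_ip F K.
Proof.
have rF := gns_seqP F; have rK := gns_seqP K.
have rF' : represents phi (fun n => vtrans x (gns_seq F n)) (val (gns_pi x F)).
  exact: represents_trans (gns_seqP _).
have rK' : represents phi (fun n => vtrans x (gns_seq K n)) (val (gns_pi x K)).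
  exact: represents_trans (gns_seqP _).
apply: (cvgC_unique (gns_ip_lim rF' rK')).
by under eq_fun do rewrite form_trans; exact: gns_ip_lim.
Qed.

Lemma gns_pi_isometry x F : rnorm (gns_pi x F) = rnorm F.
Proof. by rewrite /gns_rnorm gns_pi_unitary. Qed.

Lemma gns_pi_cst x (s : V) : gns_pi x (gns_cst s) = gns_cst (vtrans x s).
Proof.
apply/val_inj/funext => y; rewrite gns_pi_val.
have -> : val (gns_cst s) (x^-1 * y)%g = B s (vpoint R (x^-1 * y)%g) by [].
by rewrite -(form_trans phi x) /vtrans /vpoint /= mulgA mulgV mul1g.
Qed.

Lemma form_trans_continuous (s t : V) : continuous phi ->
  continuous (fun x => B (vtrans x s) t).
Proof.
move=> cphi; rewrite /kernel_form.
under eq_fun do rewrite big_map.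
have csum (J : Type) (r : seq J) (f : J -> T) : (forall j, continuous (f j)) ->
    continuous (fun x => \sum_(j <- r) f j x).
  move=> cf; elim: r => [|j r ih].
    by under eq_fun do rewrite big_nil; move=> x; exact: cvg_cst.
  by under eq_fun do rewrite big_cons; exact: (continuousC_D (cf j) ih).
apply: (csum) => p; apply: (csum) => q /=.
have ct : continuous (fun x => phi (q.2^-1 * (x * p.2))%g).
  move=> x.
  have c1 : (fun x : G => (x, p.2)) z @[z --> x] --> (x, p.2).
    by apply: cvg_pair; [exact: cvg_id|exact: cvg_cst].
  have c2 := cvg_comp _ _ c1 (@mulg_continuous G (x, p.2)).
  have c3 := cvg_comp _ _ c2 (@translation_continuous G q.2^-1%g (x * p.2)%g).
  exact: (cvg_comp _ _ c3 (cphi _)).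
exact: (continuousC_Z (c := p.1 * Num.conj q.1) ct).
Qed.

(** The orbit of a finite combination is continuous because phi is, and finite
    combinations are dense. *)
Lemma gns_pi_continuous F : continuous phi -> continuous (fun x => gns_pi x F).
Proof.
move=> cphi x0; apply/cvg_ballP => d d0.
have [r r0 dr] := ge0_rcP (ltW d0).
have rp : 0 < r.
  by move: d0; rewrite dr lt_def rc_ge0 -[0]/(rc 0) (inj_eq (@rcI R)) -lt_def.
have r4 : 0 < r / 4 by rewrite divr_gt0.
have [s hs] := gns_dense F r4.
rewrite dr gns_ballE.
pose w x := B (vtrans x s) (vtrans x0 s).
have d1 : 0 < (r / 4) ^+ 2 / 2 by rewrite divr_gt0// exprn_gt0.
have /continuousC_P/(_ x0 _ d1) hw : continuous w by exact: form_trans_continuous.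
near=> x => /=.
have hx : modulus (w x - w x0) < (r / 4) ^+ 2 / 2 by near: x.
have hv : vnorm phi (vsub (vtrans x0 s) (vtrans x s)) <= r / 4.
  rewrite -ler_sqr ?nnegrE ?vnorm_ge0 ?(ltW r4)//.
  have e : rc (vnorm phi (vsub (vtrans x0 s) (vtrans x s)) ^+ 2) =
      rc (2 * complex.Re (w x0 - w x)).
    rewrite -formE// formBl// !formBr// !form_trans -addC_conj.
    rewrite /w form_trans (form_herm hphi (vtrans x0 s) (vtrans x s)).
    by rewrite (rmorphB (@Num.conj C)) /= -(form_herm hphi s s); ring.
  move/(@rcI R) : e => ->.
  have := Re_le_modulus (w x0 - w x); rewrite modulus_sub.
  have := ler_norm (complex.Re (w x0 - w x)); lra.
have h1 : rnorm (gns_pi x0 F - gns_pi x0 (gns_cst s)) <= r / 4.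
  by rewrite -linearB gns_pi_isometry.
have h2 : rnorm (gns_pi x (gns_cst s) - gns_pi x F) <= r / 4.
  by rewrite gns_rnorm_sub -linearB gns_pi_isometry.
have h3 : rnorm (gns_pi x0 (gns_cst s) - gns_pi x (gns_cst s)) <= r / 4.
  by rewrite !gns_pi_cst gns_cstB gns_cst_rnorm.
have := gns_rnorm_triangle (gns_pi x0 F) (gns_pi x0 (gns_cst s)) (gns_pi x F).
have := gns_rnorm_triangle (gns_pi x0 (gns_cst s)) (gns_pi x (gns_cst s)) (gns_pi x F).
lra.
Unshelve. all: by end_near. Qed.

Lemma gns_unitary_rep : continuous phi -> unitary_rep (gns_dot hphi) gns_pi.
Proof.
move=> cphi; split.
- by move=> F; apply/val_inj/funext => y; rewrite gns_pi_val invg1 mul1g.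
- move=> x y F; apply/val_inj/funext => z; rewrite !gns_pi_val.
  by rewrite invgM mulgA.
- exact: gns_pi_unitary.
- by move=> F; exact: gns_pi_continuous.
Qed.

Definition gns_cyclic : H := gns_point hphi 1%g.

Lemma gns_coefficient x : gns_ip (gns_pi x gns_cyclic) gns_cyclic = phi x.
Proof.
rewrite -gns_reproducing gns_pi_val mulg1.
have -> : val gns_cyclic x^-1%g = B (vpoint R 1%g) (vpoint R x^-1%g) by [].
by rewrite /kernel_form !big_seq1 /= conjC1 !mul1r invgK mulg1.
Qed.

Lemma gns_cyclic_rnorm : rnorm gns_cyclic ^+ 2 = complex.Re (phi 1%g).
Proof.
apply: (@rcI R); rewrite -gns_ipE -gns_coefficient.
have -> : gns_pi 1%g gns_cyclic = gns_cyclic.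
  by apply/val_inj/funext => y; rewrite gns_pi_val invg1 mul1g.
by rewrite gns_ipE.
Qed.

End gns_hilbert.

Section fs_norm_upper_bound.
Variables (R : realType) (G : topologicalGroupType).
Hypothesis hG : hausdorff_space G.
Local Notation C := (Cplx R).
Local Notation T := (G -> C).
Variable I : T -> C.
Hypothesis HI : left_haar_integral I.

(** By the GNS construction phi / phi(1), if phi(1) <> 0, is the coefficient of a
    unitary representation at a vector of norm 1. *)
Lemma integral_cpd_le f phi : Cc R G f -> (cstar_norm I f <= 1)%E -> cpd phi ->
  modulus (I (f * phi)) <= value1 phi.
Proof.
move=> cf f1 hphi; have [cphi pphi] := hphi.
have v0 := value1_ge0 hphi.
have [v1|vN0] := eqVneq (value1 phi) 0.
  have -> : f * phi = 0.
    apply/funext => x; have := modulus_cpd x hphi; rewrite v1 => h.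
    have : phi x = 0 by apply/eqP; rewrite -modulus_eq0 eq_le h modulus_ge0.
    by rewrite fctE => ->; rewrite mulr0.
  by rewrite (haar0 hG HI) modulus0.
have vp : 0 < value1 phi by rewrite lt_def vN0.
pose a : R := Num.sqrt (value1 phi).
have a0 : 0 < a by rewrite sqrtr_gt0.
have a2 : a ^+ 2 = value1 phi by rewrite sqr_sqrtr.
have raN0 : rc a != 0 :> C by rewrite -[0]/(rc 0) (inj_eq (@rcI R)) gt_eqF.
pose xi := (rc a)^-1 *: gns_cyclic pphi.
have xi1 : `|xi| <= 1.
  rewrite /xi normrZ normC_modulus modulusV modulus_ge0_rc ?(ltW a0)//.
  rewrite -[`|gns_cyclic pphi|]/(rc (gns_rnorm (gns_cyclic pphi))) -rcM.
  have -> : gns_rnorm (gns_cyclic pphi) = a.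
    apply/eqP; rewrite -(@eqrXn2 _ 2) ?gns_rnorm_ge0 ?(ltW a0)//.
    by rewrite gns_cyclic_rnorm a2.
  by rewrite mulVf ?gt_eqF.
have coef x : gns_dot pphi (gns_pi pphi x xi) xi = (rc (value1 phi))^-1 * phi x.
  have piZ : gns_pi pphi x xi = (rc a)^-1 *: gns_pi pphi x (gns_cyclic pphi).
    exact: (linearZZ (gns_pi pphi x)).
  rewrite piZ [LHS]gns_ipZ gns_coefficient; congr (_ * _).
  by rewrite -rcV conj_rc -rcM -a2 -rcV expr2 invfM.
have le1 : (rep_norm I (gns_dot pphi) (gns_pi pphi) f <= 1)%E.
  apply: le_trans f1; apply: ereal_sup_ubound.
  exists (gns pphi), (gns_dot pphi), (gns_pi pphi); split => //.
    exact: gns_hilbert.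
  exact: gns_unitary_rep.
have : ((modulus (I (fun x => f x * gns_dot pphi (gns_pi pphi x xi) xi)))%:E <= 1)%E.
  by apply: le_trans le1; apply: ereal_sup_ubound; exists xi, xi.
rewrite lee_fin.
have -> : (fun x => f x * gns_dot pphi (gns_pi pphi x xi) xi) =
    (rc (value1 phi))^-1 *: (f * phi).
  apply/funext => x; rewrite coef.
  have -> : ((rc (value1 phi))^-1 *: (f * phi)) x = (rc (value1 phi))^-1 * (f x * phi x) by [].
  ring.
rewrite (haarZ hG HI) ?modulusM; last exact: (Cc_mul hG).
by rewrite modulusV modulus_ge0_rc// ler_pdivrMl// mulr1.
Qed.

Lemma integral_fs_rep_le f u t : Cc R G f -> (cstar_norm I f <= 1)%E -> fs_rep u t ->
  modulus (I (f * u)) <= t.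
Proof.
move=> cf f1; elim=> [|{}u {}t c phi ru ih hphi].
  by rewrite mulr0 (haar0 hG HI) modulus0.
have cu := fs_rep_continuous ru; have [cphi _] := hphi.
have cfp := Cc_mul hG cf cphi.
have -> : f * (c *: phi + u) = c *: (f * phi) + f * u.
  by apply/funext => x; rewrite !fctE mulrDr; congr (_ + _); exact: mulrCA.
rewrite (haar_linear HI c cfp (Cc_mul hG cf cu)).
rewrite (le_trans (modulusD _ _))// lerD// modulusM ler_wpM2l ?modulus_ge0//.
exact: (integral_cpd_le cf f1 hphi).
Qed.

Theorem fs_norm_le_pd_norm u : FS R G u -> (fs_norm I u <= (pd_norm u)%:E)%E.
Proof.
move=> /FS_repP[t0 ht0]; apply: ge_ereal_sup => _ [f [cf f1] <-].
rewrite lee_fin; apply: lb_le_inf; first by exists t0.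
by move=> t ht; exact: integral_fs_rep_le.
Qed.

End fs_norm_upper_bound.

(** * The Rajchman and Fourier algebras *)

Section rajchman_and_fourier_algebras.
Variables (R : realType) (G : topologicalGroupType).
Hypothesis hG : hausdorff_space G.
Hypothesis lcG : locally_compact [set: G].
Local Notation C := (Cplx R).
Local Notation T := (G -> C).
Variable I : T -> C.
Hypothesis HI : left_haar_integral I.
Local Notation FS := (FS R G).
Local Notation B0 := (rajchman_algebra R G).
Local Notation A := (fourier_algebra I).
Local Notation N := (@pd_norm R G).
Local Notation BA := (@FS_banach_algebra R G).
Implicit Types (u v w : T).

Lemma C0_of_cs u : continuous u -> compactly_supported u -> C0 R G u.
Proof.
move=> cu su; split=> // e e0; exists (closure [set x | u x != 0]) => // x nx.
by rewrite (support_closure nx) modulus0.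
Qed.

Lemma C0_lin (c : C) u v : C0 R G u -> C0 R G v -> C0 R G (c *: u + v).
Proof.
move=> [cu u0] [cv v0]; split; first exact: (continuousC_D (continuousC_Z (c := c) cu) cv).
move=> e e0; have c0 := modulus_ge0 c.
have c1 : 0 < 2 * (modulus c + 1) by lra.
have e1 : 0 < e / (2 * (modulus c + 1)) by rewrite divr_gt0.
have e2 : 0 < e / 2 by rewrite divr_gt0.
have [K cK hK] := u0 _ e1; have [K' cK' hK'] := v0 _ e2.
exists (K `|` K'); first exact: compactU.
move=> x /not_orP[/hK h1 /hK' h2].
apply: (le_lt_trans (modulusD _ _)); rewrite [modulus ((c *: u) x)](modulusM c (u x)).
rewrite ltr_pdivlMr// in h1; have := modulus_ge0 (u x); nra.
Qed.

Lemma C0_bounded_mul u v M : continuous u -> (forall x, modulus (u x) <= M) ->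
  C0 R G v -> C0 R G (u * v).
Proof.
move=> cu uM [cv v0]; split; first exact: (continuousC_M cu cv).
move=> e e0; have M0 : 0 <= M := le_trans (modulus_ge0 _) (uM 1%g).
have M1 : 0 < M + 1 by lra.
have e1 : 0 < e / (M + 1) by rewrite divr_gt0.
have [K cK hK] := v0 _ e1; exists K => // x /hK h.
rewrite [modulus _](modulusM (u x) (v x)); rewrite ltr_pdivlMr// in h.
have := uM x; have := modulus_ge0 (v x); nra.
Qed.

Lemma C0_uniform_limit u : continuous u ->
  (forall e : R, 0 < e -> exists2 v, C0 R G v & forall x, modulus (u x - v x) < e) ->
  C0 R G u.
Proof.
move=> cu h; split=> // e e0; have e2 : 0 < e / 2 by rewrite divr_gt0.
have [v [_ v0] uv] := h _ e2; have [K cK hK] := v0 _ e2; exists K => // x /hK hx.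
have -> : u x = (u x - v x) + v x by rewrite subrK.
apply: (le_lt_trans (modulusD _ _)); have := uv x; lra.
Qed.

Lemma FS_sup u x : FS u -> modulus (u x) <= N u.
Proof. exact: (ba_sup BA). Qed.

Lemma B0_FS u : B0 u -> FS u. Proof. by case. Qed.

Lemma B0_0 : B0 0.
Proof.
split; first exact: (ba0 BA).
by apply: C0_of_cs; [move=> x; exact: cvg_cst|have [] := Cc0 R hG].
Qed.

Lemma B0_lin (c : C) u v : B0 u -> B0 v -> B0 (c *: u + v).
Proof. by move=> [? ?] [? ?]; split; [exact: FS_lin|exact: C0_lin]. Qed.

Lemma B0_scale (c : C) u : B0 u -> B0 (c *: u).
Proof. by move=> h; rewrite -[c *: u]addr0; apply: B0_lin => //; exact: B0_0. Qed.

Lemma B0_add u v : B0 u -> B0 v -> B0 (u + v).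
Proof. by move=> hu hv; rewrite -[u]scale1r; exact: B0_lin. Qed.

Lemma B0_mul u v : FS u -> B0 v -> B0 (u * v).
Proof.
move=> hu [hv v0]; split; first exact: FS_mul.
exact: (C0_bounded_mul (FS_continuous hu) (fun x => FS_sup x hu) v0).
Qed.

Lemma B0_closed_ideal : closed_ideal I B0.
Proof.
split; [by move=> u []|exact: B0_0|exact: B0_lin|exact: B0_mul|].
move=> u hu h; split=> //; apply: C0_uniform_limit; first exact: FS_continuous.
move=> e e0; have [v [hv v0] uv] := h e e0; exists v => // x.
have Fuv : FS (u - v) by exact: (ba_sub BA).
have := sup_le_fs_norm hG lcG HI x (FS_continuous Fuv).
by move=> /le_lt_trans/(_ uv); rewrite lte_fin.
Qed.

Lemma fourier_algebra_sub : A `<=` B0.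
Proof.
move=> u; apply; split; first exact: B0_closed_ideal.
by move=> v [hv cv]; split => //; apply: C0_of_cs => //; exact: FS_continuous.
Qed.

Lemma fourier_algebra_cs u : FS u -> compactly_supported u -> A u.
Proof. by move=> hu cu J [_]; apply. Qed.

Lemma fourier_algebra_0 : A 0.
Proof. by move=> J [[_ h _ _ _] _]. Qed.

Lemma fourier_algebra_lin (c : C) u v : A u -> A v -> A (c *: u + v).
Proof.
by move=> hu hv J hJ; have [[_ _ h _ _] _] := hJ; apply: h; [exact: hu|exact: hv].
Qed.

Lemma fourier_algebra_scale (c : C) u : A u -> A (c *: u).
Proof.
by move=> h; rewrite -[c *: u]addr0; apply: fourier_algebra_lin => //; exact: fourier_algebra_0.
Qed.

Lemma fourier_algebra_mul u v : FS u -> A v -> A (u * v).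
Proof.
by move=> hu hv J hJ; have [[_ _ _ h _] _] := hJ; apply: h => //; exact: hv.
Qed.

Lemma exp_sumE (a : T) n : \sum_(k < n) (k`!%:R : C)^-1 *: a ^+ k =
  (fun x => exp_partial 0 n (a x)).
Proof.
apply/funext => x; rewrite fct_sumE; apply: eq_bigr => k _.
by rewrite !fctE addn0.
Qed.

(** The exponential series of a converges for the norm pd_norm, hence for the dual
    norm, which it bounds; conversely convergence for the dual norm implies
    pointwise convergence. *)
Lemma exp_setE (S : set T) : S `<=` FS ->
  exp_set I S = [set cexp (R := R) \o a | a in S].
Proof.
move=> SFS; apply/seteqP; split=> w.
  move=> [Fw [a Sa cw]]; exists a => //.
  apply/funext => x /=.
  have Fn n : FS (fun y => exp_partial 0 n (a y)).
    by apply: (exp_partial_ba BA); exact: SFS.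
  apply: (@expser_unique _ 0 (a x) (w x) (fun n => modulus (w x - exp_partial 0 n (a x)))) => //.
  apply/cvgrPdist_lt => e e0.
  have e1 : (0 < e%:E)%E by rewrite lte_fin.
  have : \forall n \near \oo, (fs_norm I (w - \sum_(k < n) (k`!%:R : C)^-1 *: a ^+ k)%R
     < e%:E)%E.
    by move: cw => /(_ [set t | (t < e%:E)%E]); apply; exact: lt_nbhsl.
  apply: filterS => n; rewrite exp_sumE => h; rewrite sub0r normrN ger0_norm ?modulus_ge0//.
  have Fwn : FS (w - (fun y => exp_partial 0 n (a y))) by exact: (ba_sub BA).
  have := sup_le_fs_norm hG lcG HI x (FS_continuous Fwn).
  by move=> /le_lt_trans/(_ h); rewrite lte_fin.
move=> [a Sa <-]; have Fa := SFS _ Sa.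
split; first exact: (ba_cexp BA).
exists a => //; have [Fe ce] := expser_ba BA 0 Fa.
have Fn n : FS (fun y => exp_partial 0 n (a y)) by exact: (exp_partial_ba BA).
have ce' : (N ((fun x => expser 0 (a x)) - (fun x => exp_partial 0 n (a x))))%:E
   @[n --> \oo] --> 0%E by apply: (cvg_comp _ _ ce); exact: cvg_id.
apply: (squeeze_cvge _ (cvg_cst 0%E) ce'); near=> n.
rewrite exp_sumE.
have Fd : FS ((cexp (R := R) \o a) - (fun y => exp_partial 0 n (a y))).
  exact: (ba_sub BA).
apply/andP; split; last exact: (fs_norm_le_pd_norm hG HI Fd).
apply: le_trans (sup_le_fs_norm hG lcG HI 1%g (FS_continuous Fd)).
by rewrite lee_fin modulus_ge0.
Unshelve. all: by end_near. Qed.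

Section noncompact.
Hypothesis ncG : ~ compact [set: G].

Lemma C0_small_point u (e : R) : C0 R G u -> 0 < e -> exists x, modulus (u x) < e.
Proof.
move=> [_ h] /h[K cK hK]; apply: contrapT => nex; apply: ncG.
suff -> : [set: G] = K by [].
by apply/seteqP; split=> // x _; apply: contrapT => /hK hx; apply: nex; exists x.
Qed.

Lemma C0_cst (c : C) : C0 R G (cst c) -> c = 0.
Proof.
move=> h; apply/eqP; rewrite -modulus_eq0 eq_le modulus_ge0 andbT.
apply/ler_addgt0Pr => e e0; rewrite add0r.
by have [x /ltW] := C0_small_point h e0.
Qed.

(** b is arbitrarily small at some point, because G is not compact.  Hence the
    projection of B0(G) + C1 onto the constants is continuous. *)
Lemma unitization_cst_le (b : T) (c : C) : B0 b -> modulus c <= N (b + cst c).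
Proof.
move=> hb; apply/ler_addgt0Pr => e e0; have [x hx] := C0_small_point hb.2 e0.
have Fc : FS (b + cst c) by apply: (ba_add BA); [exact: B0_FS|exact: (ba_cst BA)].
have cE : c = (b + cst c) x - b x by rewrite fctE addrAC subrr add0r.
rewrite [in leLHS]cE.
by apply: (le_trans (modulusB _ _)); apply: lerD; [exact: FS_sup|exact: ltW].
Qed.

Lemma unitization_unique (b b' : T) (c c' : C) : B0 b -> B0 b' ->
  b + cst c = b' + cst c' -> c = c' /\ b = b'.
Proof.
move=> hb hb' e; suff cc : c = c'.
  by split=> //; move: e; rewrite cc => /addIr.
apply/eqP; rewrite -subr_eq0; apply/eqP/C0_cst.
have -> : cst (c - c') = -1 *: b + b'.
  apply/funext => x; have := congr1 (@^~ x) e; rewrite !fctE => h.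
  have -> : c = b' x + c' - b x by rewrite -h [b x + c]addrC addrK.
  have E (z w : C) : z *: w = z * w by [].
  by rewrite ?E; ring.
by have [] := B0_lin (-1) hb hb'.
Qed.

Local Notation B1 := (unitization B0).

Lemma unitization_lin (S : set T) (c : C) u v :
  (forall (d : C) a b, S a -> S b -> S (d *: a + b)) ->
  unitization S u -> unitization S v -> unitization S (c *: u + v).
Proof.
move=> Slin [a Sa [ca ->]] [b Sb [cb ->]].
exists (c *: a + b); first exact: Slin.
exists (c * ca + cb); apply/funext => x; rewrite !fctE.
have E (z w : C) : z *: w = z * w by [].
by rewrite !E; ring.
Qed.

Lemma B1_FS : B1 `<=` FS.
Proof. by move=> _ [b /B0_FS hb [c ->]]; apply: (ba_add BA) => //; exact: (ba_cst BA). Qed.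

(** An absolutely convergent series splits into a series in B0(G) and a series of
    constants; B0(G) is closed under uniform limits in B(G). *)
Theorem rajchman_unitization_banach : banach_algebra B1 N.
Proof.
split.
- by exists 0; [exact: B0_0|exists 1; rewrite add0r].
- by move=> c u v; apply: unitization_lin; exact: B0_lin.
- move=> _ _ [a Ba [c ->]] [b Bb [d ->]].
  exists (a * b + (c *: b + d *: a)); last first.
    exists (c * d); apply/funext => x; rewrite !fctE.
    have E (z w : C) : z *: w = z * w by [].
    by rewrite !E; ring.
  apply: B0_add; first by apply: B0_mul => //; exact: B0_FS.
  by apply: B0_add; exact: B0_scale.
- exact: (ba_ge0 BA).
- by move=> u x /B1_FS; exact: FS_sup.
- by move=> u v /B1_FS hu /B1_FS hv; exact: (ba_normD BA).
- by move=> c u /B1_FS hu; exact: (ba_normZ BA).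
- by move=> u v /B1_FS hu /B1_FS hv; exact: (ba_normM BA).
move=> u a hu ua ca.
have /choice[bc hbc] k : exists p : T * C, B0 p.1 /\ u k = p.1 + cst p.2.
  by have [b Bb [c e]] := hu k; exists (b, c).
pose b k := (bc k).1; pose c k := (bc k).2.
have Bb k : B0 (b k) by have [] := hbc k.
have ubc k : u k = b k + cst (c k) by have [] := hbc k.
have cle k : modulus (c k) <= a k.
  by apply: le_trans (ua k); rewrite ubc; exact: unitization_cst_le.
have n1 := ba_ge0 BA 1.
have ncst (d : C) : N (cst d) <= modulus d * N 1.
  by rewrite cst_scale1; apply: (ba_normZ BA); exact: (ba1 BA).
have ble k : N (b k) <= (1 + N 1) * a k.
  have -> : b k = u k - cst (c k) by rewrite ubc addrK.
  apply: (le_trans (ba_normB BA (B1_FS (hu k)) (ba_cst BA _))).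
  have := ncst (c k); have := ua k; have := cle k; nra.
have cb : cvgn (series (fun k => (1 + N 1) * a k)).
  have -> : (fun k => (1 + N 1) * a k) = (1 + N 1) *: a by [].
  by apply: is_cvg_seriesZ; exact: ca.
have [s Fs cs] := ba_complete BA (fun k => B0_FS (Bb k)) ble cb.
have Bsum n : B0 (\sum_(k < n) b k).
  by elim/big_ind : _ => //; [exact: B0_0|exact: B0_add].
have Bs : B0 s.
  split=> //; apply: C0_uniform_limit; first exact: FS_continuous.
  move=> e e0; have /cvgrPdist_lt/(_ _ e0)[n _ /(_ n (leqnn n))] := cs.
  rewrite sub0r normrN ger0_norm ?(ba_ge0 BA)// => h.
  exists (\sum_(k < n) b k); first by have [] := Bsum n.
  move=> x; apply: le_lt_trans h.
  by have := FS_sup x (ba_sub BA Fs (B0_FS (Bsum n))).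
have [l hl] := complex_series_cvg cle ca.
exists (s + cst l); first by exists s => //; exists l.
have lim : N (s - \sum_(k < n) b k) + tail a n * N 1 @[n --> \oo] --> (0 : R).
  have -> : 0 = 0 + 0 * N 1 :> R by rewrite mul0r addr0.
  have c2 : tail a n * N 1 @[n --> \oo] --> 0 * N 1.
    exact: (cvgM (tail_cvg0 ca) (cvg_cst (N 1))).
  exact: (cvgD cs c2).
apply: (squeeze_cvgr _ (cvg_cst 0) lim); near=> n; rewrite (ba_ge0 BA) /=.
have -> : s + cst l - \sum_(k < n) u k =
    (s - \sum_(k < n) b k) + cst (l - \sum_(k < n) c k).
  have -> : \sum_(k < n) u k = \sum_(k < n) b k + cst (\sum_(k < n) c k).
    under eq_bigr do rewrite ubc.
    rewrite big_split /=; congr (_ + _); apply/funext => x.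
    by rewrite fct_sumE.
  by apply/funext => x; rewrite !fctE; ring.
apply: (le_trans (ba_normD BA (ba_sub BA Fs (B0_FS (Bsum n))) (ba_cst BA _))).
rewrite lerD2l (le_trans (ncst _))// ler_wpM2r// hl//.
Unshelve. all: by end_near. Qed.

End noncompact.

End rajchman_and_fourier_algebras.

(** * The spectrum of a regular Rajchman algebra *)

Section regular_rajchman_algebra.
Variables (R : realType) (G : topologicalGroupType).
Hypothesis hG : hausdorff_space G.
Local Notation C := (Cplx R).
Local Notation T := (G -> C).
Local Notation B0 := (rajchman_algebra R G).
Local Notation N := (@pd_norm R G).
Implicit Types (x : G).

Definition evaluation x : {ptws B0 -> C} := fun a => val a x.

Lemma ptws_nbhs (gamma : {ptws B0 -> C}) (a : B0) (e : R) : 0 < e ->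
  nbhs gamma [set chi : {ptws B0 -> C} | modulus (chi a - gamma a) < e].
Proof.
move=> e0.
have cp : (fun chi : {ptws B0 -> C} => chi a) @ nbhs gamma --> gamma a.
  exact: (@proj_continuous B0 (fun=> C) a gamma).
by move/cvgC_modulusP : cp => /(_ e e0).
Qed.

(** Regularity forces every character to be a pointwise limit of evaluations; a
    function of C0(G) not killed by the character keeps the points in a compact
    set, so that the character is itself an evaluation. *)
Lemma spectrum_evaluation (gamma : {ptws B0 -> C}) : regular_algebra B0 ->
  spectrum gamma -> exists x, forall a : B0, gamma a = val a x.
Proof.
move=> reg sg; have [[a0 ga0] glin gmul] := sg.
have [clg|nclg] := pselect (closure (range evaluation) gamma); last first.
  exfalso; have cl : closed (closure (range evaluation)) by exact: closed_closure.
  (* The evaluation at a point where a does not vanish is a character, so a is 0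
     everywhere. *)
  have [a [a_0 /negP]] := reg _ gamma cl sg nclg; apply.
  have av0 x : val a x = 0.
    apply/eqP; apply: contraT => ax; exfalso; move/negP : (ax); apply.
    apply/eqP; apply: (a_0 (evaluation x)); split; first by apply: subset_closure; exists x.
    split; first by exists a.
      by move=> c u v d e; rewrite /evaluation e.
    by move=> u v d e; rewrite /evaluation e.
  have aE : val a = 1 *: val a + val a by apply/funext => x; rewrite !fctE av0 scaler0 addr0.
  by have := glin 1 a a a aE; rewrite mul1r -{1}[gamma a]addr0 => /addrI <-.
(* The trace on G of the neighbourhoods of gamma. *)
pose Fl : set_system G := [set U | exists2 W, nbhs gamma W & evaluation @^-1` W `<=` U].
have PF : ProperFilter Fl.
  split.
    move=> [W gW sub]; have [_ [[x _ <-] Wx]] := clg W gW.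
    exact: (sub x).
  split.
  - by exists setT => //; exact: filterT.
  - move=> P Q [W gW sP] [W' gW' sQ]; exists (W `&` W'); first exact: filterI.
    by move=> x [/sP Px /sQ Qx].
  - by move=> P Q PQ [W gW sP]; exists W => // x /sP; exact: PQ.
have d0 : 0 < modulus (gamma a0) / 2 by rewrite divr_gt0// modulus_gt0.
have [_ [_ /(_ _ d0)[K cK hK]]] : B0 (val a0) by exact: set_mem (valP a0).
have FK : Fl K.
  exists [set chi | modulus (chi a0 - gamma a0) < modulus (gamma a0) / 2].
    exact: ptws_nbhs.
  move=> x /= hx; apply: contrapT => /hK h.
  have := modulusB (val a0 x) (evaluation x a0 - gamma a0).
  have -> : val a0 x - (evaluation x a0 - gamma a0) = gamma a0.
    by rewrite /evaluation; ring.
  lra.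
have [x [Kx clx]] := cK Fl PF FK.
exists x => a; apply/eqP; apply: contraT => ne; exfalso.
have e0 : 0 < modulus (gamma a - val a x) / 2 by rewrite divr_gt0// modulus_gt0 subr_eq0.
have ca : continuous (val a) by have [/FS_continuous] : B0 (val a) by exact: set_mem (valP a).
have hU := (continuousC_P _).1 ca x _ e0.
have hW : Fl [set y | modulus (evaluation y a - gamma a) < modulus (gamma a - val a x) / 2].
  exists [set chi | modulus (chi a - gamma a) < modulus (gamma a - val a x) / 2].
    exact: ptws_nbhs.
  by [].
have [y [/= h1 h2]] := clx _ _ hW hU.
have := modulusB (val a y - val a x) (evaluation y a - gamma a).
have -> : val a y - val a x - (evaluation y a - gamma a) = gamma a - val a x.
  by rewrite /evaluation; ring.
lra.
Qed.

Hypothesis ncG : ~ compact [set: G].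
Hypothesis reg : regular_algebra B0.

(** The characters of B0(G) + C1 are the evaluations and the projection onto the
    constants, none of which kills b + c. *)
Lemma nonvanishing_invertible (b : T) (c : C) : B0 b -> c != 0 ->
  (forall x, b x + c != 0) -> exists2 v, unitization B0 v & (b + cst c) * v = 1.
Proof.
move=> hb c0 nz; apply: contrapT => ninv.
have hu : unitization B0 (b + cst c) by exists b => //; exists c.
have BA1 := rajchman_unitization_banach R hG ncG.
have [|chi [clin cmul c1] cu0] := exists_character BA1 hu.
  by move=> v hv e; apply: ninv; exists v.
have B1b a : B0 a -> unitization B0 a.
  by move=> ha; exists a => //; exists 0; apply/funext => x; rewrite fctE addr0.
have chiu : chi (b + cst c) = c + chi b.
  rewrite addrC cst_scale1 clin ?c1 ?mulr1//; first exact: (ba1 BA1).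
  exact: B1b.
rewrite chiu in cu0.
pose gamma : {ptws B0 -> C} := fun a => chi (val a).
have B0val (a : B0) : unitization B0 (val a) by apply: B1b; exact: set_mem (valP a).
pose sb : B0 := SigSub (mem_set hb).
have [g0|/existsNP[a /eqP ga]] := pselect (forall a : B0, gamma a = 0).
  have gb : chi b = 0 by exact: (g0 sb).
  by move: cu0; rewrite gb addr0 => /eqP; rewrite (negbTE c0).
have sg : spectrum gamma.
  split; first by exists a.
    by move=> d u v w e; rewrite /gamma e clin.
  by move=> u v w e; rewrite /gamma e cmul.
have [x hx] := spectrum_evaluation reg sg.
have chib : chi b = b x by exact: (hx sb).
by have := nz x; rewrite -chib addrC cu0 eqxx.
Qed.

End regular_rajchman_algebra.

(** * Comparison of the two groups of components *)

Section quotient_groups.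
Variables (R : realType) (X : Type).
Local Notation C := (Cplx R).
Local Notation T := (X -> C).
Implicit Types (U V E F P Q : set T) (u a b : T).

Record multiplicative_group E : Prop := MultiplicativeGroup {
  mg_1 : E 1 ;
  mg_mul : forall a b, E a -> E b -> E (a * b) ;
  mg_inv : forall a, E a -> exists2 b, E b & a * b = 1 }.

Lemma coset_mem E a u : setprod [set a] E u <-> exists2 e, E e & u = a * e.
Proof.
split=> [[_ -> [e Ee ->]]|[e Ee ->]]; first by exists e.
by exists a => //; exists e.
Qed.

Lemma coset_eq E a b : multiplicative_group E -> setprod [set b] E a ->
  setprod [set a] E = setprod [set b] E.
Proof.
move=> mE /coset_mem[e Ee ->].
have [f Ef ef] := mg_inv mE Ee.
apply/seteqP; split=> u /coset_mem[g Eg ->]; apply/coset_mem.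
  by exists (e * g); [exact: mg_mul|rewrite mulrA].
exists (f * g); first exact: mg_mul.
have -> : b * e * (f * g) = b * (e * f) * g by ring.
by rewrite ef mulr1.
Qed.

Lemma coset_mul E a b : multiplicative_group E ->
  setprod (setprod [set a] E) (setprod [set b] E) = setprod [set a * b] E.
Proof.
move=> mE; apply/seteqP; split=> u.
  move=> [_ /coset_mem[e Ee ->] [_ /coset_mem[f Ef ->] ->]]; apply/coset_mem.
  by exists (e * f); [exact: mg_mul|ring].
move=> /coset_mem[e Ee ->].
exists a; first by apply/coset_mem; exists 1; [exact: mg_1|rewrite mulr1].
exists (b * e); last by rewrite mulrA.
by apply/coset_mem; exists e.
Qed.

(** If U = E V and V meets E in F, the inclusion of V induces an isomorphism of
    V / F onto U / E.  Its inverse maps a coset P to the intersection of P and V. *)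
Lemma quotients_isomorphic_of_product U E V F :
  multiplicative_group E -> multiplicative_group V -> multiplicative_group F ->
  F `<=` E -> F `<=` V -> E `&` V `<=` F -> U = setprod E V ->
  quotients_isomorphic U E V F.
Proof.
move=> mE mV mF FE FV EVF UE.
have trace a : V a -> setprod [set a] E `&` V = setprod [set a] F.
  move=> Va; have [a' Va' aa'] := mg_inv mV Va.
  apply/seteqP; split=> u; last first.
    move=> /coset_mem[e Fe ->]; split; first by apply/coset_mem; exists e => //; exact: FE.
    by apply: (mg_mul mV) => //; exact: FV.
  move=> [/coset_mem[e Ee ->] Vae]; apply/coset_mem; exists e => //.
  apply: EVF; split=> //; have := mg_mul mV Va' Vae.
  by rewrite mulrA [a' * a]mulrC aa' mul1r.
have repr P : cosets U E P -> exists2 a, V a & P = setprod [set a] E.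
  move=> [u]; rewrite UE => -[e Ee [a Va ->]] <-; exists a => //.
  apply: coset_eq => //; apply/coset_mem; exists e => //; exact: mulrC.
exists (fun P => P `&` V); split.
  split.
  - move=> P /repr[a Va ->]; rewrite /= trace//; by exists a.
  - move=> P Q /set_mem/repr[a Va ->] /set_mem/repr[b Vb ->]; rewrite !trace// => e.
    apply: coset_eq => //.
    have : setprod [set a] F a by apply/coset_mem; exists 1; [exact: mg_1|rewrite mulr1].
    rewrite e => /coset_mem[f Ff ->]; apply/coset_mem; exists f => //; exact: FE.
  - move=> _ [a Va <-]; exists (setprod [set a] E); last exact: trace.
    exists a => //; rewrite UE; exists 1; first exact: mg_1.
    by exists a => //; rewrite mul1r.
move=> P Q /repr[a Va ->] /repr[b Vb ->].
rewrite /= coset_mul// (trace _ (mg_mul mV Va Vb)) (trace _ Va) (trace _ Vb).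
by rewrite coset_mul.
Qed.

Lemma setprod_group_sub U E V : multiplicative_group U -> E `<=` U -> V `<=` U ->
  setprod E V `<=` U.
Proof. by move=> mU EU VU _ [a /EU Ua [b /VU Ub ->]]; exact: mg_mul. Qed.

End quotient_groups.

Section ideals_of_fourier_stieltjes_algebra.
Variables (R : realType) (G : topologicalGroupType).
Local Notation C := (Cplx R).
Local Notation T := (G -> C).
Local Notation FS := (FS R G).
Local Notation BA := (@FS_banach_algebra R G).
Implicit Types (u v a b : T).

Record fs_ideal (S : set T) : Prop := FsIdeal {
  fi_sub : S `<=` FS ;
  fi_0 : S 0 ;
  fi_lin : forall (c : C) u v, S u -> S v -> S (c *: u + v) ;
  fi_mul : forall u v, FS u -> S v -> S (u * v) }.

Variable S : set T.
Hypothesis SI : fs_ideal S.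
Local Notation S1 := (unitization S).

Lemma fi_scale (c : C) u : S u -> S (c *: u).
Proof. by move=> Su; rewrite -[c *: u]addr0; apply: (fi_lin SI) => //; exact: (fi_0 SI). Qed.

Lemma fi_add u v : S u -> S v -> S (u + v).
Proof. by move=> Su Sv; rewrite -[u]scale1r; exact: (fi_lin SI). Qed.

Lemma unitization_FS : S1 `<=` FS.
Proof. by move=> _ [a /(fi_sub SI) Fa [c ->]]; apply: (ba_add BA) => //; exact: (ba_cst BA). Qed.

Lemma unitization_cst (c : C) : S1 (cst c).
Proof. by exists 0; [exact: (fi_0 SI)|exists c; rewrite add0r]. Qed.

Lemma unitization_1 : S1 1. Proof. exact: unitization_cst. Qed.

Lemma unitization_sub a : S a -> S1 a.
Proof. by move=> Sa; exists a => //; exists 0; apply/funext => x; rewrite fctE addr0. Qed.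

Lemma unitization_add u v : S1 u -> S1 v -> S1 (u + v).
Proof.
move=> hu hv; rewrite -[u]scale1r; apply: unitization_lin => //; exact: (fi_lin SI).
Qed.

Lemma unitization_opp u : S1 u -> S1 (- u).
Proof.
move=> hu; rewrite -scaleN1r -[_ *: _]addr0; apply: unitization_lin => //.
  exact: (fi_lin SI).
exact: unitization_sub (fi_0 SI).
Qed.

Lemma unitization_mul u v : S1 u -> S1 v -> S1 (u * v).
Proof.
move=> [a Sa [c ->]] [b Sb [d ->]].
exists (a * b + (c *: b + d *: a)).
  apply: fi_add; first by apply: (fi_mul SI) => //; exact: (fi_sub SI).
  by apply: fi_add; exact: fi_scale.
exists (c * d); apply/funext => x; rewrite !fctE.
have E (z w : C) : z *: w = z * w by [].
by rewrite !E; ring.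
Qed.

(** e^(a + c) is e^c plus an element of the ideal generated by a. *)
Lemma cexp_add_cst a (c : C) : cexp (R := R) \o (a + cst c) =
  cexp c *: (a * (fun x => expser 1 (a x))) + cst (cexp c).
Proof.
apply/funext => x; rewrite /= [(a + cst c) x]/(a x + c) addrC cexpD cexp_rec1 !fctE.
have E (z w : C) : z *: w = z * w by [].
by rewrite E; ring.
Qed.

Lemma unitization_cexp u : S1 u -> S1 (cexp (R := R) \o u).
Proof.
move=> [a Sa [c ->]]; rewrite cexp_add_cst; eexists; last by eexists.
apply: fi_scale; rewrite mulrC; apply: (fi_mul SI) => //.
by have [] := expser_ba BA 1 (fi_sub SI Sa).
Qed.

Local Notation E := [set cexp (R := R) \o a | a in S1].

Lemma exp_group : multiplicative_group E.
Proof.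
split.
- exists 0; first exact: unitization_sub (fi_0 SI).
  by apply/funext => x; exact: cexp0.
- move=> _ _ [a Sa <-] [b Sb <-]; exists (a + b); first exact: unitization_add.
  by apply/funext => x; exact: cexpD.
- move=> _ [a Sa <-]; exists (cexp (R := R) \o (- a)).
    by exists (- a) => //; exact: unitization_opp.
  by apply/funext => x; exact: cexpN.
Qed.

Lemma invertible_group : multiplicative_group (invertibles S1).
Proof.
split.
- by split; [exact: unitization_1|exists 1; [exact: unitization_1|rewrite mulr1]].
- move=> a b [Sa [a' Sa' aa']] [Sb [b' Sb' bb']]; split; first exact: unitization_mul.
  exists (a' * b'); first exact: unitization_mul.
  have -> : a * b * (a' * b') = (a * a') * (b * b') by ring.
  by rewrite aa' bb' mulr1.
- move=> a [Sa [a' Sa' aa']]; exists a' => //; split=> //.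
  by exists a => //; rewrite mulrC.
Qed.

Lemma exp_sub_invertible : E `<=` invertibles S1.
Proof.
move=> u Eu; have [v Ev uv] := mg_inv exp_group Eu.
have sub w : E w -> S1 w by move=> [a Sa <-]; exact: unitization_cexp.
by split; [exact: sub|exists v => //; exact: sub].
Qed.

(** An inverse in B(G) suffices, since 1 / (a + c) = 1 / c - v a / c. *)
Lemma invertible_in_unitization a (c : C) v : S a -> c != 0 -> FS v ->
  (a + cst c) * v = 1 -> invertibles S1 (a + cst c).
Proof.
move=> Sa c0 Fv e; split; first by exists a => //; exists c.
exists v => //; exists ((- c^-1) *: (v * a)); first by apply: fi_scale; exact: (fi_mul SI).
exists c^-1; apply/funext => x.
have ex : (a x + c) * v x = 1 by have := congr1 (@^~ x) e.
rewrite !fctE; have E' (z w : C) : z *: w = z * w by [].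
rewrite E'; apply: (mulfI c0).
have -> : c * (- c^-1 * (v x * a x) + c^-1) = c * c^-1 * (1 - v x * a x) by ring.
by rewrite divff// mul1r -ex; ring.
Qed.

End ideals_of_fourier_stieltjes_algebra.

Section comparison.
Variables (R : realType) (G : topologicalGroupType).
Hypothesis hG : hausdorff_space G.
Hypothesis lcG : locally_compact [set: G].
Local Notation C := (Cplx R).
Local Notation T := (G -> C).
Variable I : T -> C.
Hypothesis HI : left_haar_integral I.
Local Notation FS := (FS R G).
Local Notation B0 := (rajchman_algebra R G).
Local Notation A := (fourier_algebra I).
Local Notation B1 := (unitization B0).
Local Notation A1 := (unitization A).
Local Notation N := (@pd_norm R G).
Local Notation BA := (@FS_banach_algebra R G).
Local Notation exps S := [set cexp (R := R) \o a | a in S].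

Lemma rajchman_ideal : fs_ideal B0.
Proof. by split; [move=> u []|exact: B0_0|exact: B0_lin|exact: B0_mul]. Qed.

Lemma fourier_ideal : fs_ideal A.
Proof.
split; first by move=> u /(fourier_algebra_sub hG lcG HI)[].
- exact: fourier_algebra_0.
- exact: fourier_algebra_lin.
- exact: fourier_algebra_mul.
Qed.

Lemma fourier_unitization_sub : A1 `<=` B1.
Proof.
by move=> _ [a /(fourier_algebra_sub hG lcG HI) Ba [c ->]]; exists a => //; exists c.
Qed.

Lemma fourier_invertible_sub : invertibles A1 `<=` invertibles B1.
Proof.
move=> u [hu [v hv uv]]; split; first exact: fourier_unitization_sub.
by exists v => //; exact: fourier_unitization_sub.
Qed.

Lemma compact_fourier_algebra : compact [set: G] -> A = B0.
Proof.
move=> cG; apply/seteqP; split; first exact: (fourier_algebra_sub hG lcG HI).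
move=> u [Fu _]; apply: fourier_algebra_cs => //.
by apply: (subclosed_compact _ cG) => //; exact: closed_closure.
Qed.

Hypothesis ncG : ~ compact [set: G].
Hypothesis reg : regular_algebra B0.

Lemma fourier_cpd_positive (K : set G) : compact K -> exists v : G -> R,
  [/\ A (fun x => rc (v x)), forall x, 0 <= v x & forall x, K x -> 0 < v x].
Proof.
move=> cK; have [v [h1 h2 h3 h4]] := exists_cpd_positive hG lcG HI cK.
by exists v; split=> //; apply: fourier_algebra_cs => //; exact: FS_cpd.
Qed.

(** By hypothesis b h lies in the ideal A(G), where h = (e^b - 1) / b.  One would
    like to divide by h.  Off a compact set |b| < 1/2, where h has no zero; adding
    to |h|^2 a function v of A(G) that is positive on the compact set produces an
    invertible element, and b (|h|^2 + v) is still in A(G). *)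
Lemma exp_fourier_log b : B0 b -> A (b * (fun x => expser 1 (b x))) -> A b.
Proof.
move=> hb Abh; have Fb := hb.1.
pose h x := expser 1 (b x); pose p : T := b * (fun x => expser 2 (b x)).
have [F2 _] := expser_ba BA 2 Fb.
have hp x : h x = 1 + p x by exact: expser1_rec.
have Bp : B0 p by rewrite /p mulrC; exact: B0_mul.
pose pc : T := fun x => Num.conj (p x).
have Bpc : B0 pc.
  case: Bp => Fp [cp p0]; split; first exact: FS_conj.
  split; first exact: continuousC_conj.
  by move=> e /p0[K cK hK]; exists K => // x /hK; rewrite /pc modulus_conj.
have half : (0 : R) < 2^-1 by rewrite invr_gt0.
have [K cK hK] := hb.2.2 _ half.
have [v [Av v0 vK]] := fourier_cpd_positive cK.
pose vc : T := fun x => rc (v x).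
have Bv : B0 vc by exact: (fourier_algebra_sub hG lcG HI).
(* q + 1 = |h|^2 + v, where h = 1 + p. *)
pose q : T := p + (pc + (p * pc + vc)).
have Bq : B0 q.
  have Fp : FS p by case: Bp.
  apply: B0_add => //; apply: B0_add => //; apply: B0_add => //.
  exact: B0_mul.
have hc x : Num.conj (h x) = 1 + pc x by rewrite hp (rmorphD (@Num.conj C)) /= conjC1.
have qE x : q x + 1 = h x * Num.conj (h x) + rc (v x).
  by rewrite hc hp /q !fctE /vc; ring.
have [x|j Bj qj] := nonvanishing_invertible hG ncG reg Bq (oner_neq0 _).
  rewrite qE mulC_conj -rcD -[0]/(rc 0) (inj_eq (@rcI R)) gt_eqF//.
  have [Kx|/hK nKx] := pselect (K x).
    by rewrite ltr_wpDl ?vK// exprn_ge0 ?modulus_ge0.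
  by rewrite ltr_pwDl ?v0// exprn_gt0// modulus_gt0 expser1_neq0.
have Fj : FS j := unitization_FS rajchman_ideal Bj.
have Fpc1 : FS (pc + 1) by apply: (ba_add BA); [case: Bpc|exact: (ba1 BA)].
have -> : b = j * ((pc + 1) * (b * h) + b * vc).
  apply/funext => x; rewrite -[LHS]mulr1.
  have qjx : (q x + 1) * j x = 1 by have := congr1 (@^~ x) qj.
  rewrite -qjx qE !fctE hc /vc.
  ring.
apply: (fourier_algebra_mul Fj); apply: (fi_add fourier_ideal).
  exact: (fourier_algebra_mul Fpc1).
by apply: (fourier_algebra_mul Fb).
Qed.

(** If e^(b + c) = a + c' with a in A(G), comparison of the parts in B0(G) shows
    that e^b - 1 is in A(G), and so is b. *)
Lemma exp_meets_fourier : exps B1 `&` invertibles A1 `<=` exps A1.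
Proof.
move=> w [[b [b0 Bb0 [c ->]] <-] [[a Aa [c' e]] _]].
exists (b0 + cst c) => //; exists b0; last by exists c.
apply: exp_fourier_log => //.
have [F1 _] := expser_ba BA 1 Bb0.1.
pose y : T := b0 * (fun x => expser 1 (b0 x)).
have By : B0 y by rewrite /y mulrC; exact: B0_mul.
have Ba : B0 a by exact: (fourier_algebra_sub hG lcG HI).
rewrite cexp_add_cst in e.
have [_ ya] := unitization_unique ncG (B0_scale hG (cexp c) By) Ba e.
have -> : b0 * (fun x => expser 1 (b0 x)) = (cexp c)^-1 *: a.
  by rewrite -ya scalerA mulVf ?scale1r// cexp_neq0.
exact: fourier_algebra_scale.
Qed.

(** b is small at some point, where the inverse would be large. *)
Lemma invertible_constant_neq0 b (c : C) : B0 b -> invertibles B1 (b + cst c) -> c != 0.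
Proof.
move=> Bb [_ [v Bv bv]]; apply/negP => /eqP c0; rewrite {}c0 in bv.
have Fv := unitization_FS rajchman_ideal Bv; have n0 := pd_norm_ge0 v.
have e0 : 0 < (N v + 1)^-1 by rewrite invr_gt0; lra.
have [x hx] := C0_small_point ncG Bb.2 e0.
have bvx : b x * v x = 1.
  by have := congr1 (@^~ x) bv; rewrite !fctE addr0.
have := congr1 (@modulus R) bvx; rewrite modulusM modulus1 => m1.
have := FS_sup x Fv; have := modulus_ge0 (b x); have := modulus_ge0 (v x).
move: hx; rewrite -[_^-1]div1r ltr_pdivlMr; last lra.
nra.
Qed.

(** Write u = c (1 + b'), and choose v in A(G), v >= 0, so large on a compact set
    off which |b'| < 1/2 that b1 = b' / (1 + v) satisfies |b1| < 1 everywhere.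
    Then 1 + t b1 has no zero for t in [0, 1], so 1 + b1 is an exponential; and
    u / (1 + b1) is in A(G) + C1, because (b' - b1) / (1 + b1) = v b1 / (1 + b1)
    is a multiple of v. *)
Lemma invertible_factorization : invertibles B1 = setprod (exps B1) (invertibles A1).
Proof.
have BI := rajchman_ideal; have AI := fourier_ideal.
apply/seteqP; split; last first.
  apply: setprod_group_sub; first exact: invertible_group.
    exact: exp_sub_invertible.
  exact: fourier_invertible_sub.
move=> u Uu; have [[b Bb [c ue]] [w Bw uw]] := Uu; rewrite ue in Uu.
have c0 := invertible_constant_neq0 Bb Uu.
pose b' := c^-1 *: b; have Bb' : B0 b' by exact: B0_scale.
have Fb' : FS b' by case: Bb'.
have half : (0 : R) < 2^-1 by rewrite invr_gt0.
have [K cK hK] := Bb'.2.2 _ half.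
have [v [Av v0 vK]] := fourier_cpd_positive cK.
have cv : continuous v by exact: (continuousC_Re (FS_continuous (fi_sub AI Av))).
have [m m0 vm] : exists2 m : R, 0 < m & forall x, K x -> m <= v x.
  have [->|/set0P Kn0] := eqVneq K set0; first by exists 1.
  have [x /set_mem Kx hx] := compact_EVT_min Kn0 cK (continuous_subspaceT cv).
  by exists (v x); [exact: vK|move=> y Ky; apply: hx; exact: mem_set].
have nb0 := pd_norm_ge0 b'.
(* M v exceeds the supremum of |b'| on K. *)
pose M := (N b' + 1) / m.
have M0 : 0 <= M by rewrite divr_ge0 ?(ltW m0)//; lra.
have Mv x : K x -> N b' + 1 <= M * v x.
  by move=> Kx; rewrite /M mulrAC ler_pdivlMr// ler_wpM2l ?vm//; lra.
pose vc : T := rc M *: (fun x => rc (v x)).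
have Avc : A vc by exact: fourier_algebra_scale.
have vcE x : vc x = rc (M * v x) by rewrite rcM.
have Mv0 x : 0 <= M * v x by exact: mulr_ge0.
have [x|j Bj dj] := nonvanishing_invertible hG ncG reg
    (fourier_algebra_sub hG lcG HI Avc) (oner_neq0 _).
  rewrite vcE -[1]/(rc 1) -rcD -[0]/(rc 0) (inj_eq (@rcI R)) gt_eqF//.
  by rewrite ltr_wpDl.
have Fj := unitization_FS BI Bj.
have djx x : (rc (M * v x) + 1) * j x = 1.
  by rewrite -vcE; have := congr1 (@^~ x) dj.
pose b1 := j * b'; have Bb1 : B0 b1 by exact: B0_mul.
have b1_lt1 x : modulus (b1 x) < 1.
  have md : (M * v x + 1) * modulus (b1 x) = modulus (b' x).
    have bx : b' x = rc (M * v x + 1) * b1 x.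
      have -> : rc (M * v x + 1) = rc (M * v x) + 1 :> C by rewrite rcD.
      rewrite -[LHS]mul1r -[in LHS](djx x) -mulrA; reflexivity.
    by rewrite bx modulusM modulus_ge0_rc// addr_ge0.
  have [Kx|/hK nKx] := pselect (K x).
    have := Mv x Kx; have := FS_sup x Fb'; have := modulus_ge0 (b1 x); nra.
  by have := Mv0 x; have := modulus_ge0 (b1 x); nra.
have B1A := rajchman_unitization_banach R hG ncG.
have [|t t0 t1|beta Bbeta hbeta] := @log_of_invertible_segment _ _ _ _ B1A b1.
- exact: unitization_sub.
- have Btb : B0 (rc t *: b1) by exact: B0_scale.
  have [x|z Bz hz] := nonvanishing_invertible hG ncG reg Btb (oner_neq0 _).
    have -> : (rc t *: b1) x = rc t * b1 x by [].
    rewrite -modulus_gt0; have := modulusD (rc t * b1 x + 1) (- (rc t * b1 x)).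
    rewrite addrAC subrr add0r modulus1 modulusN modulusM modulus_ge0_rc//.
    have := b1_lt1 x; have := modulus_ge0 (b1 x); nra.
  by exists z => //; rewrite addrC.
have hbx x : cexp (beta x) = 1 + b1 x by have := congr1 (@^~ x) hbeta.
pose k : T := cexp (R := R) \o (- beta).
have Bk : B1 k by apply: (unitization_cexp BI); exact: (unitization_opp BI).
have Fk := unitization_FS BI Bk.
have kx x : (1 + b1 x) * k x = 1 by rewrite -hbx; exact: cexpN.
(* u = (1 + b1) (a + c), where k = 1 / (1 + b1). *)
pose a : T := c *: (k * ((b' * j) * vc)).
have Aa : A a.
  apply: fourier_algebra_scale; apply: fourier_algebra_mul => //.
  by apply: fourier_algebra_mul => //; exact: FS_mul.
have uE x : u x = cexp (beta x) * (a x + c).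
  rewrite hbx ue /a /b1 !fctE.
  have E (z y : C) : z *: y = z * y by [].
  have bE : b x = c * b' x by rewrite /b' fctE E mulVKf.
  rewrite E bE vcE.
  have -> : (1 + j x * b' x) * (c * (k x * (b' x * j x * rc (M * v x))) + c) =
    c * ((1 + j x * b' x) * k x * (b' x * (j x * rc (M * v x))) + (1 + j x * b' x)) by ring.
  have -> : (1 + j x * b' x) * k x = 1 by exact: kx.
  have -> : j x * rc (M * v x) = 1 - j x by rewrite -(djx x); ring.
  ring.
have aw : (a + cst c) * (w * (cexp (R := R) \o beta)) = 1.
  apply/funext => x; rewrite !fctE.
  have uwx : u x * w x = 1 by have := congr1 (@^~ x) uw.
  by transitivity (u x * w x) => //; rewrite uE /=; ring.
exists (cexp (R := R) \o beta); first by exists beta.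
exists (a + cst c); last by apply/funext => x; exact: uE.
apply: (invertible_in_unitization AI Aa c0 _ aw).
apply: FS_mul; first exact: (unitization_FS BI Bw).
by apply: (ba_cexp BA); exact: (unitization_FS BI Bbeta).
Qed.

End comparison.

Theorem mainTheorem2 (R : realType) (G : topologicalGroupType)
    (I : (G -> Cplx R) -> Cplx R) :
  hausdorff_space G -> locally_compact [set: G] ->
  left_haar_integral I ->
  regular_algebra (rajchman_algebra R G) ->
  let B1 := unitization (rajchman_algebra R G) in
  let A1 := unitization (fourier_algebra I) in
  quotients_isomorphic (invertibles B1) (exp_set I B1)
                       (invertibles A1) (exp_set I A1) /\
  invertibles B1 = setprod (exp_set I B1) (invertibles A1).
Proof.
move=> hG lcG HI reg B1 A1.
have BI := @rajchman_ideal R G hG; have AI := fourier_ideal hG lcG HI.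
rewrite !(exp_setE hG lcG HI); [|exact: (unitization_FS AI)|exact: (unitization_FS BI)].
have EB := exp_group BI; have EA := exp_group AI.
have EA_sub : [set cexp (R := R) \o a | a in A1] `<=` [set cexp (R := R) \o a | a in B1].
  by move=> _ [a ha <-]; exists a => //; exact: (fourier_unitization_sub hG lcG HI).
have [prod meet] : invertibles B1 = setprod [set cexp (R := R) \o a | a in B1] (invertibles A1)
    /\ [set cexp (R := R) \o a | a in B1] `&` invertibles A1 `<=`
       [set cexp (R := R) \o a | a in A1].
  have [cG|ncG] := pselect (compact [set: G]); last first.
    by split; [exact: (invertible_factorization hG lcG HI)|exact: (exp_meets_fourier hG lcG HI)].
  have A1B1 : A1 = B1 by rewrite /A1 (compact_fourier_algebra hG lcG HI cG).
  rewrite A1B1; split; last by move=> u [].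
  apply/seteqP; split; last first.
    by apply: (setprod_group_sub (invertible_group BI)) => //; exact: exp_sub_invertible.
  by move=> u hu; exists 1; [exact: mg_1|exists u => //; rewrite mul1r].
split=> //; apply: quotients_isomorphic_of_product => //.
  exact: invertible_group.
exact: exp_sub_invertible.
Qed.
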